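(* Let $\Theta$ be an open subset of $\mathbb{R}^d$, $\sigma>0$, $A\in\mathbb{R}^{M\times P}$, $\mu_0\in\mathbb{R}^P$, and $Y=\mu_0+W$ with $W\sim\mathcal N(0,\sigma^2\mathrm{Id}_P)$. Let $\mu:\mathbb{R}^P\times\Theta\to\mathbb{R}^P$ satisfy: (A.1) $y\mapsto\mu(y,\theta)$ is Lipschitz continuous with a Lipschitz constant $L_1$ independent of $\theta$; (A.2) $\mu(0,\theta)=0$ for every $\theta\in\Theta$; (A.3) $\theta\mapsto\mu(y,\theta)$ is Lipschitz continuous with a Lipschitz constant $L_2$ independent of $y$. Define the risk $R(\mu_0,\theta)=\mathbb{E}_W\|A(\mu(Y,\theta)-\mu_0)\|^2$ and the degrees of freedom $\mathrm{df}(\mu_0,\theta)=\sum_{i=1}^P\operatorname{cov}\big((AY)_i,(A\mu(Y,\theta))_i\big)/\sigma^2$. For $\epsilon>0$ define $$\widehat{\mathrm{df}}^{\mathrm{FD}}(y,\theta,\epsilon)=\frac1\epsilon\sum_{i=1}^P\big(A^*A(\mu(y+\epsilon e_i,\theta)-\mu(y,\theta))\big)_i,$$ $$\nabla_2\widehat{\mathrm{df}}^{\mathrm{FD}}(y,\theta,\epsilon)=\frac1\epsilon\sum_{i=1}^P\big(J_2\mu(y+\epsilon e_i,\theta)-J_2\mu(y,\theta)\big)^*A^*Ae_i,$$ $$\mathrm{SUGAR}^{\mathrm{FD}}(y,\theta,\epsilon)=2\,J_2\mu(y,\theta)^*A^*A(\mu(y,\theta)-y)+2\sigma^2\,\nabla_2\widehat{\mathrm{df}}^{\mathrm{FD}}(y,\theta,\epsilon).$$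 Then $\theta\mapsto R(\mu_0,\theta)$ and $\theta\mapsto\mathrm{df}(\mu_0,\theta)$ are weakly differentiable, and for any Lebesgue point $\theta$, $$\lim_{\epsilon\to0}\mathbb{E}_W\big[\mathrm{SUGAR}^{\mathrm{FD}}(Y,\theta,\epsilon)\big]=\nabla_2R(\mu_0,\theta)\quad\text{and}\quad\lim_{\epsilon\to0}\mathbb{E}_W\big[\nabla_2\widehat{\mathrm{df}}^{\mathrm{FD}}(Y,\theta,\epsilon)\big]=\nabla_2\mathrm{df}(\mu_0,\theta).$$
   Context: $(e_i)_{1\le i\le P}$ is the canonical basis of $\mathbb{R}^P$. $J_2\mu(y,\theta)\in\mathbb{R}^{P\times d}$ is the weak Jacobian of $\mu$ with respect to $\theta$, and $\nabla_2 f=J_2f^*$ is the weak gradient with respect to $\theta$. Weak derivatives are defined Lebesgue-almost everywhere, and pointwise identities involving them are understood at Lebesgue points (i.e. Lebesgue-a.e.). $\mathbb{E}_W$ denotes expectation with respect to the noise $W$.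
   Formalization: The sum defining the degrees of freedom runs over i = 1,…,M (the dimension of AY) instead of i = 1,…,P, since (AY)_i is undefined for i > M and the claim fails for the literal sum when M > P. *)

(* Defs.v *)
From HB Require Import structures.
From mathcomp Require Import all_boot all_order all_algebra.
From mathcomp Require Import all_classical all_reals all_analysis.

Set Implicit Arguments.
Unset Strict Implicit.
Unset Printing Implicit Defensive.

Import Order.TTheory GRing.Theory Num.Theory.
Import numFieldNormedType.Exports.

Local Open Scope classical_set_scope.
Local Open Scope ring_scope.

Section Defs.
Variable R : realType.

Definition ecv (n : nat) (i : 'I_n) : 'cV[R]_n := delta_mx i 0.

Definition enorm2 (n : nat) (v : 'cV[R]_n) : R := \sum_(i < n) (v i 0) ^+ 2.
Definition enorm (n : nat) (v : 'cV[R]_n) : R := Num.sqrt (enorm2 v).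

(* Lebesgue integration on R^n, realised as the iterated integral of   *)
(* the one-dimensional Lebesgue measure over n.-tuples (which carry    *)
(* the product sigma-algebra of the library).                          *)

Definition col_of_tuple (n : nat) (t : n.-tuple (measurableTypeR R)) : 'cV[R]_n :=
  \col_(i < n) (tnth t i : R).

Fixpoint iint (n : nat) : (n.-tuple (measurableTypeR R) -> \bar R) -> \bar R :=
  match n return (n.-tuple (measurableTypeR R) -> \bar R) -> \bar R with
  | 0 => fun f => f [tuple]
  | n'.+1 => fun f =>
      (\int[@lebesgue_measure R]_x iint (fun t => f (cons_tuple x t)))%E
  end.

Definition integral_on (n : nat) (D : set 'cV[R]_n) (f : 'cV[R]_n -> \bar R)
  : \bar R :=
  iint (fun t => ((\1_D (col_of_tuple t))%:E * f (col_of_tuple t))%E).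

Definition mset (n : nat) (D : set 'cV[R]_n) : Prop :=
  measurable (@col_of_tuple n @^-1` D).

Definition mfun_on (n : nat) (D : set 'cV[R]_n) (f : 'cV[R]_n -> R) : Prop :=
  measurable_fun (@col_of_tuple n @^-1` D) (f \o @col_of_tuple n).

Definition negligible (n : nat) (N : set 'cV[R]_n) : Prop :=
  exists B, mset B /\ N `<=` B /\ integral_on B (fun=> 1%E) = 0%E.

Definition ae_on (n : nat) (D : set 'cV[R]_n) (Q : 'cV[R]_n -> Prop) : Prop :=
  exists N, negligible N /\ forall x, D x -> ~ N x -> Q x.

Definition loc_integrable (n : nat) (O : set 'cV[R]_n) (f : 'cV[R]_n -> R) :=
  mfun_on O f /\
  forall K, compact K -> K `<=` O ->
    (integral_on K (fun x => (`|f x|)%:E) < +oo)%E.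

Fixpoint pder (n : nat) (s : seq 'I_n) (phi : 'cV[R]_n -> R) : 'cV[R]_n -> R :=
  match s with
  | [::] => phi
  | j :: s' => fun x => derive (pder s' phi) x (ecv j)
  end.

Definition smooth (n : nat) (phi : 'cV[R]_n -> R) : Prop :=
  forall s : seq 'I_n, continuous (pder s phi) /\
    forall (j : 'I_n) x, derivable (pder s phi) x (ecv j).

Definition test_fun (n : nat) (O : set 'cV[R]_n) (phi : 'cV[R]_n -> R) : Prop :=
  smooth phi /\
  exists K, compact K /\ K `<=` O /\ forall x, ~ K x -> phi x = 0.

Definition weak_gradient (n : nat) (O : set 'cV[R]_n)
  (f : 'cV[R]_n -> R) (g : 'cV[R]_n -> 'cV[R]_n) : Prop :=
  loc_integrable O f /\
  (forall j : 'I_n, loc_integrable O (fun x => g x j 0)) /\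
  forall phi, test_fun O phi -> forall j : 'I_n,
    integral_on O (fun x => (f x * pder [:: j] phi x)%:E) =
    (- integral_on O (fun x => (g x j 0 * phi x)%:E))%E.

Definition weakly_differentiable (n : nat) (O : set 'cV[R]_n)
  (f : 'cV[R]_n -> R) : Prop := exists g, weak_gradient O f g.

Definition weak_jacobian (n p : nat) (O : set 'cV[R]_n)
  (F : 'cV[R]_n -> 'cV[R]_p) (G : 'cV[R]_n -> 'M[R]_(p, n)) : Prop :=
  forall i : 'I_p,
    weak_gradient O (fun x => F x i 0) (fun x => \col_(j < n) G x i j).

Definition gauss_density (P : nat) (sigma : R) (mu0 : 'cV[R]_P) (y : 'cV[R]_P)
  : R :=
  (Num.sqrt (2 * pi * sigma ^+ 2))^-1 ^+ P *
  expR (- enorm2 (y - mu0) / (2 * sigma ^+ 2)).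

Definition gexp (P : nat) (sigma : R) (mu0 : 'cV[R]_P) (h : 'cV[R]_P -> \bar R)
  : \bar R :=
  integral_on setT (fun y => (h y * (gauss_density sigma mu0 y)%:E)%E).

Definition gE (P : nat) (sigma : R) (mu0 : 'cV[R]_P) (h : 'cV[R]_P -> R) : R :=
  fine (gexp sigma mu0 (fun y => (h y)%:E)).

Definition gEv (P n : nat) (sigma : R) (mu0 : 'cV[R]_P) (h : 'cV[R]_P -> 'cV[R]_n)
  : 'cV[R]_n :=
  \col_(k < n) gE sigma mu0 (fun y => h y k 0).

Definition gcov (P : nat) (sigma : R) (mu0 : 'cV[R]_P) (X Z : 'cV[R]_P -> R) : R :=
  gE sigma mu0 (fun y => (X y - gE sigma mu0 X) * (Z y - gE sigma mu0 Z)).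

Section Quantities.
Variables (d P M : nat) (sigma : R) (A : 'M[R]_(M, P)) (mu0 : 'cV[R]_P)
  (mu : 'cV[R]_P -> 'cV[R]_d -> 'cV[R]_P).

Definition risk (theta : 'cV[R]_d) : R :=
  gE sigma mu0 (fun y => enorm2 (A *m (mu y theta - mu0))).

Definition dof (theta : 'cV[R]_d) : R :=
  (\sum_(i < M) gcov sigma mu0 (fun y => (A *m y) i 0)
                               (fun y => (A *m mu y theta) i 0)) / sigma ^+ 2.

Definition df_FD (y : 'cV[R]_P) (theta : 'cV[R]_d) (eps : R) : R :=
  eps^-1 * \sum_(i < P)
    ((A^T *m A) *m (mu (y + eps *: ecv i) theta - mu y theta)) i 0.

Variable J : 'cV[R]_P -> 'cV[R]_d -> 'M[R]_(P, d). (* J_2 mu *)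

Definition grad_df_FD (y : 'cV[R]_P) (theta : 'cV[R]_d) (eps : R) : 'cV[R]_d :=
  eps^-1 *: \sum_(i < P)
    ((J (y + eps *: ecv i) theta - J y theta)^T *m (A^T *m A) *m ecv i).

Definition SUGAR_FD (y : 'cV[R]_P) (theta : 'cV[R]_d) (eps : R) : 'cV[R]_d :=
  2 *: ((J y theta)^T *m (A^T *m A) *m (mu y theta - y)) +
  (2 * sigma ^+ 2) *: grad_df_FD y theta eps.

End Quantities.

Definition jmeasurable (P d p q : nat) (D : set 'cV[R]_d)
  (F : 'cV[R]_P -> 'cV[R]_d -> 'M[R]_(p, q)) : Prop :=
  forall (i : 'I_p) (j : 'I_q),
    measurable_fun (setT `*` (@col_of_tuple d @^-1` D))
      (fun z : P.-tuple (measurableTypeR R) * d.-tuple (measurableTypeR R) =>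
         F (col_of_tuple z.1) (col_of_tuple z.2) i j).

End Defs.

(* Main.v *)
(* A function that is Lipschitz on an open set extends to R^n (McShane), is
   differentiable along each coordinate line at almost every point of that line
   (Lebesgue's theorem in dimension one), and its a.e. partial derivatives are its
   weak gradient. The risk and the degrees of freedom are Lipschitz in theta, so
   their weak gradients are a.e. limits of difference quotients. By Fubini, for
   a.e. theta the difference quotients of mu(y, .) converge to J y theta for a.e.
   y, hence by dominated convergence the weak gradients of the risk and of the
   degrees of freedom are Gaussian expectations involving J. The finite
   difference in y is moved onto the Gaussian density by translation invariance,
   and its limit is E[h(Y) (Y - mu0)_i] / sigma^2 (Stein's identity, without any
   differentiability of h); this is the same expression as the one obtained from
   the covariance. *)
Require Import Defs.
From HB Require Import structures.
From mathcomp Require Import all_boot all_order all_algebra.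
From mathcomp Require Import all_classical all_reals all_analysis.
From mathcomp Require Import measurable_realfun ring lra.
Import Order.TTheory GRing.Theory Num.Theory.
Import numFieldNormedType.Exports.
Local Open Scope classical_set_scope.
Local Open Scope ring_scope.

Set Implicit Arguments.
Unset Strict Implicit.
Unset Printing Implicit Defensive.

(** * Lebesgue measure on tuples *)

(** The integrals of the statement are iterated one-dimensional integrals, not integrals against a
    measure. They are matched with a product measure [tmeas], for nonnegative measurable and for
    integrable functions, so that the convergence theorems apply. The main obstacle is that each
    [J y] is determined only up to a null set of parameters that depends on [y], and there are
    uncountably many [y]. Joint measurability of [J] turns these null sets into slices of one
    measurable set, and Tonelli then exchanges the two almost-everywhere quantifiers. The gradients
    [gR] and [gdf] have to be fixed before [J]. They are built so that, at every parameter of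
    [Theta] where the difference quotients converge, they take that limit as their value. The
    exceptional set of the conclusion therefore comes from [J] alone. All difference quotients in
    the parameter use the steps 1/(k+1). A sequence of steps is enough to integrate by parts against
    a translation, and it keeps upper limits and sets of convergence measurable. *)

Section tuple_measure.
Context {R : realType}.
Local Notation RT := (measurableTypeR R).
Local Notation leb := (@lebesgue_measure R).

Lemma measurable_cons_tuple n :
  measurable_fun setT (fun p : RT * n.-tuple RT => cons_tuple p.1 p.2).
Proof. exact: measurable_cons. Qed.

(** Pushing the product measure forward along [cons_tuple] makes one step of the integral against it
    coincide with one step of [iint]. *)
Definition consm n (m : {sigma_finite_measure set (n.-tuple RT) -> \bar R}) :
    set (n.+1.-tuple RT) -> \bar R :=
  pushforward (leb \x m)%E (fun p : RT * n.-tuple RT => cons_tuple p.1 p.2).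

Section consm.
Variables (n : nat) (m : {sigma_finite_measure set (n.-tuple RT) -> \bar R}).

Let m0 : consm m set0 = 0%E.
Proof. by rewrite /consm /pushforward preimage_set0 measure0. Qed.
Let m_ge0 A : (0 <= consm m A)%E.
Proof. by rewrite /consm /pushforward; exact: measure_ge0. Qed.
Let m_sa : semi_sigma_additive (consm m).
Proof.
move=> F mF tF mUF; rewrite /consm /pushforward preimage_bigcup.
have mc A : measurable A ->
    measurable ((fun p : RT * n.-tuple RT => cons_tuple p.1 p.2) @^-1` A).
  by move=> mA; rewrite -[X in measurable X]setTI; exact: measurable_cons_tuple.
apply: measure_semi_sigma_additive.
- by move=> k; exact: (mc _ (mF k)).
- apply/trivIsetP => /= i j _ _ ij; rewrite -preimage_setI.
  by move/trivIsetP : tF => /(_ _ _ _ _ ij) ->//; rewrite preimage_set0.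
- by rewrite -preimage_bigcup; exact: mc.
Qed.

HB.instance Definition _ := isMeasure.Build _ _ _ (consm m) m0 m_ge0 m_sa.

Let m_sf : sigma_finite setT (consm m).
Proof.
have /sigma_finiteP[F [TF ndF Foo]] := sigma_finiteT leb.
have /sigma_finiteP[G [TG ndG Goo]] := sigma_finiteT m.
exists (fun k => [set t | F k (thead t) /\ G k (behead_tuple t)]).
  rewrite predeqE => t; split=> // _.
  have : [set: RT] (thead t) by [].
  rewrite TF => -[i _ Fi].
  have : [set: n.-tuple RT] (behead_tuple t) by [].
  rewrite TG => -[k _ Gk]; exists (maxn i k) => //; split.
  - by move: Fi; exact/subsetPset/ndF/leq_maxl.
  - by move: Gk; exact/subsetPset/ndG/leq_maxr.
move=> k; have [? ?] := Foo k; have [? ?] := Goo k; split.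
  apply: measurableI.
    rewrite -[X in measurable X]setTI.
    exact: (@measurable_tnth _ RT n.+1 ord0).
  rewrite -[X in measurable X]setTI.
  exact: (@measurable_behead _ RT n).
rewrite /consm /pushforward [X in (leb \x m)%E X](_ : _ = F k `*` G k).
  by rewrite product_measure1E// lte_mul_pinfty// ge0_fin_numE.
have bK x (t : n.-tuple RT) : behead_tuple (cons_tuple x t) = t by exact/val_inj.
by apply/seteqP; split => -[x t] /=; rewrite theadE bK.
Qed.

HB.instance Definition _ := Measure_isSigmaFinite.Build _ _ _ (consm m) m_sf.
End consm.

Fixpoint tmeas n : {sigma_finite_measure set (n.-tuple RT) -> \bar R} :=
  if n is n'.+1 then consm (tmeas n') else \d_[tuple].

Lemma ge0_integral_tmeasS n (f : n.+1.-tuple RT -> \bar R) :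
  measurable_fun [set: _.-tuple RT] f -> (forall t, 0 <= f t)%E ->
  (\int[tmeas n.+1]_t f t = \int[leb]_x \int[tmeas n]_t f (cons_tuple x t))%E.
Proof.
move=> mf f0.
rewrite [LHS](@ge0_integral_pushforward _ _ _ _ _ _ (@measurable_cons_tuple n)
  (leb \x tmeas n)%E setT f)//=.
rewrite preimage_setT fubini_tonelli1//=.
by apply: measurableT_comp => //; exact: measurable_cons_tuple.
Qed.

Lemma measurable_cons_tuplel n (x : RT) :
  measurable_fun setT (fun t : n.-tuple RT => cons_tuple x t).
Proof. by apply: measurable_cons. Qed.

Lemma iint_ge0E n (f : n.-tuple RT -> \bar R) :
  measurable_fun [set: _.-tuple RT] f -> (forall t, 0 <= f t)%E ->
  iint f = (\int[tmeas n]_t f t)%E.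
Proof.
elim: n f => [f mf f0|n IH f mf f0] /=.
  by rewrite integral_dirac// diracT mul1e.
rewrite ge0_integral_tmeasS//; apply: eq_integral => x _.
by apply: IH => //; apply: measurableT_comp => //; exact: measurable_cons_tuplel.
Qed.

(** The integrals of the positive and of the negative part are measurable by Tonelli, hence so is
    their difference, finite or not. *)
Lemma measurable_integral_snd d1 d2 (T1 : measurableType d1)
    (T2 : measurableType d2) (m : {sigma_finite_measure set T2 -> \bar R})
    (f : T1 * T2 -> \bar R) :
  measurable_fun setT f ->
  measurable_fun setT (fun x => \int[m]_y f (x, y))%E.
Proof.
move=> mf; under eq_fun do rewrite integralE.
apply: emeasurable_funB.
- rewrite (_ : (fun x => _) = fubini_F m f^\+)%E; last first.
    by apply/funext => x; apply: eq_integral => y _; rewrite ?funeposE ?funenegE.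
  by apply: measurable_fun_fubini_tonelli_F => //; exact: measurable_funepos.
- rewrite (_ : (fun x => _) = fubini_F m f^\-)%E; last first.
    by apply/funext => x; apply: eq_integral => y _; rewrite ?funeposE ?funenegE.
  by apply: measurable_fun_fubini_tonelli_F => //; exact: measurable_funeneg.
Qed.

(** The parameter space [T] is arbitrary because the induction moves the outermost integration
    variable into the parameter. *)
Lemma measurable_iint n d (T : measurableType d) (f : T * n.-tuple RT -> \bar R) :
  measurable_fun setT f -> measurable_fun setT (fun z => iint (fun t => f (z, t))).
Proof.
elim: n d T f => [d T f mf|n IH d T f mf] /=.
  by apply: measurableT_comp => //; exact: measurable_pair2.
apply: (@measurable_integral_snd _ _ _ _ leb
  (fun zx => iint (fun t => f (zx.1, cons_tuple zx.2 t)))).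
apply: (IH _ _ (fun z : (T * RT) * n.-tuple RT => f (z.1.1, cons_tuple z.1.2 z.2))).
apply: measurableT_comp => //; apply/measurable_fun_pairP; split.
  by apply: (@measurableT_comp _ _ _ _ _ _ fst _ fst).
apply: (@measurable_cons _ _ _ _ _ _ snd) => //.
by apply: (@measurableT_comp _ _ _ _ _ _ snd _ fst).
Qed.

(** Sections of an integrable function are integrable only for almost every first coordinate, so the
    induction hypothesis identifies the inner integrals almost everywhere. [measurable_iint] is what
    then allows the outer integrals to be compared. *)
Lemma iintE n (f : n.-tuple RT -> \bar R) :
  (tmeas n).-integrable setT f -> iint f = (\int[tmeas n]_t f t)%E.
Proof.
elim: n f => [f /integrableP[mf _]|n IH f intf] /=.
  by rewrite integral_dirac// diracT mul1e.
have mf := measurable_int _ intf.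
have mc := @measurable_cons_tuple n.
have intg : (leb \x tmeas n)%E.-integrable setT
    (f \o (fun p : RT * n.-tuple RT => cons_tuple p.1 p.2)).
  apply/integrableP; split; first exact: measurableT_comp.
  have /integrableP[_] := intf; apply: le_lt_trans.
  rewrite [leRHS](@ge0_integral_pushforward _ _ _ _ _ _ mc
    (leb \x tmeas n)%E setT (abse \o f))//=.
  by apply: measurableT_comp.
rewrite [RHS](@integral_pushforward _ _ _ _ _ _ mc (leb \x tmeas n)%E setT f)//=.
rewrite preimage_setT -integral12_prod_meas1//=.
apply: ae_eq_integral => //=.
- apply: (@measurable_iint _ _ RT (fun p => f (cons_tuple p.1 p.2))).
  exact: measurableT_comp.
- apply: (@measurable_integral_snd _ _ _ _ _ (fun p => f (cons_tuple p.1 p.2))).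
  exact: measurableT_comp.
have := ae_integrable1 intg; apply: filterS => x /= ix _.
exact: IH.
Qed.

End tuple_measure.

(** * Translation invariance, products and slices of the measure on tuples *)

Section tuple_measure_translation.
Context {R : realType}.
Local Notation RT := (measurableTypeR R).
Local Notation leb := (@lebesgue_measure R).
Local Notation col := (@col_of_tuple R _).

Lemma measurable_addr_RT (c : R) : measurable_fun setT (fun x : RT => (x + c)%R : RT).
Proof. exact: measurable_funD. Qed.

(** Lebesgue measure is the only measure that gives half-open intervals their length, and a
    translation preserves that length. *)
Lemma lebesgue_measureD (c : R) (A : set RT) : measurable A ->
  pushforward leb (fun x : RT => x + c : RT) A = leb A.
Proof.
move=> mA; apply/esym; apply: lebesgue_measure_unique => // [|m _ [[a b] _ <-]].
  exact: measurable_addr_RT.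
rewrite /= /pushforward (_ : _ @^-1` _ = `]a - c, b - c]%classic); last first.
  by apply/seteqP; split=> x /=; rewrite !in_itv/= ltrBlDr lerBrDr.
by rewrite !lebesgue_measure_itv/= !lte_fin ltrD2r; case: ifP => // _; rewrite -!EFinB opprB addrA subrK.
Qed.

Lemma ge0_integral_lebesgueD (c : R) (f : RT -> \bar R) :
  measurable_fun setT f -> (forall x, 0 <= f x)%E ->
  (\int[leb]_x f (x + c)%R = \int[leb]_x f x)%E.
Proof.
move=> mf f0.
have := @ge0_integral_pushforward _ _ _ _ _ _ (measurable_addr_RT c) leb setT f
  measurableT mf (fun x _ => f0 x).
rewrite preimage_setT => <-.
apply: eq_measure_integral => [|h A mA _]; first exact: measurable_addr_RT.
exact: lebesgue_measureD.
Qed.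

Definition taddv n (v : 'cV[R]_n) (t : n.-tuple RT) : n.-tuple RT :=
  [tuple (tnth t i + v i 0 : RT) | i < n].

Lemma col_taddv n (v : 'cV[R]_n) t : col (taddv v t) = col t + v.
Proof. by apply/matrixP => i j; rewrite !mxE tnth_mktuple ord1. Qed.

Lemma measurable_taddv n (v : 'cV[R]_n) : measurable_fun setT (taddv v).
Proof.
apply/measurable_fun_tnthP => i.
rewrite (_ : _ \o _ = fun t => tnth t i + v i 0); last first.
  by apply/funext => t /=; rewrite tnth_mktuple.
by apply: measurable_funD => //; exact: measurable_tnth.
Qed.

Lemma taddv_cons n (v : 'cV[R]_n.+1) x (t : n.-tuple RT) :
  taddv v (cons_tuple x t) =
  cons_tuple (x + v ord0 0 : RT) (taddv (\col_i v (lift ord0 i) 0) t).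
Proof.
apply: eq_from_tnth => i; rewrite tnth_mktuple.
case: (unliftP ord0 i) => [j ->|->]; last by rewrite !tnth0.
by rewrite !tnthS tnth_mktuple mxE.
Qed.

Lemma ge0_integral_taddv n (v : 'cV[R]_n) (f : n.-tuple RT -> \bar R) :
  measurable_fun setT f -> (forall t, 0 <= f t)%E ->
  (\int[tmeas n]_t f (taddv v t) = \int[tmeas n]_t f t)%E.
Proof.
elim: n v f => [v f mf f0|n IH v f mf f0].
  by apply: eq_integral => t _; rewrite (tuple0 (taddv v t)) [in RHS](tuple0 t).
have mfv : measurable_fun setT (fun t => f (taddv v t)).
  by apply: measurableT_comp => //; exact: measurable_taddv.
rewrite !ge0_integral_tmeasS//.
under eq_integral => x _ do under eq_integral => t _ do rewrite taddv_cons.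
pose F (x : RT) := (\int[tmeas n]_t f (cons_tuple x t))%E.
rewrite -[RHS](@ge0_integral_lebesgueD (v ord0 0) F); first last.
- by move=> x; apply: integral_ge0.
- apply: (@measurable_integral_snd _ _ _ _ _ _ (fun p => f (cons_tuple p.1 p.2))).
  by apply: measurableT_comp => //; exact: measurable_cons_tuple.
apply: eq_integral => x _.
rewrite (IH _ (fun t => f (cons_tuple (x + v ord0 0 : RT) t)))//.
by apply: measurableT_comp => //; exact: measurable_cons_tuplel.
Qed.

Lemma integral_taddv n (v : 'cV[R]_n) (f : n.-tuple RT -> \bar R) :
  measurable_fun setT f ->
  (\int[tmeas n]_t f (taddv v t) = \int[tmeas n]_t f t)%E.
Proof.
move=> mf; rewrite integralE [RHS]integralE; congr (_ - _)%E.
- rewrite -(@ge0_integral_taddv _ v f^\+%E)//; last exact: measurable_funepos.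
  by apply: eq_integral => t _; rewrite !funeposE.
- rewrite -(@ge0_integral_taddv _ v f^\-%E)//; last exact: measurable_funeneg.
  by apply: eq_integral => t _; rewrite !funenegE.
Qed.

Lemma integrable_taddv n (v : 'cV[R]_n) (f : n.-tuple RT -> \bar R) :
  (tmeas n).-integrable setT f ->
  (tmeas n).-integrable setT (fun t => f (taddv v t)).
Proof.
move=> /integrableP[mf lf]; apply/integrableP; split.
  by apply: measurableT_comp => //; exact: measurable_taddv.
rewrite (@ge0_integral_taddv _ v (abse \o f))//=.
exact: (@measurableT_comp _ _ _ _ _ _ abse).
Qed.

(** Used twice: with indicators of intervals for the volume of boxes, and with normal densities for
    the total mass of the Gaussian. *)
Lemma integral_tmeas_prod n (f : 'I_n -> R -> R) (c : 'I_n -> R) :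
  (forall i, measurable_fun setT (f i)) -> (forall i x, 0 <= f i x) ->
  (forall i, \int[leb]_x (f i x)%:E = (c i)%:E)%E ->
  (\int[tmeas n]_t (\prod_(i < n) f i (tnth t i))%:E = (\prod_(i < n) c i)%:E)%E.
Proof.
elim: n f c => [f c mf f0 fc|n IH f c mf f0 fc].
  under eq_integral do rewrite big_ord0.
  by rewrite integral_cst//= diracT mule1 big_ord0.
have mprod : forall k (g : 'I_k -> R -> R), (forall i, measurable_fun setT (g i)) ->
    measurable_fun setT (fun t : k.-tuple RT => (\prod_(i < k) g i (tnth t i))%:E).
  move=> k g mg; apply/measurable_EFinP.
  apply: measurable_prod => i _.
  exact: (measurableT_comp (mg i) (@measurable_tnth _ RT _ i)).
rewrite ge0_integral_tmeasS//; [|exact: mprod|]; last first.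
  by move=> t; rewrite lee_fin prodr_ge0.
have IHc : (\int[tmeas n]_t (\prod_(i < n) f (lift ord0 i) (tnth t i))%:E
    = (\prod_(i < n) c (lift ord0 i))%:E)%E.
  by apply: (IH (fun i => f (lift ord0 i)) (fun i => c (lift ord0 i))).
transitivity (\int[leb]_x ((\prod_(i < n) c (lift ord0 i))%:E * (f ord0 x)%:E))%E.
  apply: eq_integral => x _; rewrite -IHc muleC -ge0_integralZl//; first last.
  - by rewrite lee_fin.
  - by move=> t _; rewrite lee_fin prodr_ge0.
  - by apply: (mprod _ (fun i => f (lift ord0 i))).
  apply: eq_integral => t _; rewrite big_ord_recl tnth0 EFinM; congr (_ * _%:E)%E.
  by apply: eq_bigr => i _; rewrite tnthS.
rewrite ge0_integralZl//; first last.
- rewrite lee_fin prodr_ge0// => i _.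
  by rewrite -lee_fin -fc integral_ge0// => x _; rewrite lee_fin.
- by move=> x _; rewrite lee_fin.
- by apply/measurable_EFinP; exact: mf.
by rewrite fc big_ord_recl EFinM muleC.
Qed.

(* Averaging the translates of N over a segment of shifts and exchanging the integrals. *)
Lemma tmeas_slice0 n (v : 'cV[R]_n) (N : set (n.-tuple RT)) :
  measurable N ->
  (forall t, leb [set s | N (taddv (s *: v) t)] = 0%E) ->
  tmeas n N = 0%E.
Proof.
move=> mN N0.
have msh : measurable_fun setT (fun p : RT * n.-tuple RT => taddv (p.1 *: v) p.2).
  apply/measurable_fun_tnthP => i.
  rewrite (_ : _ \o _ = fun p => tnth p.2 i + p.1 * v i 0); last first.
    by apply/funext => t /=; rewrite tnth_mktuple mxE.
  apply: measurable_funD; last by apply: measurable_funM.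
  exact: (measurableT_comp (@measurable_tnth _ RT n i) measurable_snd).
pose f (p : RT * n.-tuple RT) : \bar R :=
  (\1_(`[0%R, 1%R]%classic : set RT) p.1 * \1_N (taddv (p.1 *: v) p.2))%:E.
have mf : measurable_fun setT f.
  apply/measurable_EFinP; apply: measurable_funM.
    by apply: measurableT_comp => //; exact: measurable_indic.
  by apply: measurableT_comp => //; exact: measurable_indic.
have f0 p : (0 <= f p)%E by rewrite lee_fin mulr_ge0.
have := @fubini_tonelli _ _ _ _ _ leb (tmeas n) f mf f0.
under eq_integral => x _.
  rewrite /f/=.
  under eq_integral do rewrite EFinM.
  rewrite ge0_integralZl//; last first.
    apply/measurable_EFinP; apply: measurableT_comp; first exact: measurable_indic.
    exact: measurable_taddv.
  rewrite (@ge0_integral_taddv _ _ (fun t => (\1_N t)%:E)); first last.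
  - by move=> t; rewrite lee_fin.
  - by apply/measurable_EFinP; exact: measurable_indic.
  rewrite integral_indic// setIT; over.
rewrite ge0_integralZr//; last first.
  by apply/measurable_EFinP; exact: measurable_indic.
rewrite integral_indic// setIT.
have leb01 : leb `[0%R, 1%R]%classic = 1%E.
  by have := @lebesgue_measure_itv R `[0%R, 1%R]; rewrite /= lte01 sube0.
move=> H; transitivity (leb `[0%R, 1%R]%classic * tmeas n N)%E.
  by rewrite leb01 mul1e.
apply: etrans; first exact: H.
apply: integral0_eq => t _.
have mNt : measurable [set s : RT | N (taddv (s *: v) t)].
  rewrite -[X in measurable X]setTI.
  exact: (measurableT_comp msh (measurable_pair2 t)) measurableT _ mN.
transitivity (\int[leb]_x (\1_(`[0%R, 1%R]%classic `&`
    [set s : RT | N (taddv (s *: v) t)]) x)%:E)%E.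
  by apply: eq_integral => x _; rewrite indicI.
rewrite integral_indic ?setIT//=; last exact: measurableI.
apply/eqP; rewrite -measure_le0 -(N0 t); apply: le_measure.
- by rewrite inE; exact: measurableI.
- by rewrite inE.
- exact: subIsetr.
Qed.

End tuple_measure_translation.

(** * Columns as tuples: boxes, open sets and joint measurability *)

Section col_vectors.
Context {R : realType}.
Local Notation RT := (measurableTypeR R).
Local Notation col := (@col_of_tuple R _).

Definition tuple_of_col n (v : 'cV[R]_n) : n.-tuple RT := [tuple (v i 0 : RT) | i < n].

Lemma tuple_of_colK n : cancel (@tuple_of_col n) (@col_of_tuple R n).
Proof. by move=> v; apply/matrixP => i j; rewrite mxE tnth_mktuple ord1. Qed.

Lemma col_of_tupleK n : cancel (@col_of_tuple R n) (@tuple_of_col n).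
Proof. by move=> t; apply: eq_from_tnth => i; rewrite tnth_mktuple mxE. Qed.

Lemma measurable_coord n (i : 'I_n) :
  measurable_fun setT (fun t : n.-tuple RT => col t i 0).
Proof.
rewrite (_ : (fun _ => _) = fun t : n.-tuple RT => tnth t i); last first.
  by apply/funext => t; rewrite mxE.
exact: measurable_tnth.
Qed.

Lemma cvg_cV (T : Type) (F : set_system T) {FF : Filter F} n (u : T -> 'cV[R]_n) (v : 'cV[R]_n) :
  (forall i, (fun k => u k i 0) @ F --> v i 0) -> u @ F --> v.
Proof.
move=> uv; apply/cvg_ballP => e e0.
have : \forall k \near F, forall i, ball (v i 0) e (u k i 0).
  by apply: filter_forall => i; have /cvg_ballP := uv i; exact.
by apply: filterS => k H; split => // i j; rewrite ord1.
Qed.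

Definition obox n (a b : 'I_n -> R) := [set x : 'cV[R]_n | forall i, a i < x i 0 < b i].
Definition cbox n (a b : 'I_n -> R) := [set x : 'cV[R]_n | forall i, a i <= x i 0 <= b i].

Lemma mset_coord n (S : 'I_n -> set R) : (forall i, measurable (S i)) ->
  Defs.mset [set x : 'cV[R]_n | forall i, S i (x i 0)].
Proof.
move=> mS; rewrite /Defs.mset (_ : _ @^-1` _ =
    \bigcap_(i in [set: 'I_n]) ((fun t : n.-tuple RT => col t i 0) @^-1` S i)).
  apply: fin_bigcap_measurable => // i _; rewrite -[X in measurable X]setTI.
  exact: measurable_coord.
by apply/seteqP; split => t /= H i; [move=> _|]; exact: H.
Qed.

Lemma mset_obox n (a b : 'I_n -> R) : Defs.mset (obox a b).
Proof.
rewrite (_ : obox a b = [set x | forall i, `]a i, b i[%classic (x i 0)]).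
  by apply: (@mset_coord _ (fun i => `]a i, b i[%classic)) => i; exact: measurable_itv.
by apply/seteqP; split => x H i; have := H i; rewrite /= in_itv.
Qed.

Lemma compact_cbox n (a b : 'I_n -> R) : compact (cbox a b).
Proof.
have := @rV_compact R n (fun i => `[a i, b i]%classic)
  (fun i => @segment_compact R (a i) (b i)).
set A := [set v | _] => cA.
rewrite (_ : cbox a b = (@trmx R 1 n) @` A); last first.
  apply/seteqP; split => [x xab|_ [x xA <-] i].
    exists x^T; last exact: trmxK.
    by move=> i /=; rewrite mxE in_itv/=; exact: xab.
  by have /= := xA i; rewrite mxE in_itv.
apply: continuous_compact => //; apply: continuous_subspaceT => x.
apply/(@cvg_ballP _ _ _ _ (nbhs_filter x)) => e e0; apply/nbhs_ballP; exists e => // y [_ xy].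
by split => // i j; rewrite !mxE; exact: xy.
Qed.

(** Corners have coordinates in the multiples of 1/(k+1), so only countably many boxes arise as [k]
    and [v] vary. *)
Definition gridlo (k : nat) n (v : n.-tuple int) (i : 'I_n) : R :=
  (tnth v i - 1)%:~R / k.+1%:R.
Definition gridhi (k : nat) n (v : n.-tuple int) (i : 'I_n) : R :=
  (tnth v i + 1)%:~R / k.+1%:R.

Lemma grid_boxes n (O : set 'cV[R]_n) (x : 'cV[R]_n) : open O -> O x ->
  exists k v, obox (gridlo k v) (gridhi k v) x /\ cbox (gridlo k v) (gridhi k v) `<=` O.
Proof.
move=> oO Ox.
have /nbhs_ballP[e /= e0 xeO] : nbhs x O by exact: open_nbhs_nbhs.
have [k ke] : exists k : nat, k.+1%:R^-1 < e / 2.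
  have [N _ HN] := near_infty_natSinv_lt (PosNum (divr_gt0 e0 (ltr0Sn R 1))).
  by exists N; exact: (HN N (leqnn N)).
pose K : R := k.+1%:R.
have K0 : 0 < K by rewrite ltr0n.
(* The floor gives v <= K x < v + 1 in each coordinate. The box goes down to v - 1 so that [x] lies
   strictly inside even when K x is an integer; its side 2/K stays below [e]. *)
pose v : n.-tuple int := [tuple Num.floor (x i 0 * K) | i < n].
have vx i : gridlo k v i < x i 0 /\ x i 0 < gridhi k v i.
  rewrite /gridlo /gridhi tnth_mktuple -/K ltr_pdivrMr// ltr_pdivlMr//.
  rewrite floorD1_gt; split => //.
  apply: lt_le_trans (floor_le _).
  by rewrite ltr_int gtrBl.
exists k, v; split; first by move=> i; apply/andP; exact: vx.
move=> y yv; apply: xeO; split => // i j; rewrite ord1.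
have [x1 x2] := vx i; have /andP[y1 y2] := yv i.
have ghl : gridhi k v i = gridlo k v i + 2 * K^-1.
  by rewrite /gridhi /gridlo -mulrDl rmorphD rmorphB/= -addrA; congr (_ / _); lra.
have : 2 * K^-1 < e by rewrite mulrC -ltr_pdivlMr.
rewrite /ball/= ltr_norml; move: x1 x2 y1 y2; rewrite ghl.
clear; move: (gridlo k v i) (x i 0) (y i 0) (K^-1) => a b c f *.
by apply/andP; split; lra.
Qed.

(** Tuples carry the product sigma-algebra. An open set belongs to it as the union of the open grid
    boxes whose closed counterparts it contains. *)
Lemma mset_open n (O : set 'cV[R]_n) : open O -> Defs.mset O.
Proof.
move=> oO.
pose F (p : nat * n.-tuple int) : set (n.-tuple RT) :=
  if pselect (cbox (gridlo p.1 p.2) (gridhi p.1 p.2) `<=` O)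
  then @col_of_tuple R n @^-1` (obox (gridlo p.1 p.2) (gridhi p.1 p.2)) else set0.
rewrite /Defs.mset (_ : _ @^-1` _ = \bigcup_p F p).
  apply: countable_bigcupT_measurable; first exact: countableP.
  by move=> p; rewrite /F; case: pselect => ? ; [exact: mset_obox|exact: measurable0].
apply/seteqP; split => [t /= Ot|t [p _]].
  have [k [v [xv vO]]] := grid_boxes oO Ot.
  by exists (k, v) => //; rewrite /F; case: pselect.
rewrite /F; case: pselect => //= pO tp; apply: pO => i.
by have /andP[/ltW -> /ltW ->] := tp i.
Qed.

Lemma mset_closed n (C : set 'cV[R]_n) : closed C -> Defs.mset C.
Proof.
move=> cC; have := mset_open (closed_openC cC); rewrite /Defs.mset preimage_setC => h.
by rewrite -[X in measurable X]setCK; exact: measurableC.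
Qed.

(** Caratheodory functions are jointly measurable. Rounding the column down to a grid point leaves
    countably many cells, on each of which the function depends on its second argument alone;
    continuity in the column gives the limit as the mesh tends to 0. *)
Lemma measurable_caratheodory d (T : measurableType d) (D : set T) n
    (f : 'cV[R]_n -> T -> R) : measurable D ->
  (forall v, measurable_fun D (f v)) ->
  (forall t, D t -> continuous (f^~ t)) ->
  measurable_fun (setT `*` D) (fun p : n.-tuple RT * T => f (col p.1) p.2).
Proof.
move=> mD mf cf.
pose q (k : nat) (w : n.-tuple int) : 'cV[R]_n := \col_i ((tnth w i)%:~R / k.+1%:R).
pose w (k : nat) (t : n.-tuple RT) : n.-tuple int :=
  [tuple Num.floor ((tnth t i : R) * k.+1%:R) | i < n].
have mSD : measurable ([set: n.-tuple RT] `*` D) by exact: measurableX.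
apply: (@measurable_fun_cvg _ _ _ _
    (fun k (p : n.-tuple RT * T) => f (q k (w k p.1)) p.2)).
  move=> k _ B mB.
  rewrite (_ : _ `&` _ = \bigcup_(v : n.-tuple int)
    (([set t : n.-tuple RT | w k t = v]) `*` (D `&` (f (q k v)) @^-1` B))).
    apply: countable_bigcupT_measurable; first exact: countableP.
    move=> v; apply: measurableX; last exact: mf.
    rewrite (_ : mkset _ = @col_of_tuple R n @^-1` [set x | forall i,
        `[(tnth v i)%:~R / k.+1%:R, (tnth v i + 1)%:~R / k.+1%:R[%classic (x i 0)]).
      by apply: (@mset_coord n (fun i => `[(tnth v i)%:~R / k.+1%:R, (tnth v i + 1)%:~R / k.+1%:R[%classic)) => i; exact: measurable_itv.
    have K0 : (0 : R) < k.+1%:R by rewrite ltr0n.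
    apply/seteqP; split => t /= => [<- i|H].
      rewrite in_itv/= mxE tnth_mktuple ler_pdivrMr// ltr_pdivlMr//.
      exact: floor_itv.
    apply: eq_from_tnth => i; rewrite tnth_mktuple; apply: floor_def.
    by have := H i; rewrite in_itv/= mxE ler_pdivrMr// ltr_pdivlMr.
  apply/seteqP; split => [[t z] /= [[_ Dz] Bz]|[t z] /= [v _ [/= <-]]].
    by exists (w k t).
  by move=> [].
move=> [t z] /= [_ Dz].
apply: (@cvg_comp _ _ _ (fun k => q k (w k t)) (f^~ z) \oo (nbhs (col t)) _ _ (cf z Dz (col t))).
apply: cvg_cV => i; apply/cvgrPdist_lt => e e0; near=> k.
have K0 : (0 : R) < k.+1%:R by rewrite ltr0n.
rewrite !mxE tnth_mktuple; set x := (X in X - _); set K := k.+1%:R.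
have /andP[f1 f2] := floor_itv (x * K).
have : K^-1 < e.
  by rewrite /K; near: k; exact: (near_infty_natSinv_lt (PosNum e0)).
apply: le_lt_trans.
rewrite -(ler_pM2r K0) mulVf ?gt_eqF// -[X in _ * X](gtr0_norm K0) -normrM.
rewrite mulrBl divfK ?gt_eqF//.
by rewrite ger0_norm; move: f1 f2; rewrite rmorphD/=; lra.
Unshelve. all: by end_near. Qed.

Lemma continuous_measurable n (f : 'cV[R]_n -> R) :
  continuous f -> measurable_fun setT (f \o @col_of_tuple R n).
Proof.
move=> cf.
have := @measurable_caratheodory _ unit setT n (fun v _ => f v) measurableT
  (fun v => measurable_cst _) (fun t _ => cf).
rewrite setXTT => H.
exact: (measurableT_comp H (pair2_measurable tt)).
Qed.

End col_vectors.

(* The Lebesgue-Stieltjes measures of G and H add up to the Lebesgue measure, so both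
   are absolutely continuous and have densities. *)
Section lebesgue_stieltjes_density.
Context {R : realType}.
Local Notation RT := (measurableTypeR R).
Local Notation leb := (@lebesgue_measure R).
Variables G H : cumulative R R.
Hypothesis GHE : forall x, G x + H x = x.

Lemma lebesgue_stieltjes_measure_itvoc (K : cumulative R R) (a b : R) : a <= b ->
  lebesgue_stieltjes_measure K `]a, b]%classic = (K b - K a)%:E.
Proof.
move=> ab; rewrite /lebesgue_stieltjes_measure /measure_extension/=.
rewrite measurable_mu_extE/=; last exact: is_ocitv.
by rewrite wlength_itv_bnd.
Qed.

Lemma lebesgue_stieltjes_le_lebesgue (A : set RT) : measurable A ->
  (lebesgue_stieltjes_measure G A <= leb A)%E.
Proof.
move=> mA.
pose m := measure_add (lebesgue_stieltjes_measure G) (lebesgue_stieltjes_measure H).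
have -> : leb A = m A.
  apply: lebesgue_measure_unique => // X [[a b] _ <-] /=.
  have [ab|ba] := leP a b; last by rewrite set_itv_ge ?measure0// bnd_simp -leNgt ltW.
  have mE : m `]a, b]%classic = (G b - G a + (H b - H a))%:E.
    rewrite /m measure_addE EFinD; congr (_ + _)%E;
      exact: lebesgue_stieltjes_measure_itvoc.
  apply: etrans (esym mE); rewrite lebesgue_measure_itv/= lte_fin -EFinB.
  case: ltP => [_|ba]; first by congr (_%:E); have := GHE a; have := GHE b; lra.
  have -> : a = b by apply/eqP; rewrite eq_le ab ba.
  by rewrite !subrr addr0.
by rewrite [leRHS]measure_addE leeDl.
Qed.

Section density.
Variable k : R.
Hypothesis k0 : 0 <= k.

Let mitv : measurable (`]- k, k]%classic : set RT).
Proof. exact: measurable_itv. Qed.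

(** Restricting to a bounded interval gives a finite measure, whose Radon-Nikodym density is
    integrable on the whole line. *)
Let nu := mrestr (lebesgue_stieltjes_measure G) mitv.
Let nu_fin : fin_num_fun nu.
Proof.
move=> A mA; rewrite ge0_fin_numE//.
have kk : - k <= k by move: k0; lra.
apply: (@le_lt_trans _ _ (lebesgue_stieltjes_measure G `]- k, k]%classic)).
  rewrite /nu /mrestr; apply: le_measure; rewrite ?inE//.
    exact: (measurableI _ _ mA mitv).
by rewrite lebesgue_stieltjes_measure_itvoc ?ltry.
Qed.
HB.instance Definition _ := Measure.on nu.
HB.instance Definition _ := Measure_isFinite.Build _ _ _ nu nu_fin.

Lemma cumulative_density : exists f : RT -> R, leb.-integrable setT (EFin \o f) /\
  forall x, -k <= x <= k -> G x - G (-k) = \int[leb]_(t in `]-k, x]%classic) f t.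
Proof.
have numu : nu `<< leb.
  apply/null_content_dominatesP => A mA A0.
  apply/eqP; rewrite eq_le measure_ge0 andbT -A0.
  apply: le_trans (lebesgue_stieltjes_le_lebesgue mA).
  by apply: le_measure; rewrite ?inE//; exact: measurableI.
have [f [f0 ffin intf nuE]] := radon_nikodym_sigma_finite numu.
exists (fine \o f); split.
  by apply: eq_integrable intf => // x _ /=; rewrite fineK.
move=> x /andP[kx xk].
have : nu `]-k, x]%classic = (G x - G (-k))%:E.
  rewrite /nu /mrestr [X in lebesgue_stieltjes_measure G X](_ : _ = `]-k, x]%classic).
    exact: lebesgue_stieltjes_measure_itvoc.
  by apply/setIidPl => y /=; rewrite !in_itv/= => /andP[-> /le_trans ->].
rewrite nuE// => h; rewrite /Rintegral.
rewrite (_ : integral _ _ _ = (G x - G (-k))%:E)// -h.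
by apply: eq_integral => y _ /=; rewrite fineK.
Qed.
End density.
End lebesgue_stieltjes_density.

(** * Almost everywhere derivability of Lipschitz functions of one variable *)

Section lipschitz_derivable.
Context {R : realType}.
Local Notation leb := (@lebesgue_measure R).

Lemma lipschitz_continuousR (F : R -> R) (L : R) :
  (forall x y, `|F x - F y| <= L * `|x - y|) -> continuous F.
Proof.
move=> FL x; apply/cvgrPdist_lt => e e0.
have L0 : 0 < `|L| + 1 by rewrite ltr_wpDl.
near=> y; apply: le_lt_trans (FL x y) _.
apply: (@le_lt_trans _ _ ((`|L| + 1) * `|x - y|)).
  by rewrite ler_wpM2r// (le_trans (ler_norm L))// lerDl.
rewrite mulrC -ltr_pdivlMr//; near: y.
by apply/nbhs_ballP; exists (e / (`|L| + 1)) => //=; exact: divr_gt0.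
Unshelve. all: by end_near. Qed.

Section lip1.
Variable F : R -> R.
Hypothesis F1 : forall x y, `|F x - F y| <= `|x - y|.

Let Fc : continuous F.
Proof. by apply: (@lipschitz_continuousR _ 1) => x y; rewrite mul1r. Qed.

(* Both functions are nondecreasing, add up to the identity, and F = 2 G - id. *)
Let G x := (x + F x) / 2.
Let H x := (x - F x) / 2.

Let Gnd : nondecreasing G.
Proof.
move=> x y xy; rewrite /G; have := F1 x y.
rewrite distrC [`|x - y|]distrC [`|y - x|]ger0_norm ?subr_ge0// ler_norml.
by move=> /andP[]; lra.
Qed.
Let Hnd : nondecreasing H.
Proof.
move=> x y xy; rewrite /H; have := F1 x y.
rewrite distrC [`|x - y|]distrC [`|y - x|]ger0_norm ?subr_ge0// ler_norml.
by move=> /andP[]; lra.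
Qed.
Let Grc : right_continuous G.
Proof.
apply: right_continuousW => x; apply: cvgMl; apply: cvgD; [exact: cvg_id|exact: Fc].
Qed.
Let Hrc : right_continuous H.
Proof.
apply: right_continuousW => x; apply: cvgMl; apply: cvgB; [exact: cvg_id|exact: Fc].
Qed.
HB.instance Definition _ := isCumulative.Build R _ R G Gnd Grc.
HB.instance Definition _ := isCumulative.Build R _ R H Hnd Hrc.

Let lip1_ae_derivable_itv (k : R) : 0 <= k ->
  {ae leb, forall x, - k < x < k -> derivable F x 1}.
Proof.
move=> k0.
have GH x : G x + H x = x by rewrite /G /H; lra.
have [f [intf fE]] := cumulative_density GH k0.
have locf : locally_integrable setT f by apply: open_integrable_locally => //; exact: openT.
have intfk y : leb.-integrable [set` Interval (BRight (- k)) (BRight y)] (EFin \o f).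
  by apply: integrableS intf => //; exact: measurable_itv.
have := FTC1 intfk locf.
apply: (@filterS _ _ (ae_filter_ringOfSetsType leb)) => x + /andP[kx xk].
rewrite lte_fin => /(_ kx)[dPhi _].
set Phi := (fun y => _) in dPhi.
(* [Phi] is the primitive of the density, derivable at [x] by Lebesgue differentiation. On ]-k, k[
   the function written here is 2 G - id, that is [F]. *)
have : derivable (fun y => 2 * (G (- k) + Phi y) - y) x 1.
  apply: derivableB; last exact: derivable_id.
  apply: derivableM; first exact: derivable_cst.
  by apply: derivableD; [exact: derivable_cst|exact: dPhi].
apply: near_eq_derivable; near=> y.
have yk : - k < y < k.
  suff : y \in `]- k, k[ by rewrite in_itv.
  by near: y; apply: near_in_itvoo; rewrite in_itv/= kx.
have /fE : - k <= y <= k by move: yk => /andP[/ltW -> /ltW ->].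
by rewrite /Phi => <- /=; rewrite /G; lra.
Unshelve. all: by end_near. Qed.

Lemma lip1_ae_derivable : {ae leb, forall x, derivable F x 1}.
Proof.
have /ae_foralln : forall k : nat, {ae leb, forall x, - k%:R < x < k%:R -> derivable F x 1}.
  by move=> k; exact: lip1_ae_derivable_itv.
apply: (@filterS _ _ (ae_filter_ringOfSetsType leb)) => x /(_ (Num.trunc `|x|).+1); apply.
by rewrite -ltr_norml truncnS_gt.
Qed.

End lip1.

Lemma lipschitz_ae_cvg (F : R -> R) (L : R) :
  (forall x y, `|F x - F y| <= L * `|x - y|) ->
  {ae leb, forall x, cvgn (fun n => n.+1%:R * (F (x + n.+1%:R^-1) - F x))}.
Proof.
(* [L] may vanish, so the rescaling to Lipschitz constant 1 divides by |L| + 1. *)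
move=> FL; pose L1 : R := `|L| + 1.
have L0 : 0 < L1 by rewrite ltr_wpDl.
have := @lip1_ae_derivable (fun x => F x / L1) _.
have FL1 x y : `|F x / L1 - F y / L1| <= `|x - y|.
  rewrite -mulrBl normrM normfV (gtr0_norm L0) ler_pdivrMr// mulrC.
  apply: le_trans (FL x y) _; rewrite ler_wpM2r// /L1.
  by rewrite (le_trans (ler_norm L))// lerDl.
move=> /(_ FL1); apply: (@filterS _ _ (ae_filter_ringOfSetsType leb)) => x.
move=> /cvg_ex[l /= /cvgr_dnbhsP H0].
have H : (forall n, (n.+1%:R^-1 : R) != 0) /\ (n.+1%:R^-1 : R) @[n --> \oo] --> (0 : R).
  by split; [move=> n; rewrite invr_neq0// pnatr_eq0 | exact: cvg_harmonic].
move: {H0} (H0 _ H) => H1; apply/cvg_ex; exists (L1 * l).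
rewrite (_ : (fun n => _) = (fun n => L1 * ((n.+1%:R^-1)^-1 *:
    (((fun x => F x / L1) \o shift x) (n.+1%:R^-1 *: 1) - F x / L1)))).
  by apply: cvgM => //; exact: cvg_cst.
apply/funext => n.
have LK (z : R) : L1 * (z / L1) = z by rewrite mulrC divfK ?gt_eqF.
by rewrite /= invrK /GRing.scale/= mulr1 -mulrBl mulrCA LK [x + _]addrC.
Qed.

End lipschitz_derivable.

(** * Test functions *)

Section flat.
Context {R : realType}.

(* The derivatives of [t |-> exp (- e / t)], extended by 0 to [t <= 0], are linear
   combinations of the functions [flat e k]. *)
Definition flat (e : R) (k : nat) (t : R) : R :=
  if 0 < t then t^-1 ^+ k * expR (- (e * t^-1)) else 0.

Lemma flat_ge0 e k t : 0 <= flat e k t.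
Proof.
rewrite /flat; case: ifP => // t0.
by rewrite mulr_ge0 ?expR_ge0// exprn_ge0// invr_ge0 ltW.
Qed.

(** With u = 1/t and k > 0, the inequality x <= exp x at x = e u / k, raised to the power k, bounds
    u^k by (k/e)^k exp(e u). The constant with k + 1 in place of k leaves some room. *)
Lemma flat_bounded e k : 0 < e -> exists2 C, 0 <= C & forall t, flat e k t <= C.
Proof.
move=> e0; exists ((k.+1%:R / e) ^+ k); first by rewrite exprn_ge0// divr_ge0// ltW.
move=> t; rewrite /flat; case: ifP => t0; last by rewrite exprn_ge0// divr_ge0// ltW.
set u := t^-1; have u0 : 0 <= u by rewrite invr_ge0 ltW.
case: k => [|k]; first by rewrite !expr0 mul1r -expR0 ler_expR oppr_le0 mulr_ge0// ltW.
have K0 : (0 : R) < k.+1%:R by rewrite ltr0n.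
have K1 : (0 : R) < k.+2%:R by rewrite ltr0n.
rewrite expRN -ler_pdivlMr ?invr_gt0 ?expR_gt0// invrK.
apply: (@le_trans _ _ ((k.+2%:R / e) ^+ k.+1 * (e * u / k.+1%:R) ^+ k.+1)).
  rewrite -exprMn; apply: lerXn2r; rewrite ?nnegrE//.
    by rewrite mulr_ge0// divr_ge0// ?mulr_ge0// ltW.
  rewrite (_ : _ * _ = u * (k.+2%:R / k.+1%:R)); last first.
    by field; rewrite !gt_eqF.
  by rewrite ler_peMr// ler_pdivlMr// mul1r ler_nat.
rewrite ler_wpM2l ?exprn_ge0 ?divr_ge0 ?(ltW e0)//.
rewrite [leRHS](_ : _ = expR (e * u / k.+1%:R) ^+ k.+1); last first.
  by rewrite -expRM_natl [in RHS]mulrCA divff ?gt_eqF// mulr1.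
have le1 : e * u / k.+1%:R <= expR (e * u / k.+1%:R).
  by apply: le_trans (expR_ge1Dx _); rewrite lerDr.
apply: lerXn2r le1; rewrite nnegrE ?expR_ge0//.
by rewrite divr_ge0// mulr_ge0// ltW.
Qed.

Lemma flatS e k t : flat e k t = t * flat e k.+1 t.
Proof.
rewrite /flat; case: ifP => t0; last by rewrite mulr0.
by rewrite exprS !mulrA divff ?mul1r// gt_eqF.
Qed.

Lemma is_derive_flat (e : R) k (t : R) : 0 < e ->
  is_derive t (1 : R) (flat e k) (e * flat e k.+2 t - k%:R * flat e k.+1 t).
Proof.
move=> e0; have [t0|t0|->] := ltgtP t 0.
- have tneg : 0 < t = false by apply/negbTE; rewrite -leNgt ltW.
  rewrite /flat tneg !mulr0 subrr.
  apply: (@near_eq_is_derive _ _ _ (cst 0)).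
    near=> x; suff : x < 0 by rewrite ltNge => /negbTE; rewrite lt_neqAle => ->; rewrite andbF.
    by near: x; exact: lt_nbhsl.
- rewrite /flat t0.
  apply: (@near_eq_is_derive _ _ _ (fun x : R => x^-1 ^+ k * expR (- (e * x^-1)))).
    near=> x; suff -> : 0 < x by [].
    by near: x; exact: lt_nbhsr.
  have dV : is_derive t 1 (fun x : R => x^-1) (- t ^- 2).
    have := @is_deriveV R id t 1 (1 : R) (lt0r_neq0 t0) (is_derive_id _ _).
    by rewrite /GRing.scale/= mulr1.
  have dX := is_deriveX k dV.
  have dE : is_derive t 1 (fun x : R => - (e * x^-1)) (e * t ^- 2).
    have := is_deriveN (is_deriveZ e dV).
    by rewrite /GRing.scale/= mulrN opprK.
  have dexp := @is_derive1_comp R expR (fun x => - (e * x^-1)) t _ _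
    (is_derive_expR _) dE.
  have dM := is_deriveM dX dexp.
  rewrite [X in is_derive _ _ X _](_ : _ =
      (fun x : R => x^-1) ^+ k * (expR \o (fun x => - (e * x^-1)))); last first.
    by apply/funext => x; rewrite !fctE.
  apply: (is_derive_eq dM); rewrite /GRing.scale/= !fctE.
  set u := t^-1; rewrite -exprVn -/u; set E := expR _.
  case: (k) => [|m]; rewrite ?exprS ?expr0 ?mulr0n/=; ring.
- have f0 m : flat e m 0 = 0 by rewrite /flat ltxx.
  (* Two uses of [flatS] turn the quotient at 0 into h times [flat e k.+2 h], which tends to 0
     because [flat] is bounded. *)
  have H : h^-1 *: ((flat e k \o shift 0) (h *: 1) - flat e k 0) @[h --> (0:R)^'] --> (0:R).
    have [C C0 HC] := @flat_bounded e k.+2 e0.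
    apply/cvgrPdist_lt => d d0; near=> h.
    have h0 : h != 0 by near: h; exact: nbhs_dnbhs_neq.
    rewrite sub0r normrN f0 subr0 /= addr0 /GRing.scale/= mulr1 flatS mulKf//.
    rewrite flatS normrM (ger0_norm (flat_ge0 _ _ _)).
    apply: (@le_lt_trans _ _ (`|h| * (C + 1))).
      by rewrite ler_wpM2l// (le_trans (HC _))// lerDl.
    rewrite -ltr_pdivlMr ?ltr_wpDl//.
    by near: h; apply: dnbhs0_lt; rewrite divr_gt0// ltr_wpDl.
  apply: DeriveDef; first by apply/cvg_ex; exists 0.
  by rewrite !f0 !mulr0 subrr; exact: cvg_lim.
Unshelve. all: by end_near. Qed.

Lemma continuous_flat (e : R) k : 0 < e -> continuous (flat e k).
Proof.
move=> e0 t; have [d _] := is_derive_flat k t e0.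
by apply: differentiable_continuous; exact/derivable1_diffP.
Qed.

End flat.

(** * Smooth bumps supported in boxes *)

Section bumps.
Context {R : realType}.

(** Smoothness quantifies over all iterated partial derivatives. The bumps are therefore placed in
    an algebra of continuous functions stable under every [pder]; affine arguments in one coordinate
    cover the distances to both faces of a box. *)
Inductive flat_alg n : ('cV[R]_n -> R) -> Prop :=
| flat_alg_flat e k (i : 'I_n) s c : 0 < e ->
    flat_alg (fun x => flat e k (s * x i 0 + c))
| flat_alg_cst c : flat_alg (fun=> c)
| flat_algD f g : flat_alg f -> flat_alg g -> flat_alg (fun x => f x + g x)
| flat_algM f g : flat_alg f -> flat_alg g -> flat_alg (fun x => f x * g x).

Lemma flat_alg_continuous n (f : 'cV[R]_n -> R) : flat_alg f -> continuous f.
Proof.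
elim => [e k i s c e0|c|{}f g _ cf _ cg|{}f g _ cf _ cg] x.
- apply: (@continuous_comp _ _ _ (fun x : 'cV[R]_n => s * x i 0 + c) (flat e k)).
    have FF := nbhs_filter x.
    have c0 (a : R) : (fun _ : 'cV[R]_n => a) @ nbhs x --> a by exact: cvg_cst.
    have c1 := @cvgM R _ (nbhs x) FF _ _ _ _ (c0 s) (@coord_continuous R n 1 i 0 x).
    exact: (@cvgD _ _ _ (nbhs x) FF _ _ _ _ c1 (c0 c)).
  exact: continuous_flat.
- exact: cst_continuous.
- exact: (@cvgD _ _ _ (nbhs x) (nbhs_filter x) _ _ _ _ (cf x) (cg x)).
- exact: (@cvgM _ _ (nbhs x) (nbhs_filter x) _ _ _ _ (cf x) (cg x)).
Qed.

Lemma is_derive_line n (f : 'cV[R]_n -> R) (x v : 'cV[R]_n) (l : R) :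
  is_derive (0 : R) (1 : R) (fun h : R => f (h *: v + x)) l -> is_derive x v f l.
Proof.
move=> [df dl].
have E : (fun h : R => h^-1 *: (((fun k : R => f (k *: v + x)) \o shift 0) (h *: 1)
    - f (0 *: v + x))) = (fun h => h^-1 *: ((f \o shift x) (h *: v) - f x)).
  apply/funext => h /=; rewrite addr0 scale0r add0r.
  by rewrite (_ : h *: (1 : R) = h)//; exact: mulr1.
by apply: DeriveDef; [move: df; rewrite /derivable E|move: dl; rewrite /derive E].
Qed.

Lemma flat_alg_derive n (f : 'cV[R]_n -> R) (j : 'I_n) : flat_alg f ->
  exists2 g, flat_alg g & forall x, is_derive x (@ecv R n j) f (g x).
Proof.
elim => [e k i s c e0|c|{}f g _ [df cdf Hf] _ [dg cdg Hg]
    |{}f g cf [df cdf Hf] cg [dg cdg Hg]].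
- exists (fun x => (s * (i == j)%:R) *
     (e * flat e k.+2 (s * x i 0 + c) + (- k%:R) * flat e k.+1 (s * x i 0 + c))).
    apply: flat_algM; first exact: flat_alg_cst.
    by apply: flat_algD; apply: flat_algM; (exact: flat_alg_cst || exact: flat_alg_flat).
  move=> x; apply: is_derive_line.
  have daff : is_derive (0:R) (1:R) (fun h : R => s * (h *: @ecv R n j + x) i 0 + c)
      (s * (i == j)%:R).
    have -> : (fun h : R => s * (h *: @ecv R n j + x) i 0 + c) =
        (fun h => (s * (i == j)%:R) * h + (s * x i 0 + c)).
      by apply/funext => h; rewrite !mxE eqxx andbT; ring.
    have dd := is_deriveD (is_deriveZ (s * (i == j)%:R) (is_derive_id (0:R) (1:R)))
      (is_derive_cst (s * x i 0 + c) (0 : R) (1 : R)).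
    rewrite (_ : (fun h : R => _) =
        (s * (i == j)%:R) \*: (id : R -> R) + cst (s * x i 0 + c))//.
    by apply: (is_derive_eq dd); rewrite addr0; exact: mulr1.
  have dfl := is_derive_flat k (s * (0 *: @ecv R n j + x) i 0 + c) e0.
  have dc := @is_derive1_comp R (flat e k) _ 0 _ _ dfl daff.
  by apply: (is_derive_eq dc); rewrite scale0r add0r; ring.
- by exists (fun=> 0); [exact: flat_alg_cst|move=> x; exact: is_derive_cst].
- exists (fun x => df x + dg x); first exact: flat_algD.
  by move=> x; exact: is_deriveD.
- exists (fun x => f x * dg x + g x * df x).
    by apply: flat_algD; exact: flat_algM.
  by move=> x; exact: is_deriveM.
Qed.

Lemma flat_alg_pder n (f : 'cV[R]_n -> R) s : flat_alg f -> flat_alg (pder s f).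
Proof.
move=> cf; elim: s => //= j s IH.
have [g cg dg] := flat_alg_derive j IH.
rewrite (_ : (fun x => _) = g)//; apply/funext => x.
by have [] := dg x.
Qed.

Lemma flat_alg_smooth n (f : 'cV[R]_n -> R) : flat_alg f -> smooth f.
Proof.
move=> cf s; have cs := flat_alg_pder s cf; split.
  exact: flat_alg_continuous.
by move=> j x; have [g _ /(_ x) []] := flat_alg_derive j cs.
Qed.

(** On the open box this is exp(- e s(x)), where s(x) is the sum of the inverse distances to the
    faces. As [e] tends to 0 it tends to the indicator of the open box. *)
Definition box_bump n (a b : 'I_n -> R) (e : R) (x : 'cV[R]_n) : R :=
  \prod_(i < n) (flat e 0 (x i 0 - a i) * flat e 0 (b i - x i 0)).

Lemma box_bump_flat_alg n (a b : 'I_n -> R) e : 0 < e -> flat_alg (box_bump a b e).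
Proof.
move=> e0; rewrite /box_bump; elim: (index_enum _) => [|i s IH].
  rewrite (_ : (fun _ => _) = fun=> 1); first exact: flat_alg_cst.
  by apply/funext => x; rewrite big_nil.
rewrite (_ : (fun _ => _) = fun x : 'cV[R]_n =>
    (flat e 0 (1 * x i 0 + (- a i)) * flat e 0 (-1 * x i 0 + b i)) *
    \prod_(j <- s) (flat e 0 (x j 0 - a j) * flat e 0 (b j - x j 0))); last first.
  by apply/funext => x; rewrite big_cons mul1r mulN1r [- _ + b i]addrC.
by apply: flat_algM => //; apply: flat_algM; exact: flat_alg_flat.
Qed.

Lemma flat0_le1 e t : 0 < e -> flat e 0 t <= 1 :> R.
Proof.
move=> e0; rewrite /flat; case: ifP => // t0; rewrite expr0 mul1r -expR0 ler_expR.
by rewrite oppr_le0 mulr_ge0 ?invr_ge0 ?(ltW e0) ?(ltW t0).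
Qed.

Lemma box_bump_ge0 n (a b : 'I_n -> R) e x : 0 <= box_bump a b e x.
Proof. by rewrite prodr_ge0// => i _; rewrite mulr_ge0 ?flat_ge0. Qed.

Lemma box_bump_le1 n (a b : 'I_n -> R) e x : 0 < e -> box_bump a b e x <= 1.
Proof.
move=> e0; rewrite -(expr1n _ n) -[X in _ ^+ X]card_ord -prodr_const.
apply: ler_prod => i _; rewrite mulr_ge0 ?flat_ge0//=.
by rewrite -[leRHS]mul1r ler_pM ?flat_ge0 ?flat0_le1.
Qed.

Lemma box_bump_out n (a b : 'I_n -> R) e x : ~ obox a b x -> box_bump a b e x = 0.
Proof.
move=> /existsNP[i /negP xi]; rewrite /box_bump (bigD1 i)//=.
suff -> : flat e 0 (x i 0 - a i) * flat e 0 (b i - x i 0) = 0 by rewrite mul0r.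
apply/eqP; rewrite mulf_eq0; move: xi; rewrite negb_and -!leNgt => /orP[h|h].
  by rewrite [flat _ _ (_ - a i)]/flat subr_gt0 ltNge h/= eqxx.
by rewrite [flat _ _ (b i - _)]/flat subr_gt0 ltNge h/= eqxx orbT.
Qed.

Lemma box_bump_test_fun n (O : set 'cV[R]_n) (a b : 'I_n -> R) e : 0 < e ->
  cbox a b `<=` O -> test_fun O (box_bump a b e).
Proof.
move=> e0 abO; split; first exact/flat_alg_smooth/box_bump_flat_alg.
exists (cbox a b); split; first exact: compact_cbox.
split => // x xab; apply: box_bump_out => H; apply: xab => i.
by have /andP[/ltW -> /ltW ->] := H i.
Qed.

Lemma box_bump_cvg n (a b : 'I_n -> R) (x : 'cV[R]_n) :
  (fun k => box_bump a b k.+1%:R^-1 x) @ \oo --> (\1_(obox a b) x : R).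
Proof.
have [xab|xab] := pselect (obox a b x); last first.
  rewrite indicE memNset//; under eq_cvg do rewrite box_bump_out//.
  exact: cvg_cst.
rewrite indicE mem_set// /box_bump.
have f1 (t : R) : 0 < t -> flat k.+1%:R^-1 0 t @[k --> \oo] --> (1 : R).
  move=> t0; rewrite -[X in _ --> X]expR0.
  have -> : (fun k => flat k.+1%:R^-1 0 t) = (fun k => expR (- (k.+1%:R^-1 * t^-1))).
    by apply/funext => k; rewrite /flat t0 expr0 mul1r.
  apply: continuous_cvg; first exact: continuous_expR.
  rewrite -oppr0; apply: cvgN; rewrite -(mul0r t^-1).
  by apply: cvgM; [exact: cvg_harmonic|exact: cvg_cst].
elim: (index_enum _) => [|i s IH].
  by under eq_cvg do rewrite big_nil; exact: cvg_cst.
have /andP[xa xb] := xab i.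
have h1 : 0 < x i 0 - a i by rewrite subr_gt0.
have h2 : 0 < b i - x i 0 by rewrite subr_gt0.
have c := cvgM (cvgM (f1 _ h1) (f1 _ h2)) IH; rewrite !mulr1 in c.
by under eq_fun do rewrite big_cons; exact: (c _ _).
Qed.

End bumps.

(** * Uniqueness of weak gradients *)

Section integral_on.
Context {R : realType}.
Local Notation RT := (measurableTypeR R).
Local Notation leb := (@lebesgue_measure R).
Local Notation col := (@col_of_tuple R _).
Local Notation colpre D := (@col_of_tuple R _ @^-1` D).

Lemma restrict_colpre n (D : set 'cV[R]_n) (f : 'cV[R]_n -> \bar R) :
  (fun t : n.-tuple RT => (\1_D (col t))%:E * f (col t))%E =
  ((f \o @col_of_tuple R n) \_ (colpre D)).
Proof.
apply/funext => t; rewrite patchE indicE.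
have [tD|tD] := boolP (t \in colpre D).
  by rewrite mem_set ?mul1e//; move: tD; rewrite inE.
by rewrite memNset ?mul0e//; move: tD; rewrite notin_setE.
Qed.

Lemma integral_onE n (D : set 'cV[R]_n) (f : 'cV[R]_n -> \bar R) :
  Defs.mset D -> (tmeas n).-integrable (colpre D) (f \o @col_of_tuple R n) ->
  integral_on D f = (\int[tmeas n]_(t in colpre D) f (col t))%E.
Proof.
move=> mD intf; rewrite /integral_on restrict_colpre integral_mkcond iintE//.
exact/(integrable_mkcond _ mD).1.
Qed.

Lemma ge0_integral_onE n (D : set 'cV[R]_n) (f : 'cV[R]_n -> \bar R) :
  Defs.mset D -> measurable_fun (colpre D) (f \o @col_of_tuple R n) ->
  (forall x, D x -> 0 <= f x)%E ->
  integral_on D f = (\int[tmeas n]_(t in colpre D) f (col t))%E.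
Proof.
move=> mD mf f0; rewrite /integral_on restrict_colpre integral_mkcond iint_ge0E//.
  exact: (iffLR (measurable_restrictT _ mD) mf).
by move=> t; rewrite erestrict_ge0// => {}t; exact: f0.
Qed.

Lemma mset_compact n (K : set 'cV[R]_n) : compact K -> Defs.mset K.
Proof. by move=> cK; apply: mset_closed; apply: compact_closed. Qed.

Lemma tmeas_cbox n (a b : 'I_n -> R) : (tmeas n (colpre (cbox a b)) < +oo)%E.
Proof.
have mB : measurable (colpre (cbox a b)) by exact: (mset_compact (@compact_cbox R n a b)).
rewrite -[X in tmeas n X]setIT -integral_indic//.
have mi (i : 'I_n) : measurable (`[a i, b i]%classic : set RT) by exact: measurable_itv.
have itvE (i : 'I_n) : (\int[leb]_x (\1_(`[a i, b i]%classic : set RT) x)%:E =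
   (fine (leb `[a i, b i]%classic))%:E)%E.
  rewrite integral_indic// setIT fineK// lebesgue_measure_itv/= lte_fin.
  by case: ifP => // _; rewrite -EFinB.
have := @integral_tmeas_prod R n (fun i => \1_(`[a i, b i]%classic)) _
  (fun i => measurable_indic (mi i)) (fun i x => ltac:(by [])) itvE.
rewrite (_ : integral _ _ _ = (\int[tmeas n]_t (\1_(colpre (cbox a b)) t)%:E)%E).
  by move=> ->; rewrite ltry.
apply: eq_integral => t _; congr EFin; rewrite [RHS]indicE.
have [tab|tab] := boolP (t \in _).
  rewrite big1// => i _; rewrite indicE mem_set//=.
  by move: tab; rewrite inE => /(_ i); rewrite mxE in_itv.
have /existsNP[i ti] : ~ cbox a b (col t) by move: tab; rewrite notin_setE.
rewrite (bigD1 i)//= indicE memNset ?mul0r//=.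
by move: ti; rewrite mxE in_itv.
Qed.

Lemma compact_sub_cbox n (K : set 'cV[R]_n) : compact K ->
  exists m : nat, K `<=` cbox (fun=> - m%:R) (fun=> m%:R).
Proof.
move=> /compact_bounded[M [_ HM]].
exists (Num.trunc (M + 1)).+1 => x Kx i.
have /HM/(_ _ Kx) xM : M < M + 1 by rewrite ltrDl.
rewrite -ler_norml (le_trans _ (ltW (truncnS_gt _)))// (le_trans _ xM)//.
rewrite [`|x|](@mx_normrE R n 1 x).
exact: (@le_bigmax _ _ _ 0 (fun ij => `|x ij.1 ij.2|) (i, 0)).
Qed.

Lemma ae_on_tmeas n (D : set 'cV[R]_n) (Q : 'cV[R]_n -> Prop) (S : set (n.-tuple RT)) :
  measurable S -> tmeas n S = 0%E ->
  (forall t, D (col t) -> ~ S t -> Q (col t)) -> ae_on D Q.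
Proof.
move=> mS S0 H.
pose B := @tuple_of_col R n @^-1` S.
have preS : colpre B = S.
  by apply/seteqP; split => t; rewrite /B /preimage/= col_of_tupleK.
have mB : measurable (colpre B) by rewrite preS.
exists B; split.
  exists B; split => //; split => //.
  rewrite ge0_integral_onE//; last exact: measurable_cst.
  apply: (etrans (integral_cst _ mB 1%E)); rewrite mul1e preS.
  exact: S0.
by move=> x Dx Bx; rewrite -(tuple_of_colK x); apply: H; rewrite ?tuple_of_colK.
Qed.

Lemma loc_integrable_cpt n (O K : set 'cV[R]_n) (f : 'cV[R]_n -> R) :
  open O -> loc_integrable O f -> compact K -> K `<=` O ->
  (tmeas n).-integrable (colpre K) (EFin \o (f \o @col_of_tuple R n)).
Proof.
move=> oO [mf lf] cK KO.
have mO : measurable (colpre O) by exact: mset_open.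
have mK : measurable (colpre K) by exact: mset_compact.
have mfK : measurable_fun (colpre K) (f \o @col_of_tuple R n).
  by apply: measurable_funS mf => // t; exact: KO.
apply/integrableP; split; first exact/measurable_EFinP.
have := lf K cK KO; rewrite ge0_integral_onE//.
by apply/measurable_EFinP; exact: measurableT_comp.
Qed.

Lemma bounded_loc_integrable n (O : set 'cV[R]_n) (f : 'cV[R]_n -> R) :
  open O -> mfun_on O f ->
  (forall m : nat, exists C : R, forall x, O x ->
     cbox (fun=> - m%:R) (fun=> m%:R) x -> `|f x| <= C) ->
  loc_integrable O f.
Proof.
move=> oO mf fC; split => // K cK KO.
have mK : measurable (colpre K) by exact: mset_compact.
have mO : measurable (colpre O) by exact: mset_open.
have mfK : measurable_fun (colpre K) (f \o @col_of_tuple R n).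
  by apply: measurable_funS mf => // t; exact: KO.
have [m Km] := compact_sub_cbox cK.
have [C HC] := fC m.
rewrite ge0_integral_onE//; last first.
  by apply/measurable_EFinP; apply: measurableT_comp.
apply: (@le_lt_trans _ _ (\int[tmeas n]_(t in colpre K) (`|C|%:E))%E).
  apply: ge0_le_integral => //.
  - by apply/measurable_EFinP; apply: measurableT_comp.
  - move=> t Kt; rewrite lee_fin (le_trans _ (ler_norm _))//.
    by apply: HC; [exact: KO|exact: Km].
rewrite integral_cst// lte_mul_pinfty//.
apply: le_lt_trans (tmeas_cbox (fun=> - m%:R) (fun=> m%:R)).
apply: le_measure; rewrite ?inE//.
  exact: (mset_compact (@compact_cbox R n _ _)).
by move=> t; exact: Km.
Qed.

End integral_on.

Section integral_generated.
Context d (T : measurableType d) (R : realType) (mu : {measure set T -> \bar R}).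
Variable h : T -> \bar R.
Hypothesis inth : mu.-integrable setT h.

Let mh : measurable_fun setT h. Proof. exact: measurable_int inth. Qed.

Let mpos (A : set T) : \bar R := (\int[mu]_(x in A) h^\+ x)%E.
Let mneg (A : set T) : \bar R := (\int[mu]_(x in A) h^\- x)%E.

Let mpos0 : mpos set0 = 0%E. Proof. exact: integral_set0. Qed.
Let mneg0 : mneg set0 = 0%E. Proof. exact: integral_set0. Qed.
Let mpos_ge0 A : (0 <= mpos A)%E. Proof. exact: integral_ge0. Qed.
Let mneg_ge0 A : (0 <= mneg A)%E. Proof. exact: integral_ge0. Qed.
Let mpos_sa : semi_sigma_additive mpos.
Proof. by apply: semi_sigma_additive_nng_induced => //; exact: measurable_funepos. Qed.
Let mneg_sa : semi_sigma_additive mneg.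
Proof. by apply: semi_sigma_additive_nng_induced => //; exact: measurable_funeneg. Qed.
HB.instance Definition _ := isMeasure.Build _ _ _ mpos mpos0 mpos_ge0 mpos_sa.
HB.instance Definition _ := isMeasure.Build _ _ _ mneg mneg0 mneg_ge0 mneg_sa.

Let posfin A : measurable A -> mpos A \is a fin_num.
Proof.
move=> mA; apply: integrable_fin_num => //.
by apply: integrable_funepos => //; exact: integrableS inth.
Qed.
Let negfin A : measurable A -> mneg A \is a fin_num.
Proof.
move=> mA; apply: integrable_fin_num => //.
by apply: integrable_funeneg => //; exact: integrableS inth.
Qed.

(* Two finite measures that agree on a generating pi-system are equal; this is applied to
   the positive and negative parts of h. *)
Lemma integral_generated_eq0 (G : set (set T)) (g : (set T)^nat) :
  measurable = <<s G >> -> setI_closed G -> (forall i, G (g i)) ->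
  \bigcup_k (g k) = setT ->
  (forall A, G A -> (\int[mu]_(x in A) h x = 0)%E) ->
  forall A, measurable A -> (\int[mu]_(x in A) h x = 0)%E.
Proof.
move=> mG GI Gg gT G0 A mA.
have GM B : G B -> measurable B by move=> GB; rewrite mG; exact: sub_sigma_algebra.
have pn B : measurable B -> (\int[mu]_(x in B) h x)%E = (mpos B - mneg B)%E.
  by move=> _; rewrite integralE.
rewrite pn//; suff -> : mpos A = mneg A by rewrite subee// negfin.
apply: (measure_unique G g) => // [B GB|k].
  have mB := GM _ GB; have := G0 _ GB; rewrite pn//.
  rewrite -(fineK (posfin mB)) -(fineK (negfin mB)) => -[/eqP].
  rewrite subr_eq0 => /eqP pn0.
  suff : mpos B = mneg B by [].
  by rewrite -(fineK (posfin mB)) pn0 fineK// negfin.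
by have := posfin (GM _ (Gg k)); rewrite ge0_fin_numE.
Qed.

End integral_generated.

(** * The fundamental lemma of the calculus of variations, tested on boxes *)

Section fundamental_lemma.
Context {R : realType}.
Local Notation RT := (measurableTypeR R).
Local Notation col := (@col_of_tuple R _).
Local Notation colpre D := (@col_of_tuple R _ @^-1` D).

(** A generating pi-system, chosen because an orthant cuts an open box in another open box with the
    same lower corner. *)
Definition orthants n : set (set (n.-tuple RT)) :=
  [set S | exists c : 'I_n -> R, S = [set t | forall i, col t i 0 < c i]].

Lemma orthant_measurable n (S : set (n.-tuple RT)) : orthants S -> measurable S.
Proof.
move=> [c ->].
have := @mset_coord R n (fun i => `]-oo, c i[%classic) (fun i => measurable_itv _).
by rewrite /Defs.mset; congr (measurable _); apply/seteqP.
Qed.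

Lemma orthants_generate n : @measurable _ (n.-tuple RT) = <<s @orthants n >>.
Proof.
apply/seteqP; split; last first.
  apply: smallest_sub; first exact: sigma_algebra_measurable.
  exact: orthant_measurable.
pose T' := g_sigma_algebraType (@orthants n).
have mid : measurable_fun setT ((fun t => t) : T' -> n.-tuple RT).
  apply/measurable_fun_tnthP => i.
  apply: (measurability _ (RGenInftyO.measurableE R)) => _ [_ [c ->] <-].
  (* A half-space in direction [i] is the union over [m] of the orthants with bound [c] in that
     direction and [m] in all the others. *)
  rewrite setTI (_ : _ @^-1` _ = \bigcup_m
      [set t : T' | forall j, col t j 0 < if j == i then c else m%:R]); last first.
    apply/seteqP; split => [t /= tc|t [m _] /(_ i) /=].
      pose s := \sum_(j < n) `|col t j 0|.
      exists (Num.trunc s).+1 => // j; case: eqP => [->|_].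
        by move: tc; rewrite in_itv/= mxE.
      apply: (le_lt_trans (ler_norm _)); apply: le_lt_trans (truncnS_gt s).
      by rewrite /s (bigD1 j)//= lerDl sumr_ge0.
    by rewrite eqxx mxE in_itv.
  apply: bigcupT_measurable => m; apply: sub_sigma_algebra.
  by exists (fun j => if j == i then c else m%:R).
move=> S mS; have := mid measurableT S mS.
by rewrite setTI.
Qed.

Lemma orthantsI n : setI_closed (@orthants n).
Proof.
move=> _ _ [a ->] [b ->]; exists (fun i => Num.min (a i) (b i)).
apply/seteqP; split => t /=.
  by move=> [H1 H2] i; rewrite lt_min H1 H2.
by move=> H; split => i; have := H i; rewrite lt_min => /andP[].
Qed.

Lemma bigcup_orthants n :
  \bigcup_m [set t : n.-tuple RT | forall i, col t i 0 < m%:R] = setT.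
Proof.
apply/seteqP; split => // t _.
pose s := \sum_(j < n) `|col t j 0|.
exists (Num.trunc s).+1 => // j.
apply: (le_lt_trans (ler_norm _)); apply: le_lt_trans (truncnS_gt s).
by rewrite /s (bigD1 j)//= lerDl sumr_ge0.
Qed.

Section boxes.
Variables (n : nat) (O : set 'cV[R]_n) (h : 'cV[R]_n -> R).
Hypothesis oO : open O.
Hypothesis lh : loc_integrable O h.
Hypothesis h0 : forall a b e, 0 < e -> cbox a b `<=` O ->
  (\int[tmeas n]_(t in colpre (cbox a b)) (h (col t) * box_bump a b e (col t))%:E = 0)%E.

Let mcbox (a b : 'I_n -> R) : measurable (colpre (cbox a b)).
Proof. exact: (mset_compact (@compact_cbox R n a b)). Qed.

Let mobox (a b : 'I_n -> R) : measurable (colpre (obox a b)).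
Proof. exact: (@mset_obox R n a b). Qed.

Let inth (a b : 'I_n -> R) : cbox a b `<=` O ->
  (tmeas n).-integrable (colpre (cbox a b)) (EFin \o (h \o @col_of_tuple R n)).
Proof. by move=> abO; apply: loc_integrable_cpt lh _ abO => //; exact: compact_cbox. Qed.

Lemma obox_sub_cbox (a b : 'I_n -> R) : obox a b `<=` cbox a b.
Proof. by move=> x xab i; have /andP[/ltW -> /ltW ->] := xab i. Qed.

(** Dominated convergence along the bumps of parameter 1/(k+1): they lie between 0 and 1, so |h|
    dominates, and they tend to the indicator of the box. *)
Let obox_eq0 (a b : 'I_n -> R) : cbox a b `<=` O ->
  (\int[tmeas n]_(t in colpre (obox a b)) (h (col t))%:E = 0)%E.
Proof.
move=> abO; have ih := inth abO.
have mh : measurable_fun (colpre (cbox a b)) (h \o @col_of_tuple R n).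
  by apply/measurable_EFinP; exact: (measurable_int _ ih).
have [|||||_ _] := @dominated_convergence _ _ _ (tmeas n) _ (mcbox a b)
  (fun k t => (h (col t) * box_bump a b k.+1%:R^-1 (col t))%:E)
  (fun t => (h (col t) * \1_(obox a b) (col t))%:E)
  (fun t => `|h (col t)|%:E).
- move=> k; apply/measurable_EFinP; apply: measurable_funM => //.
  apply: measurable_funTS; apply: continuous_measurable.
  by apply: flat_alg_continuous; apply: box_bump_flat_alg; rewrite invr_gt0.
- apply/measurable_EFinP; apply: measurable_funM => //.
  apply: measurable_funTS; exact: (measurable_indic (mobox a b)).
- apply: aeW => t _; apply: cvg_EFin; first exact: nearW.
  by apply: cvgM; [exact: cvg_cst|exact: box_bump_cvg].
- exact: (integrable_abse ih).
- apply: aeW => t k _; rewrite lee_fin normrM ler_piMr//.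
  by rewrite ger0_norm ?box_bump_ge0// box_bump_le1.
rewrite (_ : [sequence _]_n = fun=> 0%E); last first.
  by apply/funext => k; rewrite /= h0// invr_gt0.
move=> /(cvg_lim (@ereal_hausdorff R)); rewrite lim_cst//.
move=> ->.
rewrite [LHS]integral_mkcond [RHS]integral_mkcond; apply: eq_integral => t _.
rewrite !patchE; case: ifPn => [|tab].
  rewrite !inE => tab; rewrite mem_set; last exact: obox_sub_cbox.
  by rewrite indicE mem_set// mulr1.
case: ifPn => // _; rewrite indicE memNset ?mulr0//.
by move: tab; rewrite notin_setE.
Qed.

Let obox_ae0 (a b : 'I_n -> R) : cbox a b `<=` O ->
  (tmeas n).-negligible [set t | obox a b (col t) /\ h (col t) <> 0].
Proof.
move=> abO.
pose hh := (EFin \o (h \o @col_of_tuple R n)) \_ (colpre (obox a b)).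
have ihh : (tmeas n).-integrable setT hh.
  apply/(integrable_mkcond _ (mobox a b)).1.
  by apply: integrableS (inth abO) => // t; exact: obox_sub_cbox.
have hh0 : forall A, measurable A -> (\int[tmeas n]_(t in A) hh t = 0)%E.
  have Gg (m : nat) : @orthants n [set t | forall i, col t i 0 < m%:R].
    by exists (fun=> m%:R).
  apply: (integral_generated_eq0 ihh (@orthants_generate n) (@orthantsI n) Gg (@bigcup_orthants n)).
  move=> A [c ->].
  (* The orthant only lowers the upper corner of the box, so the closed box stays inside [O] and
     [obox_eq0] applies. *)
  rewrite /hh -integral_mkcondr (_ : _ `&` _ = colpre (obox a (fun i => Num.min (b i) (c i)))).
    apply: obox_eq0 => x xab; apply: abO => i; have /andP[-> /=] := xab i.
    by rewrite le_min => /andP[].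
  apply/seteqP; split => t /=.
    by move=> [tc tab] i; have /andP[-> /=] := tab i; rewrite lt_min => ->; exact: tc.
  move=> tab; split=> i; have /andP[ta] := tab i; rewrite lt_min => /andP[tb tc] //.
  by rewrite ta.
have := integral_ae_eq measurableT ihh (measurable_cst 0%E).
move=> /(_ _)/wrap[|].
  by move=> E _ mE; rewrite hh0// integral0.
apply: negligibleS => t /= [tab ht0] /(_ I).
by rewrite /hh patchE mem_set//= => -[].
Qed.

Lemma loc_integrable_ae0 :
  (tmeas n).-negligible [set t | O (col t) /\ h (col t) <> 0].
Proof.
(* Countable unions of negligible sets are indexed by [nat], so the pairs of a mesh and a grid point
   are enumerated through [unpickle]. *)
pose F (m : nat) : set (n.-tuple RT) :=
  if unpickle m is Some (k, v) then
    if pselect (cbox (gridlo k v) (gridhi k v) `<=` O)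
    then [set t | obox (gridlo k v) (gridhi k v) (col t) /\ h (col t) <> 0] else set0
  else set0.
apply: (@negligibleS _ _ _ _ (\bigcup_m F m)).
  move=> t /= [Ot ht]; have [k [v [xv vO]]] := grid_boxes oO Ot.
  exists (pickle (k, v)) => //; rewrite /F pickleK.
  by case: pselect.
apply: negligible_bigcup => m; rewrite /F.
case: unpickle => [[k v]|]; last exact: negligible_set0.
by case: pselect => [kvO|?]; [exact: obox_ae0|exact: negligible_set0].
Qed.

End boxes.
End fundamental_lemma.

(** * Measurability of the set where a sequence of functions does not converge *)

Section measurable_cvg.
Context d (T : measurableType d) (R : realType).

(** Turns convergence into the vanishing of an upper limit, which is a measurable function of the
    point. Both slicing arguments need the set of non-convergence to be measurable. *)
Lemma cvg_limn_esup_dist (u : nat -> R) (l : R) :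
  u @ \oo --> l <-> limn_esup (fun k => `|u k - l|%:E) = 0%E.
Proof.
split=> [ul|h].
  have : (fun k => `|u k - l|%:E) @ \oo --> 0%E.
    apply: cvg_EFin; first exact: nearW.
    by rewrite -[0](@normr0 _ R) -(subrr l); apply: cvg_norm; apply: cvgB; [|exact: cvg_cst].
  by move=> /cvg_limn_einf_sup[].
have /fine_cvgP[_ /=] : (fun k => `|u k - l|%:E) @ \oo --> 0%E.
  by apply: limn_esup_le_cvg; [rewrite h|move=> k; rewrite lee_fin].
move=> c0; apply/cvgrPdist_lt => e e0; have /cvgrPdist_lt/(_ e e0) := c0.
by apply: filterS => k /=; rewrite sub0r normrN normr_id distrC.
Qed.

Lemma measurable_not_cvg (u : nat -> T -> R) (l : T -> R) :
  (forall k, measurable_fun setT (u k)) -> measurable_fun setT l ->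
  measurable [set x | ~ (u^~ x @ \oo --> l x)].
Proof.
move=> mu ml; pose s x := limn_esup (fun k => `|u k x - l x|%:E).
have ms : measurable_fun setT s.
  apply: (@measurable_fun_limn_esup _ _ _ _ (fun k x => `|u k x - l x|%:E)) => k.
  apply/measurable_EFinP; apply: measurableT_comp => //.
  exact: measurable_funB.
rewrite (_ : mkset _ = setT `&` [set x | s x != 0%E]); last first.
  rewrite setTI; apply/seteqP; split => x /=.
    by apply: contra_notN => /eqP s0; apply/cvg_limn_esup_dist.
  by move=> /eqP s0; apply: contra_not s0 => /cvg_limn_esup_dist.
exact: emeasurable_neq.
Qed.

End measurable_cvg.

Section weak_gradient_unique.
Context {R : realType}.
Local Notation col := (@col_of_tuple R _).
Local Notation colpre D := (@col_of_tuple R _ @^-1` D).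

(** The cut-offs to [O] and to [K] are the same function, and integrability over [K] lets [iintE]
    apply to it. *)
Lemma integral_on_supp n (O K : set 'cV[R]_n) (f : 'cV[R]_n -> R) :
  compact K -> K `<=` O -> (forall x, ~ K x -> f x = 0) ->
  (tmeas n).-integrable (colpre K) (EFin \o (f \o @col_of_tuple R n)) ->
  integral_on O (fun x => (f x)%:E) = (\int[tmeas n]_(t in colpre K) (f (col t))%:E)%E.
Proof.
move=> cK KO fK intf; have mK : measurable (colpre K) by exact: mset_compact.
have E : ((EFin \o f) \o @col_of_tuple R n) \_ (colpre O) =
    (EFin \o (f \o @col_of_tuple R n)) \_ (colpre K).
  apply/funext => t; rewrite !patchE; case: ifPn => [tO|tO].
    case: ifPn => // tK /=; rewrite fK//.
    by move: tK; rewrite notin_setE.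
  rewrite ifF//; apply/negbTE; apply: contra tO.
  by rewrite !inE; exact: KO.
rewrite /integral_on -[LHS]/(iint (fun t => ((\1_O (col t))%:E * (EFin \o f) (col t))%E)).
rewrite restrict_colpre E integral_mkcond iintE//.
exact/(integrable_mkcond _ mK).1.
Qed.

Lemma loc_integrableB n (O : set 'cV[R]_n) (f g : 'cV[R]_n -> R) : open O ->
  loc_integrable O f -> loc_integrable O g ->
  loc_integrable O (fun x => f x - g x).
Proof.
move=> oO lf lg; split.
  by apply: measurable_funB; [exact: lf.1|exact: lg.1].
move=> K cK KO; have mK : measurable (colpre K) by exact: mset_compact.
have := integrableB mK (loc_integrable_cpt oO lf cK KO) (loc_integrable_cpt oO lg cK KO).
move=> /integrableP[mfg fg]; rewrite ge0_integral_onE//.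
exact: (@measurableT_comp _ _ _ _ _ _ abse _ _ _ mfg).
Qed.

Lemma integrableM_bounded n (K : set 'cV[R]_n) (g phi : 'cV[R]_n -> R) (C : R) :
  compact K -> (tmeas n).-integrable (colpre K) (EFin \o (g \o @col_of_tuple R n)) ->
  measurable_fun setT (phi \o @col_of_tuple R n) ->
  (forall x, `|phi x| <= C) ->
  (tmeas n).-integrable (colpre K) (fun t => (g (col t) * phi (col t))%:E).
Proof.
move=> cK ig mphi phiC; have mK : measurable (colpre K) by exact: mset_compact.
have mg : measurable_fun (colpre K) (g \o @col_of_tuple R n).
  by apply/measurable_EFinP; exact: (measurable_int _ ig).
apply: (@le_integrable _ _ _ _ _ mK _ (fun t => (C%:E * (g (col t))%:E)%E)).
- apply/measurable_EFinP; apply: measurable_funM => //.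
  exact: measurable_funTS mphi.
- move=> t _; rewrite lee_fin !normrM mulrC ler_wpM2r//.
  exact: le_trans (phiC _) (ler_norm _).
- exact: integrableZl.
Qed.

(** Both gradients have the same finite integral against every box bump, so their difference
    satisfies the hypothesis of [loc_integrable_ae0]. *)
Lemma weak_gradient_unique n (O : set 'cV[R]_n) (f : 'cV[R]_n -> R)
    (g1 g2 : 'cV[R]_n -> 'cV[R]_n) (j : 'I_n) : open O ->
  weak_gradient O f g1 -> weak_gradient O f g2 ->
  (tmeas n).-negligible [set t | O (col t) /\ g1 (col t) j 0 <> g2 (col t) j 0].
Proof.
move=> oO [lf [lg1 w1]] [_ [lg2 w2]].
have := @loc_integrable_ae0 R n O (fun x => g1 x j 0 - g2 x j 0) oO
  (loc_integrableB oO (lg1 j) (lg2 j)).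
move=> /(_ _)/wrap[|]; last first.
  by apply: negligibleS => t /= [Ot g12]; split => // /eqP; rewrite subr_eq0 => /eqP.
move=> a b e e0 abO.
have tphi := box_bump_test_fun e0 abO.
have cK := @compact_cbox R n a b.
have mK : measurable (colpre (cbox a b)) by exact: mset_compact.
have phi0 x : ~ cbox a b x -> box_bump a b e x = 0.
  by move=> xab; apply: box_bump_out => /(@obox_sub_cbox R n).
have mphi : measurable_fun setT (box_bump a b e \o @col_of_tuple R n).
  by apply: continuous_measurable; apply: flat_alg_continuous; exact: box_bump_flat_alg.
have phiC x : `|box_bump a b e x| <= 1.
  by rewrite ger0_norm ?box_bump_ge0// box_bump_le1.
have i1 := integrableM_bounded cK (loc_integrable_cpt oO (lg1 j) cK abO) mphi phiC.
have i2 := integrableM_bounded cK (loc_integrable_cpt oO (lg2 j) cK abO) mphi phiC.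
have := w1 _ tphi j; rewrite (w2 _ tphi j) => /oppe_inj.
rewrite (integral_on_supp (K := cbox a b))//; last first.
  by move=> x /phi0 ->; rewrite mulr0.
rewrite (integral_on_supp (K := cbox a b))//; last first.
  by move=> x /phi0 ->; rewrite mulr0.
move=> E.
transitivity (\int[tmeas n]_(t in colpre (cbox a b)) ((g1 (col t) j 0 * box_bump a b e (col t))%:E
  - (g2 (col t) j 0 * box_bump a b e (col t))%:E))%E.
  by apply: eq_integral => t _; rewrite -EFinB mulrBl.
rewrite integralB// E subee//.
by apply: integrable_fin_num.
Qed.

End weak_gradient_unique.

(** * Weak gradients of Lipschitz functions *)

Section partial.
Context {R : realType}.
Local Notation RT := (measurableTypeR R).
Local Notation col := (@col_of_tuple R _).
Local Notation leb := (@lebesgue_measure R).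

(** The l^1 norm carries all Lipschitz estimates: its inequalities are coordinatewise and the basis
    vectors have norm 1. The Euclidean assumptions are converted once, at the very end. *)
Definition norm1 n (v : 'cV[R]_n) : R := \sum_(i < n) `|v i 0|.

Lemma norm1_ge0 n (v : 'cV[R]_n) : 0 <= norm1 v.
Proof. by rewrite sumr_ge0. Qed.

Lemma norm1Z n (c : R) (v : 'cV[R]_n) : norm1 (c *: v) = `|c| * norm1 v.
Proof. by rewrite /norm1 mulr_sumr; apply: eq_bigr => i _; rewrite mxE normrM. Qed.

Lemma norm1_ecv n (j : 'I_n) : norm1 (@ecv R n j) = 1.
Proof.
rewrite /norm1 (bigD1 j)//= mxE !eqxx normr1 big1 ?addr0// => i ij.
by rewrite mxE (negbTE ij) normr0.
Qed.

Lemma norm1D n (u v : 'cV[R]_n) : norm1 (u + v) <= norm1 u + norm1 v.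
Proof. by rewrite /norm1 -big_split ler_sum// => i _; rewrite mxE ler_normD. Qed.

Lemma norm1N n (v : 'cV[R]_n) : norm1 (- v) = norm1 v.
Proof. by apply: eq_bigr => i _; rewrite mxE normrN. Qed.

Lemma lipschitz1_continuous n (F : 'cV[R]_n -> R) (L : R) :
  (forall x y, `|F x - F y| <= L * norm1 (x - y)) -> continuous F.
Proof.
move=> FL x; apply/(@cvgrPdist_lt _ _ _ _ (nbhs_filter x)) => e e0.
have L0 : 0 < (`|L| + 1) * n.+1%:R by rewrite mulr_gt0// ltr_wpDl.
pose r : R := e / ((`|L| + 1) * n.+1%:R).
have r0 : 0 < r by exact: divr_gt0.
apply/nbhs_ballP; exists r => // y [_ xy]; apply: le_lt_trans (FL x y) _.
have xyr : norm1 (x - y) <= n%:R * r.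
  apply: (@le_trans _ _ (\sum_(i < n) r)); last by rewrite sumr_const card_ord mulr_natl.
  by rewrite ler_sum// => i _; rewrite !mxE; exact/ltW/xy.
apply: (@le_lt_trans _ _ ((`|L| + 1) * (n%:R * r))).
  apply: (@le_trans _ _ ((`|L| + 1) * norm1 (x - y))).
    by rewrite ler_wpM2r ?norm1_ge0// (le_trans (ler_norm L))// lerDl.
  by rewrite ler_wpM2l// addr_ge0.
have -> : e = (`|L| + 1) * (n%:R * r) + (`|L| + 1) * r.
  transitivity (r * ((`|L| + 1) * n.+1%:R)); first by rewrite divfK// gt_eqF.
  by rewrite -natr1; ring.
by rewrite ltrDl mulr_gt0// ltr_wpDl.
Qed.

Section lipschitz.
Variables (n : nat) (L : R) (F : 'cV[R]_n -> R) (j : 'I_n).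
Hypothesis L0 : 0 <= L.
Hypothesis FL : forall x y, `|F x - F y| <= L * norm1 (x - y).

(** The steps form a sequence, as measurable upper limits and dominated convergence require. *)
Definition dq n (j : 'I_n) (k : nat) (F : 'cV[R]_n -> R) (x : 'cV[R]_n) : R :=
  k.+1%:R * (F (x + k.+1%:R^-1 *: @ecv R n j) - F x).

(* The truncation of the limsup makes this total, measurable and bounded by L; it is the
   limit of the difference quotients wherever they converge. *)
Definition partial (x : 'cV[R]_n) : R :=
  Num.max (- L) (Num.min L (fine (limn_esup (fun k => (dq j k F x)%:E)))).

Let cF : continuous F. Proof. exact: lipschitz1_continuous FL. Qed.
Let mF : measurable_fun setT (F \o @col_of_tuple R n).
Proof. exact: continuous_measurable. Qed.

Lemma measurable_shift (G : 'cV[R]_n -> R) (v : 'cV[R]_n) :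
  measurable_fun setT (G \o @col_of_tuple R n) ->
  measurable_fun setT (fun t : n.-tuple RT => G (col t + v)).
Proof.
move=> mG; under eq_fun do rewrite -col_taddv.
exact: (measurableT_comp mG (measurable_taddv v)).
Qed.

Lemma measurable_dq k : measurable_fun setT (fun t : n.-tuple RT => dq j k F (col t)).
Proof.
apply: measurable_funM => //; apply: measurable_funB => //.
exact: measurable_shift.
Qed.

Lemma dq_le k x : `|dq j k F x| <= L.
Proof.
have K0 : (0 : R) < k.+1%:R by rewrite ltr0n.
rewrite /dq normrM gtr0_norm// mulrC -ler_pdivlMr//.
apply: le_trans (FL _ _) _.
by rewrite addrC addKr norm1Z norm1_ecv mulr1 gtr0_norm ?invr_gt0.
Qed.

Lemma partial_le x : `|partial x| <= L.
Proof.
rewrite /partial; set r := fine _; rewrite ler_norml; apply/andP; split.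
  by rewrite le_max lexx.
rewrite ge_max ge_min lexx/= andbT; move: L0; lra.
Qed.

Lemma cvg_partial x (l : R) : (fun k => dq j k F x) @ \oo --> l -> partial x = l.
Proof.
move=> xl; have : (fun k => (dq j k F x)%:E) @ \oo --> l%:E.
  by apply: cvg_EFin => //; exact: nearW.
move=> /cvg_limn_einf_sup[_ E]; rewrite /partial E/=.
have : `|l| <= L.
  rewrite -(cvg_lim _ (cvg_norm xl))//; apply: limr_le.
    by apply/cvg_ex; exists `|l|; exact: cvg_norm.
  by apply: nearW => k; exact: dq_le.
rewrite ler_norml => /andP[l1 l2].
by rewrite min_r// max_r.
Qed.

Lemma measurable_partial : measurable_fun setT (partial \o @col_of_tuple R n).
Proof.
apply: measurable_maxr => //; apply: measurable_minr => //.
apply: (measurableT_comp (fine_measurable measurableT)).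
apply: (@measurable_fun_limn_esup _ _ _ _ (fun k t => (dq j k F (col t))%:E)) => k.
by apply/measurable_EFinP; exact: measurable_dq.
Qed.

(** The set is measurable and meets each line in direction [j] in a null set, by the one-variable
    result applied to the restriction of [F] to the line. *)
Lemma dq_cvg_partial :
  (tmeas n).-negligible [set t | ~ ((fun k => dq j k F (col t)) @ \oo --> partial (col t))].
Proof.
have mN := measurable_not_cvg measurable_dq measurable_partial.
exists [set t | ~ ((fun k => dq j k F (col t)) @ \oo --> partial (col t))].
split => //; apply: (tmeas_slice0 (v := @ecv R n j)) => // t.
pose f (s : R) := F (col t + s *: @ecv R n j).
have fL x y : `|f x - f y| <= L * `|x - y|.
  apply: le_trans (FL _ _) _.
  by rewrite opprD addrACA subrr add0r -scalerBl norm1Z norm1_ecv mulr1.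
suff : leb.-negligible [set s | ~ (fun k => dq j k F (col (taddv (s *: @ecv R n j) t))) @ \oo -->
    partial (col (taddv (s *: @ecv R n j) t))].
  apply: measure_negligible.
  have mline : measurable_fun setT (fun s : RT => taddv (s *: @ecv R n j) t).
    apply/measurable_fun_tnthP => i.
    rewrite (_ : _ \o _ = fun s : RT => tnth t i + s * @ecv R n j i 0); last first.
      by apply/funext => s /=; rewrite tnth_mktuple mxE.
    by apply: measurable_funD => //; exact: measurable_funM.
  by have := mline measurableT _ mN; rewrite setTI.
have := lipschitz_ae_cvg fL; apply: negligibleS => s /=; apply: contra_not.
move=> /cvg_ex[l xl].
have E : (fun k => dq j k F (col (taddv (s *: @ecv R n j) t))) =
    (fun k => k.+1%:R * (f (s + k.+1%:R^-1) - f s)).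
  by apply/funext => k; rewrite /dq /f col_taddv -addrA -scalerDl.
by rewrite E (@cvg_partial _ l)// E.
Qed.

End lipschitz.
End partial.

(** * Integration by parts for Lipschitz functions against test functions *)

Section weak_gradient_exists.
Context {R : realType}.
Local Notation RT := (measurableTypeR R).
Local Notation col := (@col_of_tuple R _).
Local Notation colpre D := (@col_of_tuple R _ @^-1` D).

Lemma compact_support_bounded n (K : set 'cV[R]_n) (f : 'cV[R]_n -> R) :
  compact K -> continuous f -> (forall x, ~ K x -> f x = 0) ->
  exists2 C, 0 <= C & forall x, `|f x| <= C.
Proof.
move=> cK cf f0.
have /compact_bounded[M [_ HM]] : compact (f @` K).
  by apply: continuous_compact => //; exact: continuous_subspaceT.
exists (`|M| + 1); first by rewrite addr_ge0.
have M1 : M < `|M| + 1 by rewrite (le_lt_trans (ler_norm M))// ltrDl.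
move=> x; have [Kx|Kx] := pselect (K x); last by rewrite f0// normr0 addr_ge0.
by apply: (HM _ M1); exists x.
Qed.

Lemma is_derive_on_line n (f : 'cV[R]_n -> R) (x v : 'cV[R]_n) (h l : R) :
  is_derive (h *: v + x) v f l ->
  is_derive h (1 : R) (fun s : R => f (s *: v + x)) l.
Proof.
move=> [df dl].
have E : (fun s : R => s^-1 *: (((fun k : R => f (k *: v + x)) \o shift h) (s *: 1)
    - f (h *: v + x))) = (fun s => s^-1 *: ((f \o shift (h *: v + x)) (s *: v) - f (h *: v + x))).
  apply/funext => s /=; rewrite scalerDl addrA.
  by rewrite (_ : s *: (1 : R) = s)//; exact: mulr1.
by apply: DeriveDef; [rewrite /derivable E|rewrite /derive E].
Qed.

Section test.
Variables (n : nat) (phi : 'cV[R]_n -> R) (j : 'I_n).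
Hypothesis sphi : smooth phi.

Let dphi := pder [:: j] phi.

Let dphiP x : is_derive x (@ecv R n j) phi (dphi x).
Proof. by have [_ /(_ j x) d] := sphi [::]; apply: DeriveDef. Qed.

(** Backward quotient: up to sign, the adjoint of the forward quotient [dq] under translation. *)
Definition bdq (k : nat) (x : 'cV[R]_n) : R :=
  k.+1%:R * (phi x - phi (x - k.+1%:R^-1 *: @ecv R n j)).

(** The mean value theorem on the segment from [x] back by one step gives a bound independent of
    [k], as dominated convergence requires. *)
Lemma bdq_le C k x : (forall y, `|dphi y| <= C) -> `|bdq k x| <= C.
Proof.
move=> dC; have K0 : (0 : R) < k.+1%:R by rewrite ltr0n.
set a : R := k.+1%:R^-1; have a0 : 0 < a by rewrite invr_gt0.
pose psi (s : R) := phi (s *: @ecv R n j + x).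
have dpsi (s : R) : is_derive s (1:R) psi (dphi (s *: @ecv R n j + x)).
  by apply: is_derive_on_line; exact: dphiP.
have [||c _ E] := @MVT_segment R psi (fun s => dphi (s *: @ecv R n j + x)) (- a) 0.
- by rewrite oppr_le0 ltW.

- apply: continuous_subspaceT => s.
  have [d _] := dpsi s.
  by apply: differentiable_continuous; exact/derivable1_diffP.
have -> : bdq k x = dphi (c *: @ecv R n j + x).
  rewrite /bdq -/a; move: E; rewrite /psi scale0r add0r scaleNr [- _ + x]addrC => ->.
  by rewrite sub0r opprK mulrCA divff ?mulr1// gt_eqF.
exact: dC.
Qed.

Lemma bdq_cvg x : (fun k => bdq k x) @ \oo --> dphi x.
Proof.
have [d <-] := dphiP x.
have /cvgr_dnbhsP H := d.
have := H (fun k => - k.+1%:R^-1) _.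
move=> /(_ _)/wrap[|].
  split; first by move=> k; rewrite oppr_eq0 invr_neq0// pnatr_eq0.
  by rewrite -oppr0; apply: cvgN; exact: cvg_harmonic.
apply: cvg_trans.
rewrite (_ : (fun k => bdq k x) = (fun k : nat => (- k.+1%:R^-1)^-1 *:
   ((phi \o shift x) (- k.+1%:R^-1 *: @ecv R n j) - phi x)))//.
apply/funext => k; rewrite /bdq /= invrN invrK.
rewrite (_ : - k.+1%:R^-1 *: @ecv R n j = - (k.+1%:R^-1 *: @ecv R n j)) ?scaleNr//.
by rewrite [- _ + x]addrC -[RHS]mulrN opprB.
Qed.

Lemma pder_out (K : set 'cV[R]_n) : closed K -> (forall x, ~ K x -> phi x = 0) ->
  forall x, ~ K x -> dphi x = 0.
Proof.
move=> cK phi0 x Kx.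
have : is_derive x (@ecv R n j) phi 0.
  apply: (@near_eq_is_derive _ _ _ (cst 0)).
  have : nbhs x (~` K) by apply: open_nbhs_nbhs; split => //; exact: closed_openC.
  by apply: filterS => y /phi0 ->.
by have [_ <-] := dphiP x => -[_].
Qed.

End test.
Lemma integral_suppT n (K : set 'cV[R]_n) (f : 'cV[R]_n -> R) :
  (forall x, ~ K x -> f x = 0) ->
  (\int[tmeas n]_(t in colpre K) (f (col t))%:E = \int[tmeas n]_t (f (col t))%:E)%E.
Proof.
move=> f0; rewrite integral_mkcond; apply: eq_integral => t _.
rewrite patchE; case: ifPn => // tK; rewrite f0//.
by move: tK; rewrite notin_setE.
Qed.

Lemma integrable_suppT n (K : set 'cV[R]_n) (f : 'cV[R]_n -> R) :
  Defs.mset K -> (forall x, ~ K x -> f x = 0) ->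
  (tmeas n).-integrable (colpre K) (EFin \o (f \o @col_of_tuple R n)) ->
  (tmeas n).-integrable setT (EFin \o (f \o @col_of_tuple R n)).
Proof.
move=> mK f0 /(integrable_mkcond _ mK).1.
rewrite (_ : _ \_ _ = EFin \o (f \o @col_of_tuple R n))//.
apply/funext => t; rewrite patchE; case: ifPn => // tK /=; rewrite f0//.
by move: tK; rewrite notin_setE.
Qed.

Lemma bounded_integrable n (K : set 'cV[R]_n) (f : 'cV[R]_n -> R) (C : R) :
  compact K -> measurable_fun setT (f \o @col_of_tuple R n) ->
  (forall x, K x -> `|f x| <= C) ->
  (tmeas n).-integrable (colpre K) (EFin \o (f \o @col_of_tuple R n)).
Proof.
move=> cK mf fC; have mK : measurable (colpre K) by exact: mset_compact.
have mfK : measurable_fun (colpre K) (f \o @col_of_tuple R n) by exact: measurable_funTS.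
have [m Km] := compact_sub_cbox cK.
apply/integrableP; split; first exact/measurable_EFinP.
apply: (@le_lt_trans _ _ (\int[tmeas n]_(t in colpre K) (`|C|%:E))%E).
  apply: ge0_le_integral => //.
  - by apply/measurable_EFinP; exact: measurableT_comp.
  - by move=> t Kt; rewrite lee_fin (le_trans _ (ler_norm _))// fC.
rewrite integral_cst// lte_mul_pinfty//.
apply: le_lt_trans (tmeas_cbox (fun=> - m%:R) (fun=> m%:R)).
apply: le_measure; rewrite ?inE//.
  exact: (mset_compact (@compact_cbox R n _ _)).
by move=> t; exact: Km.
Qed.

Section lipschitz_weak_gradient.
Variables (n : nat) (L : R) (F : 'cV[R]_n -> R).
Hypothesis L0 : 0 <= L.
Hypothesis FL : forall x y, `|F x - F y| <= L * norm1 (x - y).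

Let cF : continuous F. Proof. exact: lipschitz1_continuous FL. Qed.
Let mF : measurable_fun setT (F \o @col_of_tuple R n).
Proof. exact: continuous_measurable. Qed.

Lemma lipschitz1_cbox_bounded (m : nat) : exists2 C, 0 <= C &
  forall x, cbox (fun=> - m%:R) (fun=> m%:R) x -> `|F x| <= C.
Proof.
exists (`|F 0| + L * (n%:R * m%:R)); first by rewrite addr_ge0// !mulr_ge0.
move=> x xm; rewrite -[F x](subrK (F 0)) addrC.
apply: le_trans (ler_normD _ _) _; rewrite lerD2l.
apply: le_trans (FL _ _) _; rewrite ler_wpM2l// subr0 /norm1.
apply: (@le_trans _ _ (\sum_(i < n) m%:R)); last by rewrite sumr_const card_ord mulr_natl.
by rewrite ler_sum// => i _; rewrite ler_norml; exact: xm.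
Qed.

Section test.
Variables (K : set 'cV[R]_n) (phi : 'cV[R]_n -> R) (j : 'I_n).
Hypothesis sphi : smooth phi.
Hypothesis cK : compact K.
Hypothesis phi0 : forall x, ~ K x -> phi x = 0.

Let dphi := pder [:: j] phi.
Let cphi : continuous phi. Proof. exact: (sphi [::]).1. Qed.
Let cdphi : continuous dphi. Proof. exact: (sphi [:: j]).1. Qed.
Let mphi : measurable_fun setT (phi \o @col_of_tuple R n).
Proof. exact: continuous_measurable. Qed.
Let mK : measurable (colpre K). Proof. exact: mset_compact. Qed.
Let dphi0 x : ~ K x -> dphi x = 0.
Proof. by apply: pder_out => //; apply: compact_closed. Qed.

Let intFphi : (tmeas n).-integrable setT (EFin \o ((fun x => F x * phi x) \o @col_of_tuple R n)).
Proof.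
have [m Km] := compact_sub_cbox cK.
have [C C0 HC] := lipschitz1_cbox_bounded m.
have [D D0 HD] := compact_support_bounded cK cphi phi0.
apply: (integrable_suppT mK); first by move=> x /phi0 ->; rewrite mulr0.
apply: (@bounded_integrable _ _ _ (C * D)) => //; first exact: measurable_funM.
by move=> x Kx; rewrite normrM ler_pM// HC//; exact: Km.
Qed.

Lemma integral_bdq k :
  (\int[tmeas n]_t (F (col t) * bdq phi j k (col t))%:E =
   - \int[tmeas n]_t (dq j k F (col t) * phi (col t))%:E)%E.
Proof.
set v := k.+1%:R^-1 *: @ecv R n j.
pose q (t : n.-tuple RT) := (F (col t + v) * phi (col t))%:E.
have iq : (tmeas n).-integrable setT q.
  have [m Km] := compact_sub_cbox cK.
  have [C C0 HC] := lipschitz1_cbox_bounded m.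
  have [D D0 HD] := compact_support_bounded cK cphi phi0.
  apply: (integrable_suppT (K := K) (f := fun x => F (x + v) * phi x)) => //.
    by move=> x /phi0 ->; rewrite mulr0.
  apply: (@bounded_integrable _ _ _ ((C + L * norm1 v) * D)) => //.
    by apply: measurable_funM => //; exact: measurable_shift.
  move=> x Kx; rewrite normrM ler_pM// -[F (x + v)](subrK (F x)) addrC.
  apply: le_trans (ler_normD _ _) _; rewrite lerD ?HC//; first exact: Km.
  by apply: le_trans (FL _ _) _; rewrite addrC addKr.
pose p (t : n.-tuple RT) := (F (col t) * phi (col t))%:E.
(* [r] is [F] times the translate of [phi] that occurs in [bdq]; by translation invariance it has
   the same integral as [q], where the shift sits on [F]. *)
pose r (t : n.-tuple RT) := q (taddv (- v) t).
have ir : (tmeas n).-integrable setT r by exact: integrable_taddv.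
have qr : (\int[tmeas n]_t r t = \int[tmeas n]_t q t)%E.
  by apply: integral_taddv; exact: measurable_int iq.
have -> : (\int[tmeas n]_t (F (col t) * bdq phi j k (col t))%:E =
    \int[tmeas n]_t (k.+1%:R%:E * (p t - r t)))%E.
  apply: eq_integral => t _; rewrite /p /r /q col_taddv subrK -EFinB -EFinM.
  by rewrite /bdq -/v; congr EFin; ring.
have -> : (\int[tmeas n]_t (dq j k F (col t) * phi (col t))%:E =
    \int[tmeas n]_t (k.+1%:R%:E * (q t - p t)))%E.
  apply: eq_integral => t _; rewrite /p /q -EFinB -EFinM.
  by rewrite /dq -/v; congr EFin; ring.
have ip : (tmeas n).-integrable setT p by exact: intFphi.
rewrite integralZl//; last exact: integrableB.
rewrite integralZl//; last exact: integrableB.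
rewrite !integralB// qr.
have pfin : (\int[tmeas n]_t p t)%E \is a fin_num by exact: integrable_fin_num.
have qfin : (\int[tmeas n]_t q t)%E \is a fin_num by exact: integrable_fin_num.
rewrite -(fineK pfin) -(fineK qfin) -!EFinB -!EFinM -EFinN; congr EFin; ring.
Qed.

(* The discrete integration by parts follows from translation invariance; both sides pass
   to the limit by dominated convergence. *)
Lemma lipschitz_weak_derivative :
  (\int[tmeas n]_t (F (col t) * dphi (col t))%:E =
   - \int[tmeas n]_t (partial L F j (col t) * phi (col t))%:E)%E.
Proof.
have [D D0 HD] := compact_support_bounded cK cphi phi0.
have [C C0 HC] := compact_support_bounded cK cdphi dphi0.
have [m Km] := compact_sub_cbox cK.
(* The backward quotient of [phi] is supported in [K] enlarged by one step, of length at most 1. The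
   cube of half-side m + 1 contains this set for all [k] at once. *)
have [B B0 HB] := lipschitz1_cbox_bounded m.+1.
pose box := cbox (fun _ : 'I_n => - m.+1%:R) (fun=> m.+1%:R : R).
have mbox : measurable (colpre box) by exact: (mset_compact (@compact_cbox R n _ _)).
have [|||||_ _ l1] := @dominated_convergence _ _ _ (tmeas n) _ measurableT
  (fun k t => (F (col t) * bdq phi j k (col t))%:E)
  (fun t => (F (col t) * dphi (col t))%:E)
  (fun t => (B * C * \1_box (col t))%:E).
- move=> k; apply/measurable_EFinP; apply: measurable_funM => //.
  apply: measurable_funM => //; apply: measurable_funB => //.
  exact: (measurable_shift (- (k.+1%:R^-1 *: @ecv R n j)) mphi).
- apply/measurable_EFinP; apply: measurable_funM => //.
  exact: (continuous_measurable cdphi).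
- apply: aeW => t _; apply: cvg_EFin; first exact: nearW.
  by apply: cvgM; [exact: cvg_cst|exact: bdq_cvg].
- apply: (integrable_suppT (K := box) (f := fun x => B * C * \1_box x)) => //.
    by move=> x xb; rewrite indicE memNset// mulr0.
  apply: (@bounded_integrable _ _ _ (B * C)); first exact: compact_cbox.
    by apply: measurable_funM => //; exact: (measurable_indic mbox).
  move=> x xb; rewrite indicE mem_set// mulr1 ger0_norm ?mulr_ge0//.
- apply: aeW => t k _; rewrite lee_fin normrM.
  have [tb|tb] := pselect (box (col t)).
    rewrite indicE mem_set// mulr1 ler_pM//; first exact: HB.
    by apply: bdq_le => //; exact: HC.
  rewrite /bdq !phi0 ?subrr ?mulr0 ?normr0 ?mulr0 ?mulr_ge0//.
    move=> /Km tm; apply: tb => i; have := tm i.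
    rewrite !mxE -[m.+1%:R]natr1 => /andP[].
    set a : R := (X in X * _); set b : R := (X in _ * X).
    have a0 : 0 <= a by rewrite invr_ge0.
    have a1 : a <= 1 by rewrite invf_le1// ler1n.
    have b01 : b = 0 \/ b = 1 by rewrite /b; case: (i == j); [right|left].
    by case: b01 => -> t1 t2; apply/andP; split; move: a0 a1 t1 t2; lra.
  move=> /Km tm; apply: tb => i; have := tm i.
  by rewrite -[m.+1%:R]natr1 => /andP[t1 t2]; apply/andP; split; lra.
have [|||||_ _ l2] := @dominated_convergence _ _ _ (tmeas n) _ measurableT
  (fun k t => (dq j k F (col t) * phi (col t))%:E)
  (fun t => (partial L F j (col t) * phi (col t))%:E)
  (fun t => (L * `|phi (col t)|)%:E).
- move=> k; apply/measurable_EFinP; apply: measurable_funM => //.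
  exact: (measurable_dq j FL k).
- apply/measurable_EFinP; apply: measurable_funM => //.
  exact: (measurable_partial j FL).
- have := (dq_cvg_partial j FL); apply: negligibleS => t /= h xcvg; apply: h => _.
  apply: cvg_EFin; first exact: nearW.
  by apply: cvgM => //; exact: cvg_cst.
- apply: (integrable_suppT (K := K) (f := fun x => L * `|phi x|)) => //.
    by move=> x /phi0 ->; rewrite normr0 mulr0.
  apply: (@bounded_integrable _ _ _ (L * D)) => //.
    by apply: measurable_funM => //; exact: measurableT_comp.
  by move=> x _; rewrite normrM normr_id ger0_norm// ler_wpM2l.
- apply: aeW => t k _; rewrite lee_fin normrM ler_wpM2r//.
  exact: dq_le.
apply: (cvg_unique _ l1); first exact: ereal_hausdorff.
rewrite (_ : [sequence _]_n = fun k => (- \int[tmeas n]_t (dq j k F (col t) * phi (col t))%:E)%E).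
  exact: cvgeN.
by apply/funext => k /=; exact: integral_bdq.
Qed.

End test.
End lipschitz_weak_gradient.
End weak_gradient_exists.

(** * Lipschitz functions on an open set *)

Section lipschitz_on.
Context {R : realType}.
Local Notation col := (@col_of_tuple R _).
Local Notation colpre D := (@col_of_tuple R _ @^-1` D).

(** McShane's extension is the infimum over z in [O] of f z + L |x - z|. An empty [O] is treated
    apart because this infimum needs a nonempty set. *)
Lemma mcshane n (O : set 'cV[R]_n) (f : 'cV[R]_n -> R) (L : R) : 0 <= L ->
  (forall x y, O x -> O y -> `|f x - f y| <= L * norm1 (x - y)) ->
  exists F : 'cV[R]_n -> R, (forall x y, `|F x - F y| <= L * norm1 (x - y)) /\
    forall x, O x -> F x = f x.
Proof.
move=> L0 fL.
have [[z0 Oz0]|O0] := pselect (exists z, O z); last first.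
  exists (fun=> 0); split; last by move=> x Ox; exfalso; apply: O0; exists x.
  by move=> x y; rewrite subrr normr0 mulr_ge0// norm1_ge0.
pose S x := [set f z + L * norm1 (x - z) | z in O].
have tri (x y z : 'cV[R]_n) : L * norm1 (x - z) <= L * norm1 (x - y) + L * norm1 (y - z).
  rewrite -mulrDr ler_wpM2l// (le_trans _ (norm1D _ _))//.
  by rewrite addrA subrK.
have flb y z : O y -> O z -> f y - L * norm1 (y - z) <= f z.
  by move=> Oy Oz; have := fL _ _ Oy Oz; rewrite ler_norml => /andP[_]; lra.
have lbS x : lbound (S x) (f z0 - L * norm1 (x - z0)).
  move=> _ [z Oz <-]; have := flb _ _ Oz0 Oz; have := tri z0 x z.
  by rewrite -(norm1N (z0 - x)) opprB; lra.
have S0 x : S x !=set0 by exists (f z0 + L * norm1 (x - z0)); exists z0.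
have hlb x : has_lbound (S x) by eexists; exact: lbS.
pose F x := inf (S x).
have FD x y : F x <= F y + L * norm1 (x - y).
  rewrite -lerBlDr; apply: lb_le_inf => // _ [z Oz <-].
  rewrite lerBlDr; apply: le_trans (_ : f z + L * norm1 (x - z) <= _).
    by apply: ge_inf => //; exists z.
  by have := tri x y z; lra.
exists F; split.
  move=> x y; rewrite ler_norml; have := FD x y; have := FD y x.
  by rewrite -(norm1N (y - x)) opprB => h1 h2; apply/andP; split; lra.
move=> x Ox; apply/eqP; rewrite eq_le; apply/andP; split.
  apply: ge_inf => //; exists x => //.
  by rewrite subrr /norm1 big1 ?mulr0 ?addr0// => i _; rewrite mxE normr0.
apply: lb_le_inf => // _ [z Oz <-].
by have := flb _ _ Ox Oz; lra.
Qed.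

Lemma near_shift_ecv n (O : set 'cV[R]_n) (j : 'I_n) x : open O -> O x ->
  \forall k \near \oo, O (x + k.+1%:R^-1 *: @ecv R n j).
Proof.
move=> oO Ox; have /nbhs_ballP[e /= e0 xeO] : nbhs x O by exact: open_nbhs_nbhs.
near=> k; apply: xeO; split => // i i0; rewrite ord1 !mxE.
rewrite /ball/= opprD addNKr normrN.
rewrite eqxx andbT; case: (i == j); rewrite ?mulr0 ?normr0 ?mulr1//.
rewrite gtr0_norm ?invr_gt0//.
by near: k; exact: (near_infty_natSinv_lt (PosNum e0)).
Unshelve. all: by end_near. Qed.

(** Small steps stay in the open set, so convergence of the quotients only depends on the values
    there; this lets extensions replace [f]. *)
Lemma near_dq_eq n (O : set 'cV[R]_n) (f F : 'cV[R]_n -> R) (j : 'I_n) x :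
  open O -> O x -> (forall y, O y -> F y = f y) ->
  \forall k \near \oo, dq j k F x = dq j k f x.
Proof.
move=> oO Ox Ff; apply: filterS (near_shift_ecv j oO Ox) => k Ok.
by rewrite /dq !Ff.
Qed.

(** The last clause concerns every point and not almost every one. It later yields the value of the
    gradient at any prescribed parameter where the quotients are shown to converge. *)
Lemma lipschitz_on_weak_gradient n (O : set 'cV[R]_n) (f : 'cV[R]_n -> R) (L : R) :
  open O -> 0 <= L ->
  (forall x y, O x -> O y -> `|f x - f y| <= L * norm1 (x - y)) ->
  exists g : 'cV[R]_n -> 'cV[R]_n, [/\ weak_gradient O f g,
    forall j, (tmeas n).-negligible
      [set t | O (col t) /\ ~ ((fun k => dq j k f (col t)) @ \oo --> g (col t) j 0)] &
    forall x j l, O x -> (fun k => dq j k f x) @ \oo --> l -> g x j 0 = l].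
Proof.
move=> oO L0 fL; have [F [FL Ff]] := mcshane L0 fL.
have dqE x j l : O x -> (fun k => dq j k F x) @ \oo --> l <->
    (fun k => dq j k f x) @ \oo --> l.
  move=> Ox; have E := near_dq_eq j oO Ox Ff.
  split; apply: cvg_trans; apply: near_eq_cvg => //.
  by apply: filterS E => k ->.
have mO : measurable (colpre O) by exact: mset_open.
exists (fun x => \col_j partial L F j x); split.
- have lf : loc_integrable O f.
    apply: bounded_loc_integrable => //.
      apply: (@eq_measurable_fun _ _ _ _ _ (F \o @col_of_tuple R n)).
        by move=> t; rewrite inE => Ot /=; exact: Ff.
      apply: measurable_funTS; apply: continuous_measurable.
      exact: lipschitz1_continuous FL.
    move=> m; have [C C0 HC] := lipschitz1_cbox_bounded L0 FL m.
    by exists C => x Ox xm; rewrite -Ff//; exact: HC.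
  have E j : (fun x : 'cV[R]_n => (\col_i partial L F i x) j 0) = partial L F j.
    by apply/funext => x; rewrite mxE.
  split => //; split => [j|phi [sphi [K [cK [KO phi0]]]] j].
    rewrite E; apply: bounded_loc_integrable => //.
      by apply: measurable_funTS; exact: (measurable_partial j FL).
    by move=> m; exists L => x _ _; exact: partial_le.
  have mK : measurable (colpre K) by exact: mset_compact.
  have [m Km] := compact_sub_cbox cK.
  have cphi := (sphi [::]).1; have cdphi := (sphi [:: j]).1.
  have dphi0 := @pder_out R n phi j sphi K (compact_closed (@norm_hausdorff _ _) cK) phi0.
  have [D D0 HD] := compact_support_bounded cK cphi phi0.
  have [C C0 HC] := compact_support_bounded cK cdphi dphi0.
  have [B B0 HB] := lipschitz1_cbox_bounded L0 FL m.
  have mF : measurable_fun setT (F \o @col_of_tuple R n).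
    by apply: continuous_measurable; exact: lipschitz1_continuous FL.
  have mdphi := continuous_measurable cdphi.
  have mphi := continuous_measurable cphi.
  have intFd : (tmeas n).-integrable (colpre K)
      (EFin \o ((fun x => F x * pder [:: j] phi x) \o @col_of_tuple R n)).
    apply: (@bounded_integrable _ _ _ _ (B * C)) => //; first exact: measurable_funM.
    by move=> x Kx; rewrite normrM ler_pM// HB//; exact: Km.
  have intfd : (tmeas n).-integrable (colpre K)
      (EFin \o ((fun x => f x * pder [:: j] phi x) \o @col_of_tuple R n)).
    apply: eq_integrable intFd => // t; rewrite inE => Kt /=.
    by rewrite Ff//; exact: KO.
  rewrite (integral_on_supp (K := K) (f := fun x => f x * pder [:: j] phi x))//; last first.
    by move=> x /dphi0 ->; rewrite mulr0.
  rewrite (integral_on_supp (K := K)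
      (f := fun x => (\col_i partial L F i x) j 0 * phi x))//; first last.
  + apply: (@bounded_integrable _ _ _ _ (L * D)) => //.
      apply: measurable_funM => //; rewrite (_ : (fun t => _) = partial L F j \o @col_of_tuple R n).
        exact: (measurable_partial j FL).
      by apply/funext => t; rewrite mxE.
    by move=> x _; rewrite mxE normrM ler_pM// partial_le.
  + by move=> x /phi0 ->; rewrite mulr0.
  transitivity (\int[tmeas n]_(t in colpre K) (F (col t) * pder [:: j] phi (col t))%:E)%E.
    by apply: eq_integral => t; rewrite inE => Kt; rewrite Ff//; exact: KO.
  rewrite (integral_suppT (K := K) (f := fun x => F x * pder [:: j] phi x)); last first.
    by move=> x /dphi0 ->; rewrite mulr0.
  rewrite (lipschitz_weak_derivative L0 FL j sphi cK phi0); congr (- _)%E.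
  rewrite (integral_suppT (K := K) (f := fun x => (\col_i partial L F i x) j 0 * phi x)).
    by apply: eq_integral => t _; rewrite mxE.
  by move=> x /phi0 ->; rewrite mulr0.
- move=> j; apply: negligibleS (dq_cvg_partial j FL) => t /= [Ot].
  by rewrite mxE; apply: contra_not => /dqE; exact.
- move=> x j l Ox /dqE => /(_ Ox) xl; rewrite mxE; exact: cvg_partial xl.
Qed.

End lipschitz_on.

(** * Gaussian expectations *)

Section gauss.
Context {R : realType} (P : nat) (sigma : R) (mu0 : 'cV[R]_P).
Hypothesis sigma0 : 0 < sigma.
Local Notation RT := (measurableTypeR R).
Local Notation col := (@col_of_tuple R _).
Local Notation lam := (tmeas P).

Lemma gauss_density_prod (s : R) (t : P.-tuple RT) : s != 0 ->
  gauss_density s mu0 (col t) = \prod_(i < P) normal_pdf (mu0 i 0) s (tnth t i).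
Proof.
move=> s0; rewrite /gauss_density /enorm2.
under [RHS]eq_bigr do rewrite normal_pdfE///= /normal_fun /normal_peak.
rewrite big_split/= prodr_const card_ord; congr (_ ^+ _ * _).
  by congr (Num.sqrt _)^-1; rewrite -mulr_natl; ring.
rewrite -expR_sum; congr expR.
rewrite mulNr mulr_suml -sumrN; apply: eq_bigr => i _.
by rewrite !mxE mulNr mulr_natl.
Qed.

Lemma gauss_density_ge0 s (y : 'cV[R]_P) : 0 <= gauss_density s mu0 y.
Proof. by rewrite mulr_ge0 ?expR_ge0// exprn_ge0// invr_ge0 sqrtr_ge0. Qed.

Lemma measurable_gauss_density s : s != 0 ->
  measurable_fun setT (gauss_density s mu0 \o @col_of_tuple R P).
Proof.
move=> s0; rewrite (_ : _ \o _ = fun t : P.-tuple RT =>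
    \prod_(i < P) normal_pdf (mu0 i 0) s (tnth t i)).
  apply: measurable_prod => i _.
  exact: (measurableT_comp (measurable_normal_pdf _ _) (@measurable_tnth _ RT _ i)).
by apply/funext => t /=; rewrite gauss_density_prod.
Qed.

Lemma integral_gauss_density s : s != 0 ->
  (\int[lam]_t (gauss_density s mu0 (col t))%:E = 1)%E.
Proof.
move=> s0; under eq_integral do rewrite gauss_density_prod//.
rewrite (@integral_tmeas_prod R P (fun i => normal_pdf (mu0 i 0) s) (fun=> 1)).
- by rewrite prodr_const expr1n.
- by move=> i; exact: measurable_normal_pdf.
- by move=> i x; exact: normal_pdf_ge0.
- by move=> i; exact: integral_normal_pdf.
Qed.

Lemma integrable_gauss_density s : s != 0 ->
  lam.-integrable setT (fun t => (gauss_density s mu0 (col t))%:E).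
Proof.
move=> s0; apply/integrableP; split.
  by apply/measurable_EFinP; exact: measurable_gauss_density.
under eq_integral do rewrite gee0_abs ?lee_fin ?gauss_density_ge0//.
by rewrite integral_gauss_density// ltry.
Qed.

(* Dominates the quadratic moments and, by AM-GM, the difference quotients [gquot] of the
   density; it stays integrable because 1 / 4 < 1 / 2. *)
Definition gauss_weight (y : 'cV[R]_P) : R :=
  (1 + enorm2 (y - mu0)) * expR (enorm2 (y - mu0) / (4 * sigma ^+ 2)).

Lemma enorm2_ge0 n (v : 'cV[R]_n) : 0 <= enorm2 v.
Proof. by rewrite sumr_ge0// => i _; rewrite sqr_ge0. Qed.

Lemma gauss_weight_ge0 y : 0 <= gauss_weight y.
Proof. by rewrite mulr_ge0 ?expR_ge0// addr_ge0// enorm2_ge0. Qed.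

(** With N = |y - mu0|^2, the product has exponent - N / (4 sigma^2), which splits into two halves -
    N / (8 sigma^2). One half absorbs 1 + N through 1 + x <= exp x, the other is the exponent of the
    Gaussian with deviation 2 sigma; c1 / c2 is the ratio of the normalisations. *)
Lemma gauss_weight_dom : exists2 C, 0 <= C & forall y,
  gauss_weight y * gauss_density sigma mu0 y <= C * gauss_density (2 * sigma) mu0 y.
Proof.
have s2 : 0 < sigma ^+ 2 by rewrite exprn_gt0.
pose c1 := (Num.sqrt (2 * pi * sigma ^+ 2))^-1 ^+ P : R.
pose c2 := (Num.sqrt (2 * pi * (2 * sigma) ^+ 2))^-1 ^+ P : R.
have c10 : 0 <= c1 by rewrite exprn_ge0// invr_ge0 sqrtr_ge0.
have c20 : 0 < c2.
  by rewrite exprn_gt0// invr_gt0 sqrtr_gt0 mulr_gt0 ?exprn_gt0 ?mulr_gt0 ?pi_gt0.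
exists (c1 / c2 * (1 + 8 * sigma ^+ 2)).
  by rewrite !mulr_ge0 ?invr_ge0 ?(ltW c20)// addr_ge0// mulr_ge0// ltW.
move=> y; rewrite /gauss_weight /gauss_density -/c1 -/c2; set N := enorm2 _.
have N0 : 0 <= N by exact: enorm2_ge0.
rewrite (_ : c1 / c2 * _ * _ = c1 * ((1 + 8 * sigma ^+ 2) *
    expR (- N / (2 * (2 * sigma) ^+ 2)))); last first.
  by field; rewrite gt_eqF.
rewrite mulrCA ler_wpM2l// -mulrA -expRD.
have -> : N / (4 * sigma ^+ 2) + - N / (2 * sigma ^+ 2) =
    - (N / (8 * sigma ^+ 2)) + - N / (2 * (2 * sigma) ^+ 2).
  by field; rewrite gt_eqF.
rewrite expRD mulrA ler_wpM2r ?expR_ge0// expRN ler_pdivrMr ?expR_gt0//.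
apply: le_trans (_ : (1 + 8 * sigma ^+ 2) * (1 + N / (8 * sigma ^+ 2)) <= _).
  rewrite mulrDl !mulrDr !mul1r !mulr1.
  rewrite [8 * sigma ^+ 2 * (_ / _)]mulrC divfK ?gt_eqF ?mulr_gt0//.
  have : 0 <= N / (8 * sigma ^+ 2) by rewrite divr_ge0// mulr_ge0// ltW.
  have : 0 <= 8 * sigma ^+ 2 by rewrite mulr_ge0// ltW.
  by lra.
by rewrite ler_wpM2l ?expR_ge1Dx// addr_ge0// mulr_ge0// ltW.
Qed.

Lemma gauss_dct (f_ : nat -> 'cV[R]_P -> R) (f : 'cV[R]_P -> R) (C : R) :
  (forall k, measurable_fun setT (f_ k \o @col_of_tuple R P)) ->
  measurable_fun setT (f \o @col_of_tuple R P) ->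
  {ae lam, forall t, (fun k => f_ k (col t)) @ \oo --> f (col t)} ->
  {ae lam, forall t, forall k, `|f_ k (col t)| <= C * gauss_weight (col t)} ->
  lam.-integrable setT (fun t => (f (col t) * gauss_density sigma mu0 (col t))%:E) /\
  (fun k => \int[lam]_t (f_ k (col t) * gauss_density sigma mu0 (col t))) @ \oo -->
    \int[lam]_t (f (col t) * gauss_density sigma mu0 (col t)).
Proof.
move=> mf_ mf f_f f_C; have [D D0 HD] := gauss_weight_dom.
have s0 : sigma != 0 by rewrite gt_eqF.
have s20 : 2 * sigma != 0 by rewrite gt_eqF// mulr_gt0.
have mg := measurable_gauss_density s0.
have [|||||i1 _ l1] := @dominated_convergence _ _ _ lam _ measurableT
  (fun k t => (f_ k (col t) * gauss_density sigma mu0 (col t))%:E)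
  (fun t => (f (col t) * gauss_density sigma mu0 (col t))%:E)
  (fun t => ((`|C| * D)%:E * (gauss_density (2 * sigma) mu0 (col t))%:E)%E).
- by move=> k; apply/measurable_EFinP; exact: (measurable_funM (mf_ k) mg).
- by apply/measurable_EFinP; exact: (measurable_funM mf mg).
- apply: filterS f_f => t h _; apply: cvg_EFin; first exact: nearW.
  by apply: cvgM => //; exact: cvg_cst.
- by apply: integrableZl => //; exact: integrable_gauss_density.
- apply: filterS f_C => t h k _; rewrite -EFinM lee_fin normrM.
  rewrite (ger0_norm (gauss_density_ge0 _ _)) -mulrA.
  apply: le_trans (_ : `|C| * (gauss_weight (col t) * gauss_density sigma mu0 (col t)) <= _).
    rewrite [leRHS]mulrA ler_wpM2r ?gauss_density_ge0//; apply: le_trans (h k) _.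
    by rewrite ler_wpM2r ?gauss_weight_ge0// ler_norm.
  by rewrite ler_wpM2l.
split => //; rewrite /Rintegral.
apply: fine_cvg; rewrite fineK; first exact: l1.
exact: integrable_fin_num.
Qed.

End gauss.

Section gauss_expectation.
Context {R : realType} (P : nat) (sigma : R) (mu0 : 'cV[R]_P).
Hypothesis sigma0 : 0 < sigma.
Local Notation col := (@col_of_tuple R _).
Local Notation lam := (tmeas P).
Local Notation G := (gauss_density sigma mu0).
Local Notation w := (gauss_weight sigma mu0).
Local Notation E := (gE sigma mu0).

(** The functions on which [gE] is shown to be linear. The bound is only almost everywhere because,
    for a fixed parameter, [J] is bounded only for almost every [y]. *)
Definition gdom (h : 'cV[R]_P -> R) : Prop :=
  measurable_fun setT (h \o @col_of_tuple R P) /\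
  exists C, {ae lam, forall t, `|h (col t)| <= C * w (col t)}.

Lemma gdom_integrable h : gdom h ->
  lam.-integrable setT (fun t => (h (col t) * G (col t))%:E).
Proof.
move=> [mh [C hC]].
have [] := @gauss_dct R P sigma mu0 sigma0 (fun=> h) h C (fun=> mh) mh.
- by apply: aeW => t; exact: cvg_cst.
- by apply: filterS hC => t ht _.
- by [].
Qed.

Lemma gE_int h : gdom h -> E h = \int[lam]_t (h (col t) * G (col t)).
Proof.
move=> dh; rewrite /gE /gexp integral_onE.
- rewrite preimage_setT /Rintegral; congr fine.
- by rewrite /Defs.mset preimage_setT.
- by rewrite preimage_setT; exact: (gdom_integrable dh).
Qed.

Lemma gauss_weight_ge1 y : 1 <= w y.
Proof.
rewrite -[leLHS]mulr1 ler_pM//.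
  by rewrite lerDl enorm2_ge0.
by rewrite -expR0 ler_expR divr_ge0 ?enorm2_ge0// mulr_ge0// exprn_ge0// ltW.
Qed.

Lemma gdomD h1 h2 : gdom h1 -> gdom h2 -> gdom (fun y => h1 y + h2 y).
Proof.
move=> [m1 [C1 hC1]] [m2 [C2 hC2]]; split; first exact: measurable_funD.
exists (C1 + C2); apply: filterS2 hC1 hC2 => t h1t h2t.
by rewrite mulrDl (le_trans (ler_normD _ _))// lerD.
Qed.

Lemma gdomZ a h : gdom h -> gdom (fun y => a * h y).
Proof.
move=> [m [C hC]]; split; first exact: measurable_funM.
exists (`|a| * C); apply: filterS hC => t ht.
by rewrite normrM -mulrA ler_wpM2l.
Qed.

Lemma gdom_sum (I : finType) (h : I -> 'cV[R]_P -> R) :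
  (forall i, gdom (h i)) -> gdom (fun y => \sum_i h i y).
Proof.
move=> dh; elim: (index_enum I) => [|i s IH].
  under eq_fun do rewrite big_nil; split; first exact: measurable_cst.
  exists 0; apply: aeW => t; by rewrite normr0 mul0r.
by under eq_fun do rewrite big_cons; exact: gdomD.
Qed.

Lemma gdom_bounded (h : 'cV[R]_P -> R) C : measurable_fun setT (h \o @col_of_tuple R P) ->
  {ae lam, forall t, `|h (col t)| <= C} -> gdom h.
Proof.
move=> mh hC; split => //; exists `|C|; apply: filterS hC => t ht.
apply: le_trans ht _; apply: le_trans (ler_norm _) _.
by rewrite ler_peMr// gauss_weight_ge1.
Qed.

Lemma gdom_cst c : gdom (fun=> c).
Proof.
apply: (@gdom_bounded _ `|c|); first exact: measurable_cst.
by apply: aeW.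
Qed.

Lemma gED h1 h2 : gdom h1 -> gdom h2 -> E (fun y => h1 y + h2 y) = E h1 + E h2.
Proof.
move=> d1 d2; rewrite !gE_int//; last exact: gdomD.
rewrite -RintegralD//; [|exact: gdom_integrable..].
by apply: eq_Rintegral => t _; rewrite mulrDl.
Qed.

Lemma gEZ a h : gdom h -> E (fun y => a * h y) = a * E h.
Proof.
move=> dh; rewrite !gE_int//; last exact: gdomZ.
rewrite -RintegralZl//; last exact: gdom_integrable.
by apply: eq_Rintegral => t _; rewrite mulrA.
Qed.

Lemma gE_sum (I : finType) (h : I -> 'cV[R]_P -> R) :
  (forall i, gdom (h i)) -> E (fun y => \sum_i h i y) = \sum_i E (h i).
Proof.
(* Domination of the partial sums is carried along the induction, since additivity requires it at
   each step. *)
move=> dh; have : gdom (fun y => \sum_i h i y) /\ E (fun y => \sum_i h i y) = \sum_i E (h i).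
  elim: (index_enum I) => [|i s [IH1 IH2]].
    under eq_fun do rewrite big_nil; rewrite big_nil; split.
      exact: gdom_cst.
    by have := gEZ 0 (gdom_cst 0); under [in LHS]eq_fun do rewrite mul0r; rewrite mul0r.
  under eq_fun do rewrite big_cons; rewrite big_cons; split; first exact: gdomD.
  by rewrite gED// IH2.
by case.
Qed.

Lemma gE_cst c : E (fun=> c) = c.
Proof.
have d1 := gdom_cst 1.
have E1 : E (fun=> 1) = 1.
  rewrite gE_int// /Rintegral; under eq_integral do rewrite mul1r.
  by rewrite integral_gauss_density// gt_eqF.
by have := gEZ c d1; rewrite E1 !mulr1.
Qed.

Lemma gE_cvg (f_ : nat -> 'cV[R]_P -> R) (f : 'cV[R]_P -> R) (C : R) :
  (forall k, measurable_fun setT (f_ k \o @col_of_tuple R P)) ->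
  measurable_fun setT (f \o @col_of_tuple R P) ->
  {ae lam, forall t, (fun k => f_ k (col t)) @ \oo --> f (col t)} ->
  {ae lam, forall t, forall k, `|f_ k (col t)| <= C * w (col t)} ->
  gdom f /\ (fun k => E (f_ k)) @ \oo --> E f.
Proof.
move=> mf_ mf f_f f_C.
have df : gdom f.
  split => //; exists C; apply: filterS2 f_f f_C => t h1 h2.
  rewrite -(cvg_lim _ (cvg_norm h1))//; apply: limr_le.
    by apply/cvg_ex; exists `|f (col t)|; exact: cvg_norm.
  by apply: nearW => k; exact: h2.
split => //; rewrite gE_int//.
have [_] := gauss_dct sigma0 mf_ mf f_f f_C.
rewrite (_ : (fun k => E (f_ k)) =
  (fun k => \int[lam]_t (f_ k (col t) * G (col t))))//.
apply/funext => k; apply: gE_int; split => //; exists C.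
by apply: filterS f_C.
Qed.

End gauss_expectation.

(** * Difference quotients of the Gaussian density *)

Section gauss_fd.
Context {R : realType} (P : nat) (sigma : R) (mu0 : 'cV[R]_P).
Hypothesis sigma0 : 0 < sigma.
Local Notation RT := (measurableTypeR R).
Local Notation G := (gauss_density sigma mu0).
Local Notation w := (gauss_weight sigma mu0).
Local Notation E := (gE sigma mu0).

Lemma negligible_taddv n (v : 'cV[R]_n) (N : set (n.-tuple RT)) :
  (tmeas n).-negligible N -> (tmeas n).-negligible [set t | N (taddv v t)].
Proof.
move=> [B [mB B0 NB]].
have mpre : measurable (taddv v @^-1` B).
  by rewrite -[X in measurable X]setTI; exact: measurable_taddv.
exists (taddv v @^-1` B); split => //; last by move=> t; exact: NB.
have := @ge0_integral_taddv R n v (fun t => (\1_B t)%:E).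
move=> /(_ _ _)/wrap[||].
- by apply/measurable_EFinP; exact: measurable_indic.
- by move=> t; rewrite lee_fin.
rewrite [RHS]integral_indic// setIT [RHS]B0 => <-.
by rewrite -[X in tmeas n X]setIT -integral_indic.
Qed.

(** The relative quotient (G(y - e e_i) - G(y)) / (e G(y)), with the ratio of densities written as
    one exponential. *)
Definition gquot (i : 'I_P) (e : R) (y : 'cV[R]_P) : R :=
  e^-1 * (expR (e * ((y - mu0) i 0 / sigma ^+ 2) - e ^+ 2 / (2 * sigma ^+ 2)) - 1).

Lemma gauss_density_shift (i : 'I_P) (e : R) (y : 'cV[R]_P) : e != 0 ->
  G (y - e *: @ecv R P i) = G y * (1 + e * gquot i e y).
Proof.
move=> e0; rewrite /gquot mulVKf// [1 + _]addrC subrK /gauss_density -[RHS]mulrA -expRD.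
congr (_ * expR _).
have -> : enorm2 (y - e *: @ecv R P i - mu0) =
    enorm2 (y - mu0) - 2 * e * (y - mu0) i 0 + e ^+ 2.
  rewrite /enorm2 (bigD1 i)//= [in RHS](bigD1 i)//= !mxE !eqxx mulr1.
  rewrite (eq_bigr (fun k => ((y - mu0) k 0) ^+ 2)).
    by ring.
  by move=> k ki; rewrite !mxE (negbTE ki) mulr0 subr0.
by field; rewrite gt_eqF.
Qed.

Lemma gquot_cvg (i : 'I_P) (y : 'cV[R]_P) (u : nat -> R) :
  (forall k, 0 < u k) -> u @ \oo --> (0 : R) ->
  (fun k => gquot i (u k) y) @ \oo --> (y - mu0) i 0 / sigma ^+ 2.
Proof.
move=> u0 ucvg; set a := _ / _; set b : R := (2 * sigma ^+ 2)^-1.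
pose f (e : R) := expR (e * a - e ^+ 2 * b).
have da : is_derive (0:R) (1:R) f a.
  have d1 : is_derive (0:R) (1:R) (fun e : R => e * a - e ^+ 2 * b) a.
    have dd := is_deriveB (is_deriveM (is_derive_id (0:R) (1:R)) (is_derive_cst a (0:R) (1:R)))
     (is_deriveM (is_deriveX 2 (is_derive_id (0:R) (1:R))) (is_derive_cst b (0:R) (1:R))).
    rewrite [X in is_derive _ _ X _](_ : _ =
      (id : R -> R) * cst a - (id : R -> R) ^+ 2 * cst b); last first.
      by apply/funext => e; rewrite !fctE.
    by apply: (is_derive_eq dd); rewrite /GRing.scale/=; ring.
  have de := @is_derive1_comp R expR _ 0 _ _ (is_derive_expR _) d1.
  apply: (is_derive_eq de).
  by rewrite !mul0r expr0n/= mul0r subr0 expR0 mul1r.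
have [d dl] := da.
have /cvgr_dnbhsP H : h^-1 *: ((f \o shift 0) (h *: 1) - f 0) @[h --> (0:R)^'] --> a.
  by rewrite -dl; exact: d.
have := H u (conj (fun k => lt0r_neq0 (u0 k)) ucvg).
rewrite (_ : (fun k => gquot i (u k) y) = (fun k => (u k)^-1 *:
   ((f \o shift 0) (u k *: 1) - f 0)))//.
apply/funext => k; rewrite /gquot /f /= addr0 !mul0r expr0n/= mul0r subr0 expR0.
by rewrite (_ : u k *: (1 : R) = u k)//; exact: mulr1.
Qed.

(** The exponent is at most e c in absolute value with c = |u| / sigma^2 + b, where e <= 1 absorbs
    the quadratic term. Then |exp x - 1| <= |x| exp |x| bounds the quotient by c exp c <= exp(2 c),
    and 2 |u| <= 4 + u^2 / 4 gives both the constant and the 1/4 in the exponent of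
    [gauss_weight]. *)
Lemma gquot_bound : exists2 C, 0 <= C & forall i e y, 0 < e -> e <= 1 ->
  `|gquot i e y| <= C * w y.
Proof.
have s2 : 0 < sigma ^+ 2 by rewrite exprn_gt0.
pose b : R := (2 * sigma ^+ 2)^-1.
have b0 : 0 <= b by rewrite invr_ge0 mulr_ge0// ltW.
exists (expR (2 * b + 4 / sigma ^+ 2)); first exact: expR_ge0.
move=> i e y e0 e1; rewrite /gquot.
set u := (y - mu0) i 0; set x := _ - _ / _.
pose c : R := `|u| / sigma ^+ 2 + b.
have c0 : 0 <= c by rewrite addr_ge0// divr_ge0// ltW.
have xc : `|x| <= e * c.
  rewrite /x /c mulrDr; apply: le_trans (ler_normB _ _) _; apply: lerD.
    by rewrite normrM (gtr0_norm e0) normrM normfV (gtr0_norm s2).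
  rewrite ger0_norm; last by rewrite divr_ge0 ?sqr_ge0// mulr_ge0// ltW.
  by rewrite ler_wpM2r// expr2 ler_piMl// ltW.
have exp1 (z : R) : `|expR z - 1| <= `|z| * expR `|z|.
  have h1 := expR_ge1Dx z; have h2 := expR_ge1Dx (- z).
  have ez : expR (- z) * expR z = 1 by rewrite -expRD addNr expR0.
  have ez0 := expR_gt0 z.
  have [z0|z0] := leP 0 z.
    rewrite !ger0_norm//; last by move: h1 z0; lra.
    have : (1 - z) * expR z <= 1 by rewrite -[leRHS]ez ler_wpM2r ?expR_ge0//.
    by lra.
  rewrite ltr0_norm; last by rewrite subr_lt0 expR_lt1.
  rewrite (ltr0_norm z0) opprB.
  apply: (@le_trans _ _ (- z * 1)); first by move: h1; lra.
  rewrite ler_wpM2l ?oppr_ge0 ?ltW//.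
  by rewrite -expR0 ltr_expR oppr_gt0.
have st1 : `|e^-1 * (expR x - 1)| <= c * expR c.
  rewrite normrM normfV (gtr0_norm e0) ler_pdivrMl//.
  apply: le_trans (exp1 x) _; rewrite [leRHS]mulrA; apply: ler_pM; rewrite ?expR_ge0//.
  rewrite ler_expR; apply: le_trans xc _.
  by rewrite ler_piMl.
have st2 : c * expR c <= expR c * expR c.
  by rewrite ler_wpM2r ?expR_ge0// (le_trans _ (expR_ge1Dx _))// lerDr.
apply: (le_trans st1); apply: (le_trans st2).
have uN : u ^+ 2 <= enorm2 (y - mu0).
  by rewrite /enorm2 (bigD1 i)//= lerDl sumr_ge0// => k _; rewrite sqr_ge0.
have amgm : 2 * (`|u| / sigma ^+ 2) <= 4 / sigma ^+ 2 + u ^+ 2 / (4 * sigma ^+ 2).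
  rewrite -subr_ge0 -(real_normK (num_real u)).
  rewrite (_ : _ - _ = (`|u| / 2 - 2) ^+ 2 / sigma ^+ 2).
    by rewrite divr_ge0 ?sqr_ge0.
  by field; rewrite gt_eqF.
have uN4 : u ^+ 2 / (4 * sigma ^+ 2) <= enorm2 (y - mu0) / (4 * sigma ^+ 2).
  by rewrite ler_wpM2r// invr_ge0 mulr_ge0// ltW.
rewrite -expRD /gauss_weight mulrCA -expRD.
apply: (@le_trans _ _ (1 * expR (2 * b + 4 / sigma ^+ 2 + enorm2 (y - mu0) / (4 * sigma ^+ 2)))).
  by rewrite mul1r ler_expR; move: amgm uN4; rewrite /c; lra.
by rewrite ler_wpM2r ?expR_ge0// lerDl enorm2_ge0.
Qed.

End gauss_fd.

(** * Expectations of finite differences in the observation *)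

Section gauss_fd_limit.
Context {R : realType} (P : nat) (sigma : R) (mu0 : 'cV[R]_P).
Hypothesis sigma0 : 0 < sigma.
Local Notation RT := (measurableTypeR R).
Local Notation col := (@col_of_tuple R _).
Local Notation lam := (tmeas P).
Local Notation G := (gauss_density sigma mu0).
Local Notation w := (gauss_weight sigma mu0).
Local Notation E := (gE sigma mu0).
Local Notation gdom := (gdom sigma mu0).

Lemma measurable_gquot i e :
  measurable_fun setT (gquot sigma mu0 i e \o @col_of_tuple R P).
Proof.
apply: measurable_funM => //; apply: measurable_funB => //.
apply: measurableT_comp => //; apply: measurable_funB => //.
apply: measurable_funM => //; apply: measurable_funM => //.
rewrite (_ : (fun _ => _) = fun t : P.-tuple RT => col t i 0 - mu0 i 0).
  by apply: measurable_funB => //; exact: measurable_coord.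
by apply/funext => t; rewrite !mxE.
Qed.

Section fd.
Variables (i : 'I_P) (h : 'cV[R]_P -> R) (C : R).
Hypothesis mh : measurable_fun setT (h \o @col_of_tuple R P).
Hypothesis hC : {ae lam, forall t, `|h (col t)| <= C}.

Lemma gdom_shift v : gdom (fun y => h (y + v)).
Proof.
apply: (@gdom_bounded _ _ _ _ sigma0 _ C); first exact: measurable_shift.
have : lam.-negligible (~` [set t | `|h (col t)| <= C]) by exact: hC.
move=> /(negligible_taddv v); apply: negligibleS => t /=.
by rewrite col_taddv.
Qed.

Lemma gdom_gquot e : 0 < e -> e <= 1 -> gdom (fun y => h y * gquot sigma mu0 i e y).
Proof.
move=> e0 e1; split; first exact: (measurable_funM mh (measurable_gquot i e)).
have [D D0 HD] := gquot_bound mu0 sigma0.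
exists (`|C| * D); apply: filterS hC => t ht; rewrite normrM -mulrA.
apply: ler_pM => //; last exact: HD.
exact: le_trans ht (ler_norm C).
Qed.

(** An identity for each fixed step: translating by [v] moves the shift from [h] to the density,
    where [gauss_density_shift] turns it into the factor 1 + e [gquot]. *)
Lemma gE_shift e : 0 < e -> e <= 1 ->
  E (fun y => e^-1 * (h (y + e *: @ecv R P i) - h y)) =
  E (fun y => h y * gquot sigma mu0 i e y).
Proof.
move=> e0 e1; set v := e *: _.
have dh : gdom h by exact: gdom_bounded hC.
have dhv := gdom_shift v.
have dq := gdom_gquot e0 e1.
have -> : E (fun y => e^-1 * (h (y + v) - h y)) = e^-1 * (E (fun y => h (y + v)) - E h).
  rewrite gEZ//; last by apply: gdomD => //; under eq_fun do rewrite -mulN1r; exact: gdomZ.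
  congr (_ * _).
  under eq_fun do rewrite -[- _]mulN1r.
  by rewrite gED ?gEZ ?mulN1r//; exact: gdomZ.
have -> : E (fun y => h (y + v)) = E (fun y => h y + e * (h y * gquot sigma mu0 i e y)).
  have d2 : gdom (fun y => h y + e * (h y * gquot sigma mu0 i e y)).
    by apply: gdomD => //; exact: gdomZ.
  rewrite !gE_int// /Rintegral; congr fine.
  have mG : measurable_fun setT (fun t : P.-tuple RT => G (col t)).
    by apply: measurable_gauss_density; rewrite gt_eqF.
  rewrite [RHS](_ : _ = \int[lam]_t (h (col t) * G (col t - v))%:E)%E; last first.
    apply: eq_integral => t _; congr EFin.
    by rewrite (gauss_density_shift _ sigma0 _ _ (lt0r_neq0 e0)); ring.
  rewrite -(@integral_taddv R P v (fun t => (h (col t) * G (col t - v))%:E)).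
    by apply: eq_integral => t _; rewrite !col_taddv addrK.
  apply/measurable_EFinP; apply: measurable_funM => //.
  exact: (measurable_shift (- v) mG).
rewrite gED//; last exact: gdomZ.
by rewrite gEZ// addrC addKr mulKf// gt_eqF.
Qed.

Lemma gE_fd :
  (fun e => E (fun y => e^-1 * (h (y + e *: @ecv R P i) - h y))) @ (0:R)^'+ -->
  E (fun y => h y * ((y - mu0) i 0 / sigma ^+ 2)).
Proof.
apply/cvg_at_rightP => u [u0 ucvg].
(* The domination of [gquot] requires steps at most 1, which [u] satisfies only eventually; the
   truncated sequence satisfies it at every index. *)
pose u' k := Num.min (u k) 1.
have u'0 k : 0 < u' k by rewrite lt_min u0 ltr01.
have u'1 k : u' k <= 1 by rewrite ge_min lexx orbT.
have near_u : \forall k \near \oo, u' k = u k.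
  have := @cvgr_lt R _ _ eventually_filter u 0 ucvg 1 ltr01.
  apply: (@filterS _ _ eventually_filter) => k /ltW uk.
  by rewrite /u' min_l.
have u'cvg : u' @ \oo --> (0 : R).
  apply: (cvg_trans _ ucvg); apply: (@near_eq_cvg _ _ \oo eventually_filter u u').
  by apply: filterS near_u => k ->.
have [D D0 HD] := gquot_bound mu0 sigma0.
have mlim : measurable_fun setT ((fun y => h y * ((y - mu0) i 0 / sigma ^+ 2)) \o @col_of_tuple R P).
  apply: measurable_funM => //; apply: measurable_funM => //.
  rewrite (_ : (fun _ => _) = fun t : P.-tuple RT => col t i 0 - mu0 i 0).
    by apply: measurable_funB => //; exact: measurable_coord.
  by apply/funext => t; rewrite !mxE.
have hf_f : {ae lam, forall t, (fun k => h (col t) * gquot sigma mu0 i (u' k) (col t)) @ \oo -->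
    h (col t) * ((col t - mu0) i 0 / sigma ^+ 2)}.
  apply: aeW => t; apply: cvgM; first exact: cvg_cst.
  exact: gquot_cvg.
have hf_C : {ae lam, forall t, forall k,
    `|h (col t) * gquot sigma mu0 i (u' k) (col t)| <= (`|C| * D) * w (col t)}.
  apply: filterS hC => t ht k; rewrite normrM -mulrA.
  apply: ler_pM => //; last exact: HD.
  exact: le_trans ht (ler_norm C).
have [_] := @gE_cvg R P sigma mu0 sigma0 (fun k y => h y * gquot sigma mu0 i (u' k) y)
  (fun y => h y * ((y - mu0) i 0 / sigma ^+ 2)) (`|C| * D)
  (fun k => measurable_funM mh (measurable_gquot i (u' k))) mlim hf_f hf_C.
apply: cvg_trans; apply: (@near_eq_cvg _ _ \oo eventually_filter).
apply: filterS near_u => k uk.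
by rewrite -uk gE_shift.
Qed.

End fd.
End gauss_fd_limit.

(** * Differentiation in the parameter *)

Section difference_quotients.
Context {R : realType} (n : nat) (j : 'I_n) (x : 'cV[R]_n).

Lemma cvg_big_sum (T I : Type) (F : set_system T) {FF : Filter F} (r : seq I)
    (u : I -> T -> R) (l : I -> R) :
  (forall i, u i @ F --> l i) ->
  (fun k => \sum_(i <- r) u i k) @ F --> \sum_(i <- r) l i.
Proof.
move=> ul; elim: r => [|i r IH].
  by rewrite big_nil; under eq_fun do rewrite big_nil; exact: cvg_cst.
by rewrite big_cons; under eq_fun do rewrite big_cons; exact: cvgD.
Qed.

Lemma dq_sum (I : Type) (r : seq I) (f : I -> 'cV[R]_n -> R) k :
  dq j k (fun y => \sum_(i <- r) f i y) x = \sum_(i <- r) dq j k (f i) x.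
Proof. by rewrite /dq -sumrB mulr_sumr. Qed.

Lemma dqZ c (f : 'cV[R]_n -> R) k : dq j k (fun y => c * f y) x = c * dq j k f x.
Proof. by rewrite /dq -mulrBr mulrCA. Qed.

Lemma dqB_cst c (f : 'cV[R]_n -> R) k : dq j k (fun y => f y - c) x = dq j k f x.
Proof. by rewrite /dq; congr (_ * _); ring. Qed.

Lemma cvg_dqM (f g : 'cV[R]_n -> R) (a b : R) :
  (dq j ^~ f) ^~ x @ \oo --> a -> (dq j ^~ g) ^~ x @ \oo --> b ->
  (dq j ^~ (fun y => f y * g y)) ^~ x @ \oo --> a * g x + f x * b.
Proof.
move=> fa gb.
(* The value of [g] at the shifted point is rewritten as g x plus the step times its quotient, so it
   converges to g x because the quotients do. *)
have -> : (dq j ^~ (fun y => f y * g y)) ^~ x = (fun k => dq j k f x *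
   (g x + k.+1%:R^-1 * dq j k g x) + f x * dq j k g x).
  by apply/funext => k; rewrite /dq; field; rewrite nat1r pnatr_eq0.
have h0 : (fun k : nat => k.+1%:R^-1 : R) @ \oo --> (0 : R) by exact: cvg_harmonic.
rewrite (_ : a * g x = a * (g x + 0 * b)); last by rewrite mul0r addr0.
by apply: cvgD; apply: cvgM => //; [apply: cvgD; [exact: cvg_cst|exact: cvgM]|exact: cvg_cst].
Qed.

End difference_quotients.

Section gE_bound.
Context {R : realType} (P : nat) (sigma : R) (mu0 : 'cV[R]_P).
Hypothesis sigma0 : 0 < sigma.
Local Notation col := (@col_of_tuple R _).
Local Notation w := (gauss_weight sigma mu0).
Local Notation E := (gE sigma mu0).
Local Notation gdom := (gdom sigma mu0).

Lemma measurable_enorm2 (v : 'cV[R]_P) :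
  measurable_fun setT (fun t => enorm2 (col t - v)).
Proof.
apply: measurable_sum => i; apply: measurable_funX.
rewrite (_ : (fun _ => _) = fun t => col t i 0 - v i 0).
  by apply: measurable_funB => //; exact: measurable_coord.
by apply/funext => t; rewrite !mxE.
Qed.

Lemma gdom_gauss_weight : gdom w.
Proof.
have mN := measurable_enorm2 mu0.
split; last by exists 1; apply: aeW => t; rewrite mul1r ger0_norm// gauss_weight_ge0.
apply: measurable_funM; first exact: measurable_funD.
by apply: measurableT_comp => //; exact: measurable_funM.
Qed.

Lemma ler_gE h1 h2 : gdom h1 -> gdom h2 -> (forall y, h1 y <= h2 y) -> E h1 <= E h2.
Proof.
move=> d1 d2 h12; rewrite !gE_int//; apply: le_Rintegral => //.
- exact: (gdom_integrable sigma0 d1).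
- exact: (gdom_integrable sigma0 d2).
- by move=> t _; rewrite ler_wpM2r// gauss_density_ge0.
Qed.

Lemma gEB h1 h2 : gdom h1 -> gdom h2 -> E (fun y => h1 y - h2 y) = E h1 - E h2.
Proof.
move=> d1 d2; under eq_fun do rewrite -mulN1r.
by rewrite gED ?gEZ ?mulN1r//; exact: gdomZ.
Qed.

Lemma normr_gE_le h K : gdom h -> (forall y, `|h y| <= K * w y) ->
  `|E h| <= K * E w.
Proof.
move=> dh hK; have dw := gdom_gauss_weight.
have dKw := gdomZ K dw; have dNw := gdomZ (- K) dw.
rewrite ler_norml -mulNr -!gEZ//; apply/andP; split; apply: ler_gE => // y.
  by rewrite mulNr lerNl (le_trans _ (hK y))// -normrN ler_norm.
exact: le_trans (ler_norm _) (hK y).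
Qed.

End gE_bound.

Section parameter.
Context {R : realType} (P d : nat) (sigma : R) (mu0 : 'cV[R]_P)
  (Theta : set 'cV[R]_d).
Hypothesis sigma0 : 0 < sigma.
Hypothesis oTheta : open Theta.
Local Notation col := (@col_of_tuple R _).
Local Notation lam := (tmeas P).
Local Notation w := (gauss_weight sigma mu0).
Local Notation E := (gE sigma mu0).
Local Notation gdom := (gdom sigma mu0).
Implicit Types a b p : 'cV[R]_P -> 'cV[R]_d -> R.

(** The conditions under which the expectation can be differentiated in theta: values and Lipschitz
    constants both dominated by the integrable weight, uniformly on [Theta]. *)
Definition lip_family p := exists C, [/\ 0 <= C,
  forall theta, Theta theta -> measurable_fun setT (fun t => p (col t) theta),
  forall y theta, Theta theta -> `|p y theta| <= C * w y &
  forall y th1 th2, Theta th1 -> Theta th2 ->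
    `|p y th1 - p y th2| <= C * w y * norm1 (th1 - th2)].

Lemma lip_family_gdom p theta : lip_family p -> Theta theta ->
  gdom (fun y => p y theta).
Proof.
move=> [C [C0 mp pC _]] Tth; split; first exact: mp.
by exists C; apply: aeW => t; exact: pC.
Qed.

Lemma lip_familyD p1 p2 : lip_family p1 -> lip_family p2 ->
  lip_family (fun y theta => p1 y theta + p2 y theta).
Proof.
move=> [C [C0 mp pC pL]] [D [D0 mq qD qL]]; exists (C + D); split.
- exact: addr_ge0.
- by move=> th Tth; apply: measurable_funD; [exact: mp|exact: mq].
- by move=> y th Tth; rewrite mulrDl (le_trans (ler_normD _ _))// lerD// ?pC ?qD.
- move=> y th1 th2 T1 T2; rewrite 2!mulrDl opprD addrACA.
  by rewrite (le_trans (ler_normD _ _))// lerD ?pL ?qL.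
Qed.

Lemma lip_family_sum (I : Type) (r : seq I) (p : I -> 'cV[R]_P -> 'cV[R]_d -> R) :
  (forall i, lip_family (p i)) ->
  lip_family (fun y theta => \sum_(i <- r) p i y theta).
Proof.
move=> pp; elim: r => [|i r IH]; last first.
  rewrite (_ : (fun y theta => _) = fun y theta => p i y theta +
    \sum_(k <- r) p k y theta); first exact: lip_familyD.
  by apply/funext => y; apply/funext => th; rewrite big_cons.
have w0 y : 0 <= w y by exact: gauss_weight_ge0.
exists 0; split => //.
- by move=> th _; under eq_fun do rewrite big_nil; exact: measurable_cst.
- by move=> y th _; rewrite big_nil normr0 mul0r.
- by move=> y th1 th2 _ _; rewrite !big_nil subrr normr0 !mul0r.
Qed.

Lemma lip_family_gE p : lip_family p -> exists2 L, 0 <= L &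
  forall th1 th2, Theta th1 -> Theta th2 ->
    `|E (p ^~ th1) - E (p ^~ th2)| <= L * norm1 (th1 - th2).
Proof.
move=> fp; have dp th := @lip_family_gdom p th fp; have [C [C0 mp pC pL]] := fp.
have Ew0 : 0 <= E w.
  rewrite -(gE_cst mu0 sigma0 0); apply: ler_gE => //.
  - exact: gdom_cst.
  - exact: gdom_gauss_weight.
  - by move=> y; exact: gauss_weight_ge0.
exists (C * E w); first exact: mulr_ge0.
move=> th1 th2 T1 T2; rewrite -gEB//; [|exact: dp..].
rewrite mulrAC; apply: normr_gE_le => //.
  by under eq_fun do rewrite -mulN1r; apply: gdomD; [|apply: gdomZ]; exact: dp.
by move=> y; rewrite mulrAC; exact: pL.
Qed.

Lemma cvg_dq_gE p theta (j : 'I_d) (q : 'cV[R]_P -> R) :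
  lip_family p -> Theta theta -> measurable_fun setT (q \o @col_of_tuple R P) ->
  {ae lam, forall t, (dq j ^~ (p (col t))) ^~ theta @ \oo --> q (col t)} ->
  gdom q /\ (dq j ^~ (fun th => E (p ^~ th))) ^~ theta @ \oo --> E q.
Proof.
move=> fp Tth mq pq; have dp th := @lip_family_gdom p th fp.
have [C [C0 mp pC pL]] := fp.
have nearT := near_shift_ecv j oTheta Tth.
(* For small [k] the shifted parameter may leave [Theta], where neither measurability nor bounds are
   available. Those finitely many quotients are replaced by 0. *)
pose in_ k := `[< Theta (theta + k.+1%:R^-1 *: @ecv R d j) >].
pose f_ k y := if in_ k then dq j k (p y) theta else 0.
have nf y : \forall k \near \oo, f_ k y = dq j k (p y) theta.
  by apply: filterS nearT => k Tk; rewrite /f_ /in_ asboolT.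
have mdp k : in_ k -> gdom (fun y => p y (theta + k.+1%:R^-1 *: @ecv R d j)
   - p y theta).
  move=> /asboolP ik; under eq_fun do rewrite -mulN1r.
  by apply: gdomD; [|apply: gdomZ]; exact: dp.
have mf_ k : measurable_fun setT (f_ k \o @col_of_tuple R P).
  rewrite /f_; case: (boolP (in_ k)) => ik; last exact: measurable_cst.
  by have [] := gdomZ k.+1%:R (mdp k ik).
have f_q : {ae lam, forall t, (fun k => f_ k (col t)) @ \oo --> q (col t)}.
  apply: filterS pq => t ht; apply: (cvg_trans _ ht).
  apply: (@near_eq_cvg _ _ \oo eventually_filter); by apply: filterS (nf (col t)) => k ->.
have f_C : {ae lam, forall t, forall k, `|f_ k (col t)| <= C * w (col t)}.
  apply: aeW => t k; rewrite /f_; case: (boolP (in_ k)) => [/asboolP ik|_]; last first.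
    by rewrite normr0 mulr_ge0// gauss_weight_ge0.
  rewrite normrM normr_nat -ler_pdivlMl// mulrC.
  apply: le_trans (pL _ _ _ ik Tth) _.
  by rewrite addrAC subrr add0r norm1Z norm1_ecv mulr1 ger0_norm.
have [dq_ H] := gE_cvg sigma0 mf_ mq f_q f_C; split => //.
apply: (cvg_trans _ H); apply: (@near_eq_cvg _ _ \oo eventually_filter).
apply: filterS nearT => k Tk; rewrite /f_ /in_ asboolT//.
by rewrite /dq gEZ ?gEB//; [exact: dp|exact: dp|apply: mdp; exact/asboolP].
Qed.

End parameter.

(** * Families of linear growth and their products *)

Section linear_growth.
Context {R : realType} (P d : nat) (sigma : R) (mu0 : 'cV[R]_P)
  (Theta : set 'cV[R]_d).
Local Notation col := (@col_of_tuple R _).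
Local Notation w := (gauss_weight sigma mu0).
Local Notation lip_family := (@lip_family R P d sigma mu0 Theta).
Implicit Types a b p : 'cV[R]_P -> 'cV[R]_d -> R.

(** Linear growth in a form whose square is exactly the polynomial factor of [gauss_weight], so that
    a product of two such functions is dominated by the weight. *)
Definition growth (y : 'cV[R]_P) : R := Num.sqrt (1 + enorm2 (y - mu0)).

Let n1_ge0 y : 0 <= 1 + enorm2 (y - mu0).
Proof. by rewrite addr_ge0// enorm2_ge0. Qed.

Lemma growth_sqr y : growth y * growth y = 1 + enorm2 (y - mu0).
Proof. by rewrite -expr2 sqr_sqrtr. Qed.

Lemma growth_ge1 y : 1 <= growth y.
Proof. by rewrite -[leLHS]sqrtr1 ler_sqrt// lerDl enorm2_ge0. Qed.

Lemma growth_ge0 y : 0 <= growth y.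
Proof. exact: sqrtr_ge0. Qed.

Lemma growth_sqr_le y : growth y * growth y <= w y.
Proof.
rewrite growth_sqr /gauss_weight ler_peMr//.
by rewrite -expR0 ler_expR divr_ge0 ?enorm2_ge0// mulr_ge0// exprn_even_ge0.
Qed.

Lemma growth_le y : growth y <= w y.
Proof. by rewrite (le_trans _ (growth_sqr_le y))// ler_peMr ?growth_ge0 ?growth_ge1. Qed.

Lemma coord_growth y i : `|(y - mu0) i 0| <= growth y.
Proof.
rewrite -sqrtr_sqr ler_sqrt//; apply: (@le_trans _ _ (enorm2 (y - mu0))).
  by rewrite /enorm2 (bigD1 i)//= lerDl sumr_ge0// => k _; rewrite sqr_ge0.
by rewrite lerDr.
Qed.

Lemma norm1_growth y : norm1 y <= (P%:R + norm1 mu0) * growth y.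
Proof.
rewrite -[in leLHS](subrK mu0 y) mulrDl (le_trans (norm1D _ _))// lerD//; last first.
  by rewrite ler_peMr ?norm1_ge0 ?growth_ge1.
apply: (@le_trans _ _ (\sum_(i < P) growth y)); last by rewrite sumr_const card_ord mulr_natl.
by apply: ler_sum => i _; exact: coord_growth.
Qed.

(** The Lipschitz bound has no growth in [y], in accordance with (A.3). In a product each increment
    is thus multiplied by only one factor of linear growth. *)
Definition growth_family p := exists C, [/\ 0 <= C,
  forall theta, Theta theta -> measurable_fun setT (fun t => p (col t) theta),
  forall y theta, Theta theta -> `|p y theta| <= C * growth y &
  forall y th1 th2, Theta th1 -> Theta th2 ->
    `|p y th1 - p y th2| <= C * norm1 (th1 - th2)].

Lemma growth_familyD p1 p2 : growth_family p1 -> growth_family p2 ->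
  growth_family (fun y theta => p1 y theta + p2 y theta).
Proof.
move=> [C [C0 mp pC pL]] [D [D0 mq qD qL]]; exists (C + D); split.
- exact: addr_ge0.
- by move=> th Tth; apply: measurable_funD; [exact: mp|exact: mq].
- by move=> y th Tth; rewrite mulrDl (le_trans (ler_normD _ _))// lerD// ?pC ?qD.
- move=> y th1 th2 T1 T2; rewrite mulrDl opprD addrACA.
  by rewrite (le_trans (ler_normD _ _))// lerD ?pL ?qL.
Qed.

Lemma growth_familyZ c p : growth_family p ->
  growth_family (fun y theta => c * p y theta).
Proof.
move=> [C [C0 mp pC pL]]; exists (`|c| * C); split.
- exact: mulr_ge0.
- by move=> th Tth; apply: measurable_funM => //; exact: mp.
- by move=> y th Tth; rewrite normrM -mulrA ler_wpM2l// pC.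
- by move=> y th1 th2 T1 T2; rewrite -mulrBr normrM -mulrA ler_wpM2l// pL.
Qed.

Lemma growth_family_cst c : growth_family (fun _ _ => c).
Proof.
exists `|c|; split => //.
- by move=> y th _; rewrite ler_peMr// growth_ge1.
- by move=> y th1 th2 _ _; rewrite subrr normr0 mulr_ge0// norm1_ge0.
Qed.

Lemma growth_family_coord i : growth_family (fun y _ => (y - mu0) i 0).
Proof.
exists 1; split => //.
- move=> th _; rewrite (_ : (fun _ => _) = fun t => col t i 0 - mu0 i 0).
    by apply: measurable_funB => //; exact: measurable_coord.
  by apply/funext => t; rewrite !mxE.
- by move=> y th _; rewrite mul1r coord_growth.
- by move=> y th1 th2 _ _; rewrite subrr normr0 mul1r norm1_ge0.
Qed.

Lemma growth_family_sum (I : Type) (r : seq I) (p : I -> 'cV[R]_P -> 'cV[R]_d -> R) :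
  (forall i, growth_family (p i)) ->
  growth_family (fun y theta => \sum_(i <- r) p i y theta).
Proof.
move=> pp; elim: r => [|i r IH].
  rewrite (_ : (fun y theta => _) = fun _ _ => 0); first exact: growth_family_cst.
  by apply/funext => y; apply/funext => th; rewrite big_nil.
rewrite (_ : (fun y theta => _) = fun y theta => p i y theta +
  \sum_(k <- r) p k y theta); first exact: growth_familyD.
by apply/funext => y; apply/funext => th; rewrite big_cons.
Qed.

Lemma growth_family_mulmx M (A : 'M[R]_(M, P)) (F : 'cV[R]_P -> 'cV[R]_d -> 'cV[R]_P) m :
  (forall i, growth_family (fun y th => F y th i 0)) ->
  growth_family (fun y th => (A *m F y th) m 0).
Proof.
move=> FF; rewrite (_ : (fun y th => _) = fun y th => \sum_i A m i * F y th i 0).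
  by apply: growth_family_sum => i; exact: growth_familyZ.
by apply/funext => y; apply/funext => th; rewrite mxE.
Qed.

Lemma lip_family_growthM p1 p2 : growth_family p1 -> growth_family p2 ->
  lip_family (fun y theta => p1 y theta * p2 y theta).
Proof.
(* The factor 2 counts the two terms of the discrete product rule. *)
move=> [C [C0 mp pC pL]] [D [D0 mq qD qL]]; exists (2 * (C * D)).
have CD0 : 0 <= C * D by exact: mulr_ge0.
have g0 := growth_ge0; have w0 y : 0 <= w y by exact: gauss_weight_ge0.
split.
- exact: mulr_ge0.
- by move=> th Tth; apply: measurable_funM; [exact: mp|exact: mq].
- move=> y th Tth; rewrite normrM.
  apply: (@le_trans _ _ (C * D * w y)); last first.
    by rewrite ler_wpM2r// ler_peMl// ler1n.
  apply: (@le_trans _ _ (C * growth y * (D * growth y))).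
    by rewrite ler_pM// ?pC ?qD.
  by rewrite mulrACA ler_wpM2l// growth_sqr_le.
- move=> y th1 th2 T1 T2.
  have -> : p1 y th1 * p2 y th1 - p1 y th2 * p2 y th2 =
    (p1 y th1 - p1 y th2) * p2 y th1 + p1 y th2 * (p2 y th1 - p2 y th2) by ring.
  apply: le_trans (ler_normD _ _) _; rewrite 2!normrM.
  have n0 := norm1_ge0 (th1 - th2).
  have h1 : `|p1 y th1 - p1 y th2| * `|p2 y th1| <= C * D * w y * norm1 (th1 - th2).
    apply: (@le_trans _ _ (C * norm1 (th1 - th2) * (D * growth y))).
      by rewrite ler_pM// ?pL ?qD.
    rewrite mulrACA mulrCA [leRHS]mulrC ler_wpM2l// ler_wpM2l// growth_le//.
  have h2 : `|p1 y th2| * `|p2 y th1 - p2 y th2| <= C * D * w y * norm1 (th1 - th2).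
    apply: (@le_trans _ _ (C * growth y * (D * norm1 (th1 - th2)))).
      by rewrite ler_pM// ?qL ?pC.
    by rewrite mulrACA -[leRHS]mulrA ler_wpM2l// ler_wpM2r// growth_le.
  by apply: (le_trans (lerD h1 h2)); rewrite le_eqVlt; apply/orP; left; apply/eqP; ring.
Qed.

End linear_growth.

(** * Exchange of the almost-everywhere quantifiers in the observation and in the parameter *)

Lemma ae_slices d1 d2 (T1 : measurableType d1) (T2 : measurableType d2)
    (R : realType) (m1 : {sigma_finite_measure set T1 -> \bar R})
    (m2 : {sigma_finite_measure set T2 -> \bar R}) (B : set (T1 * T2)) :
  measurable B -> (forall x, m2 [set y | B (x, y)] = 0%E) ->
  {ae m2, forall y, m1.-negligible [set x | B (x, y)]}.
Proof.
move=> mB B0.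
pose f (z : T1 * T2) : \bar R := (\1_B z)%:E.
have mf : measurable_fun setT f by apply/measurable_EFinP; exact: measurable_indic.
have f0 z : (0 <= f z)%E by rewrite lee_fin.
have mxB x : measurable [set y | B (x, y)].
  by rewrite -[X in measurable X]setTI; exact: (measurable_pair1 x).
have myB y : measurable [set x | B (x, y)].
  by rewrite -[X in measurable X]setTI; exact: (measurable_pair2 y).
have := @fubini_tonelli _ _ _ _ _ m1 m2 f mf f0.
under eq_integral => x _.
  rewrite (_ : (fun y => f (x, y)) = fun y => (\1_[set y | B (x, y)] y)%:E)//.
  rewrite integral_indic// setIT; move: (B0 x) => /= ->; over.
rewrite integral0.
have mF : measurable_fun setT (fun y => \int[m1]_x f (x, y))%E.
  exact: (@measurable_fun_fubini_tonelli_G _ _ _ _ _ m1 f mf f0).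
move/esym => H.
have : (\int[m2]_y `|\int[m1]_x f (x, y)| = 0)%E.
  rewrite -[RHS]H; apply: eq_integral => y _; rewrite gee0_abs//.
  by apply: integral_ge0 => x _.
move/(ae_eq_integral_abs m2 measurableT mF); apply: filterS => y /(_ I)/= yB.
exists [set x | B (x, y)]; split => //.
rewrite -[RHS]yB (_ : (fun x => f (x, y)) = fun x => (\1_[set x | B (x, y)] x)%:E)//.
by rewrite integral_indic// setIT.
Qed.

Section parameter_derivative.
Context {R : realType} (P d : nat) (Theta : set 'cV[R]_d).
Local Notation RT := (measurableTypeR R).
Local Notation col := (@col_of_tuple R _).
Local Notation colpre D := (@col_of_tuple R _ @^-1` D).

(** For fixed [y], uniqueness of weak gradients identifies [g y] with the limit of the quotients off
    a null set of parameters depending on [y]. These null sets are the slices of one measurable set,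
    to which [ae_slices] applies; its measurability uses continuity of [f] in [y] and joint
    measurability of [g]. *)
Lemma ae_dq_weak_gradient (f g : 'cV[R]_P -> 'cV[R]_d -> R) (j : 'I_d) (L : R) :
  open Theta -> 0 <= L ->
  (forall y th1 th2, Theta th1 -> Theta th2 ->
    `|f y th1 - f y th2| <= L * norm1 (th1 - th2)) ->
  (forall th, Theta th -> continuous (f ^~ th)) ->
  measurable_fun (setT `*` colpre Theta)
    (fun z : P.-tuple RT * d.-tuple RT => g (col z.1) (col z.2)) ->
  (forall y, exists2 G, weak_gradient Theta (f y) G & forall th, G th j 0 = g y th) ->
  {ae tmeas d, forall t, Theta (col t) ->
    {ae tmeas P, forall s, (dq j ^~ (f (col s))) ^~ (col t) @ \oo --> g (col s) (col t)}}.
Proof.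
move=> oT L0 fL cf mg wg.
have mT : measurable (colpre Theta) by exact: mset_open.
(* A shifted parameter may leave [Theta]. Extension by 0 makes the quotients jointly measurable on
   the whole product and changes only finitely many of them at each point of [Theta]. *)
pose f0 y := f y \_ Theta.
have mf0 : measurable_fun setT
    (fun z : P.-tuple RT * d.-tuple RT => f0 (col z.1) (col z.2)).
  rewrite -setXTT.
  apply: (@measurable_caratheodory _ _ (d.-tuple RT) setT P (fun y t => f0 y (col t))) => //.
    move=> y; have [G [[my _] _] _] := wg y.
    exact: (measurable_restrictT _ mT).1 my.
  move=> t _; have [Tt|Tt] := pselect (Theta (col t)).
    by rewrite /f0 /patch mem_set//; exact: cf.
  by rewrite /f0 /patch memNset//; exact: cst_continuous.
have mg0 : measurable_fun setT ((fun z : P.-tuple RT * d.-tuple RT =>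
    g (col z.1) (col z.2)) \_ (setT `*` colpre Theta)).
  by apply/(measurable_restrictT _ _).1 => //; exact: measurableX.
pose u k (z : P.-tuple RT * d.-tuple RT) := dq j k (f0 (col z.1)) (col z.2).
have mu k : measurable_fun setT (u k).
  apply: measurable_funM => //; apply: measurable_funB => //.
  pose v := k.+1%:R^-1 *: @ecv R d j.
  rewrite (_ : (fun _ => _) = (fun z : P.-tuple RT * d.-tuple RT => f0 (col z.1) (col z.2)) \o
     (fun z => (z.1, taddv v z.2))).
    apply: measurableT_comp => //; apply: measurable_fun_pair => //.
    by apply: measurableT_comp => //; exact: measurable_taddv.
  by apply/funext => z /=; rewrite col_taddv.
have uE y th : Theta th -> \forall k \near \oo, dq j k (f0 y) th = dq j k (f y) th.
  by move=> Tth; apply: (near_dq_eq _ oT) => // x Tx; rewrite /f0 /patch mem_set.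
have mB := measurableI _ _ (measurable_not_cvg mu mg0) (measurableX measurableT mT).
have := @ae_slices _ _ _ _ _ (tmeas P) (tmeas d) _ mB.
move=> /(_ _)/wrap[s|].
  have [G wG Gg] := wg (col s).
  have [g' [wg' dg' _]] := lipschitz_on_weak_gradient oT L0 (fL (col s)).
  have neg : (tmeas d).-negligible [set t | Theta (col t) /\
      ~ (dq j ^~ (f (col s)) ^~ (col t) @ \oo --> g (col s) (col t))].
    apply: negligibleS (negligibleU (dg' j) (weak_gradient_unique j oT wG wg')).
    move=> t /= [Tt H]; have [E|E] := eqVneq (G (col t) j 0) (g' (col t) j 0).
      by left; split => //; rewrite -E Gg.
    by right; split => //; exact/eqP.
  apply: measure_negligible.
    by rewrite -[X in measurable X]setTI; exact: (measurable_pair1 s).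
  apply: negligibleS neg => t /= [H [_ Tt]]; split => //; apply: contra_not H => H.
  rewrite /patch mem_set//.
  apply: (cvg_trans _ H); apply: (@near_eq_cvg _ _ \oo eventually_filter).
  by apply: filterS (uE (col s) (col t) Tt) => k.
apply: filterS => t neg Tt; apply: negligibleS neg => s /= H.
split => //=.
apply: contra_not H.
rewrite /patch mem_set// => H.
apply: (cvg_trans _ H); apply: (@near_eq_cvg _ _ \oo eventually_filter).
by apply: filterS (uE (col s) (col t) Tt) => k.
Qed.

End parameter_derivative.

(** * Limits of the finite-difference estimators *)

Section gauss_moments.
Context {R : realType} (P : nat) (sigma : R) (mu0 : 'cV[R]_P).
Hypothesis sigma0 : 0 < sigma.
Local Notation col := (@col_of_tuple R _).
Local Notation lam := (tmeas P).
Local Notation E := (gE sigma mu0).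
Local Notation gdom := (gdom sigma mu0).

Lemma growth_gdom (p : 'cV[R]_P -> R) C : measurable_fun setT (p \o @col_of_tuple R P) ->
  (forall y, `|p y| <= C * growth mu0 y) -> gdom p.
Proof.
move=> mp pC; split => //; exists `|C|; apply: aeW => t.
apply: le_trans (pC _) _; apply: le_trans (ler_wpM2r (growth_ge0 _ _) (ler_norm C)) _.
by rewrite ler_wpM2l// growth_le.
Qed.

Lemma gdom_boundedM (h p : 'cV[R]_P -> R) C : measurable_fun setT (h \o @col_of_tuple R P) ->
  {ae lam, forall t, `|h (col t)| <= C} -> gdom p -> gdom (fun y => h y * p y).
Proof.
move=> mh hC [mp [D pD]]; split; first exact: measurable_funM.
exists (`|C| * D); apply: filterS2 hC pD => t ht pt.
by rewrite normrM -mulrA ler_pM// (le_trans ht) ?ler_norm.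
Qed.

Lemma measurable_coordB i : measurable_fun setT
  ((fun y => (y - mu0) i 0) \o @col_of_tuple R P).
Proof.
rewrite (_ : _ \o _ = fun t => col t i 0 - mu0 i 0).
  by apply: measurable_funB => //; exact: measurable_coord.
by apply/funext => t; rewrite /= !mxE.
Qed.

Lemma gdom_coordB i : gdom (fun y => (y - mu0) i 0).
Proof.
apply: (@growth_gdom _ 1); first exact: measurable_coordB.
by move=> y; rewrite mul1r coord_growth.
Qed.

(** Comes from [gE_fd] with the constant function 1: all its differences vanish, so the limit, which
    is the mean of the centred coordinate over sigma^2, is 0. *)
Lemma gE_coordB i : E (fun y => (y - mu0) i 0) = 0.
Proof.
have := @gE_fd R P sigma mu0 sigma0 i (fun=> 1) 1.
move=> /(_ _ _)/wrap[||]; [exact: measurable_cst|by apply: aeW => t; rewrite normr1|].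
under eq_fun do under [X in gE _ _ X]eq_fun do rewrite subrr mulr0.
under eq_fun do rewrite gE_cst//.
under [in X in _ --> X]eq_fun do rewrite mul1r mulrC.
rewrite gEZ//; last exact: gdom_coordB.
move=> /(fun H => cvg_unique (@Rhausdorff R) H (cvg_cst _)) /eqP.
by rewrite mulf_eq0 invr_eq0 expf_eq0/= gt_eqF//= => /eqP.
Qed.

Lemma gdom_mulmx M (A : 'M[R]_(M, P)) m : gdom (fun y => (A *m (y - mu0)) m 0).
Proof.
under eq_fun do rewrite mxE; apply: gdom_sum => // i.
by apply: gdomZ; exact: gdom_coordB.
Qed.

Lemma gE_mulmx M (A : 'M[R]_(M, P)) m : E (fun y => (A *m (y - mu0)) m 0) = 0.
Proof.
under eq_fun do rewrite mxE; rewrite gE_sum//.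
  by rewrite big1// => i _; rewrite gEZ ?gE_coordB ?mulr0//; exact: gdom_coordB.
by move=> i; apply: gdomZ; exact: gdom_coordB.
Qed.

(** A (Y - mu0) has mean zero, so subtracting the mean of [Z] from the other factor does not change
    the expectation. *)
Lemma gcov_mulmx M (A : 'M[R]_(M, P)) m (Z : 'cV[R]_P -> R) : gdom Z ->
  gdom (fun y => (A *m (y - mu0)) m 0 * Z y) ->
  gcov sigma mu0 (fun y => (A *m y) m 0) Z = E (fun y => (A *m (y - mu0)) m 0 * Z y).
Proof.
move=> dZ dAZ; have dA := gdom_mulmx A m.
have mB (N K : 'cV[R]_M) : (N - K) m 0 = N m 0 - K m 0 by rewrite !mxE.
rewrite /gcov.
have -> : E (fun y => (A *m y) m 0) = (A *m mu0) m 0.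
  rewrite (_ : (fun y => _) = fun y => (A *m (y - mu0)) m 0 + (A *m mu0) m 0).
    by rewrite gED ?gE_cst ?gE_mulmx ?add0r//; exact: gdom_cst.
  by apply/funext => y; rewrite mulmxBr mB subrK.
rewrite (_ : (fun y => _) = fun y => (A *m (y - mu0)) m 0 * Z y +
    (- E Z) * (A *m (y - mu0)) m 0).
  by rewrite gED ?gEZ ?gE_mulmx ?mulr0 ?addr0//; exact: gdomZ.
by apply/funext => y; rewrite mulmxBr mB; ring.
Qed.

End gauss_moments.

Section sugar_limit.
Context {R : realType} (d P M : nat) (sigma : R) (A : 'M[R]_(M, P)) (mu0 : 'cV[R]_P)
  (mu : 'cV[R]_P -> 'cV[R]_d -> 'cV[R]_P) (J : 'cV[R]_P -> 'cV[R]_d -> 'M[R]_(P, d))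
  (theta : 'cV[R]_d) (L : R).
Hypothesis sigma0 : 0 < sigma.
Local Notation col := (@col_of_tuple R _).
Local Notation lam := (tmeas P).
Local Notation E := (gE sigma mu0).
Local Notation gdom := (gdom sigma mu0).
Hypothesis mJ : forall p j,
  measurable_fun setT ((fun y => J y theta p j) \o @col_of_tuple R P).
Hypothesis JL : forall p j, {ae lam, forall t, `|J (col t) theta p j| <= L}.

(** The covariance integrand of the degrees of freedom with A mu replaced by its derivative A J; it
    is the common value in which the two computations of the gradient meet. *)
Definition df_integrand j (y : 'cV[R]_P) : R :=
  \sum_m (A *m (y - mu0)) m 0 * ((sigma ^+ 2)^-1 * (A *m J y theta) m j).

Let h j i (y : 'cV[R]_P) : R := ((J y theta)^T *m (A^T *m A)) j i.

Let hE j i y : h j i y = \sum_p J y theta p j * (A^T *m A) p i.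
Proof. by rewrite /h mxE; apply: eq_bigr => p _; rewrite mxE. Qed.

Let mh j i : measurable_fun setT (h j i \o @col_of_tuple R P).
Proof.
rewrite (_ : _ \o _ = fun t => \sum_p J (col t) theta p j * (A^T *m A) p i).
  by apply: measurable_sum => p; apply: measurable_funM => //; exact: mJ.
by apply/funext => t; exact: hE.
Qed.

Let hL j i : {ae lam, forall t, `|h j i (col t)| <= \sum_p L * `|(A^T *m A) p i|}.
Proof.
have : {ae lam, forall t, forall p, `|J (col t) theta p j| <= L}.
  by apply: filter_forall => p; exact: JL.
apply: filterS => t Jt; rewrite hE (le_trans (ler_norm_sum _ _ _))//.
by apply: ler_sum => p _; rewrite normrM ler_wpM2r.
Qed.

Let AJL m j : exists C, {ae lam, forall t, `|(A *m J (col t) theta) m j| <= C}.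
Proof.
exists (\sum_p `|A m p| * L).
have : {ae lam, forall t, forall p, `|J (col t) theta p j| <= L}.
  by apply: filter_forall => p; exact: JL.
apply: filterS => t Jt; rewrite mxE (le_trans (ler_norm_sum _ _ _))//.
by apply: ler_sum => p _; rewrite normrM ler_wpM2l.
Qed.

Let mAJ m j : measurable_fun setT ((fun y => (A *m J y theta) m j) \o @col_of_tuple R P).
Proof.
rewrite (_ : _ \o _ = fun t => \sum_p A m p * J (col t) theta p j).
  by apply: measurable_sum => p; apply: measurable_funM => //; exact: mJ.
by apply/funext => t; rewrite /= mxE.
Qed.

Lemma gdom_AJM m j p : gdom p -> gdom (fun y => (A *m J y theta) m j * p y).
Proof. by have [C hC] := AJL m j; exact: (gdom_boundedM (mAJ m j) hC). Qed.

Lemma gdom_df_integrand j : gdom (df_integrand j).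
Proof.
apply: gdom_sum => // m.
rewrite (_ : (fun y => _) = fun y => (A *m J y theta) m j *
    ((sigma ^+ 2)^-1 * (A *m (y - mu0)) m 0)).
  by apply: gdom_AJM; apply: gdomZ; exact: gdom_mulmx.
by apply/funext => y; ring.
Qed.

Lemma grad_df_FDE y e j : grad_df_FD A J y theta e j 0 =
  \sum_i e^-1 * (h j i (y + e *: @ecv R P i) - h j i y).
Proof.
rewrite /grad_df_FD mxE summxE mulr_sumr; apply: eq_bigr => i _; congr (_ * _).
by rewrite -colE mxE linearB mulmxBl mxE [X in _ + X]mxE.
Qed.

Lemma gdom_grad_df_FD e j : gdom (fun y => grad_df_FD A J y theta e j 0).
Proof.
under eq_fun do rewrite grad_df_FDE; apply: gdom_sum => // i; apply: gdomZ.
under eq_fun do rewrite -mulN1r; apply: gdomD.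
  by apply: (gdom_shift mu0 sigma0 (mh j i) (hL j i)).
by apply: gdomZ; exact: (gdom_bounded mu0 sigma0 (mh j i) (hL j i)).
Qed.

(** Summing [gE_fd] over [i] produces the expectation of J^T A^T A (Y - mu0) / sigma^2, and
    regrouping J^T A^T as (A J)^T gives [df_integrand]. *)
Lemma cvg_grad_df_FD j :
  (fun e => E (fun y => grad_df_FD A J y theta e j 0)) @ (0:R)^'+ --> E (df_integrand j).
Proof.
have dq e i : gdom (fun y => e^-1 * (h j i (y + e *: @ecv R P i) - h j i y)).
  apply: gdomZ; under eq_fun do rewrite -mulN1r; apply: gdomD.
    by apply: (gdom_shift mu0 sigma0 (mh j i) (hL j i)).
  by apply: gdomZ; exact: (gdom_bounded mu0 sigma0 (mh j i) (hL j i)).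
have -> : (fun e => E (fun y => grad_df_FD A J y theta e j 0)) = (fun e =>
    \sum_i E (fun y => e^-1 * (h j i (y + e *: @ecv R P i) - h j i y))).
  apply/funext => e; rewrite -gE_sum//.
  by congr gE; apply/funext => y; exact: grad_df_FDE.
have -> : E (df_integrand j) = \sum_i E (fun y => h j i y * ((y - mu0) i 0 / sigma ^+ 2)).
  rewrite -gE_sum//; last first.
    move=> i; apply: (gdom_boundedM (mh j i) (hL j i)).
    by under eq_fun do rewrite mulrC; apply: gdomZ; exact: gdom_coordB.
  congr gE; apply/funext => y; rewrite /df_integrand.
  transitivity ((sigma ^+ 2)^-1 * ((J y theta)^T *m (A^T *m A) *m (y - mu0)) j 0).
    rewrite mulmxA -trmx_mul -mulmxA mxE mulr_sumr; apply: eq_bigr => m _.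
    by rewrite [X in _ = _ * (X * _)]mxE; ring.
  rewrite mxE mulr_sumr; apply: eq_bigr => i _; rewrite /h; ring.
by apply: cvg_big_sum => i; exact: (gE_fd sigma0 (mh j i) (hL j i)).
Qed.

(** In the limit the correction term contributes 2 (A J)^T A (Y - mu0), which changes mu - Y into mu
    - mu0 in the first term. The result is left as a sum of two equal products, the form that the
    product rule gives for the squared residual. *)
Lemma cvg_SUGAR_FD j : (forall i, gdom (fun y => mu y theta i 0)) ->
  (fun e => E (fun y => SUGAR_FD sigma A mu J y theta e j 0)) @ (0:R)^'+ -->
  E (fun y => \sum_m ((A *m J y theta) m j * (A *m (mu y theta - mu0)) m 0 +
                      (A *m (mu y theta - mu0)) m 0 * (A *m J y theta) m j)).
Proof.
move=> dmu.
pose f y := 2 * ((J y theta)^T *m (A^T *m A) *m (mu y theta - y)) j 0.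
have fE : f = fun y => 2 * \sum_m (A *m J y theta) m j * (A *m (mu y theta - y)) m 0.
  apply/funext => y; rewrite /f mulmxA -trmx_mul -mulmxA mxE; congr (_ * _).
  by apply: eq_bigr => m _; rewrite [X in X * _ = _]mxE.
have df : gdom f.
  rewrite fE; apply: gdomZ; apply: gdom_sum => // m; apply: gdom_AJM.
  under eq_fun do rewrite mxE; apply: gdom_sum => // p; apply: gdomZ.
  rewrite (_ : (fun y => _) = fun y => (mu y theta p 0 + - mu0 p 0) + -1 * (y - mu0) p 0).
    apply: gdomD; last by apply: gdomZ; exact: gdom_coordB.
    by apply: gdomD => //; exact: gdom_cst.
  by apply/funext => y; rewrite !mxE; ring.
have dD := gdom_df_integrand j; have dG e := gdom_grad_df_FD e j.
have -> : (fun e => E (fun y => SUGAR_FD sigma A mu J y theta e j 0)) =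
    (fun e => E f + (2 * sigma ^+ 2) * E (fun y => grad_df_FD A J y theta e j 0)).
  apply/funext => e; rewrite -gEZ// -gED//; last exact: gdomZ.
  by congr gE; apply/funext => y; rewrite /SUGAR_FD mxE; congr (_ + _); rewrite mxE.
rewrite [X in _ --> X](_ : _ = E f + (2 * sigma ^+ 2) * E (df_integrand j)); last first.
  rewrite -gEZ// -gED//; last exact: gdomZ.
  congr gE; apply/funext => y; rewrite fE /df_integrand !mulr_sumr -big_split/=.
  apply: eq_bigr => m _; rewrite !mulmxBr.
  have mB (N K : 'cV[R]_M) : (N - K) m 0 = N m 0 - K m 0 by rewrite !mxE.
  by rewrite !mB; field; rewrite gt_eqF.
by apply: cvgD; [exact: cvg_cst|apply: cvgM; [exact: cvg_cst|exact: cvg_grad_df_FD]].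
Qed.

End sugar_limit.

Section euclidean_norm.
Context {R : realType} (n : nat).
Implicit Type v : 'cV[R]_n.

Lemma coord_le_norm1 v i : `|v i 0| <= norm1 v.
Proof. by rewrite /norm1 (bigD1 i)//= lerDl sumr_ge0. Qed.

Lemma enorm_le_norm1 v : enorm v <= norm1 v.
Proof.
rewrite /enorm -[leRHS]ger0_norm ?norm1_ge0// -sqrtr_sqr ler_sqrt ?sqr_ge0//.
rewrite expr2 {1}/norm1 mulr_suml ler_sum// => i _.
by rewrite -(real_normK (num_real (v i 0))) expr2 ler_wpM2l// coord_le_norm1.
Qed.

Lemma coord_le_enorm v i : `|v i 0| <= enorm v.
Proof.
rewrite -sqrtr_sqr ler_sqrt ?enorm2_ge0//.
by rewrite /enorm2 (bigD1 i)//= lerDl sumr_ge0// => k _; rewrite sqr_ge0.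
Qed.

End euclidean_norm.

(** * Gradients of the risk and of the degrees of freedom *)

Section sure.
Context {R : realType} (d P M : nat) (Theta : set 'cV[R]_d)
  (sigma : R) (A : 'M[R]_(M, P)) (mu0 : 'cV[R]_P)
  (mu : 'cV[R]_P -> 'cV[R]_d -> 'cV[R]_P) (L1 L2 : R).
Hypotheses (oTheta : open Theta) (sigma0 : 0 < sigma) (L1_ge0 : 0 <= L1) (L2_ge0 : 0 <= L2).
Hypothesis mu_lip : forall theta, Theta theta -> forall y1 y2 i,
  `|mu y1 theta i 0 - mu y2 theta i 0| <= L1 * norm1 (y1 - y2).
Hypothesis mu00 : forall theta, Theta theta -> mu 0 theta = 0.
Hypothesis mu_lip2 : forall y th1 th2 i, Theta th1 -> Theta th2 ->
  `|mu y th1 i 0 - mu y th2 i 0| <= L2 * norm1 (th1 - th2).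
Local Notation RT := (measurableTypeR R).
Local Notation col := (@col_of_tuple R _).
Local Notation colpre D := (@col_of_tuple R _ @^-1` D).
Local Notation lam := (tmeas P).
Local Notation E := (gE sigma mu0).
Local Notation gdom := (gdom sigma mu0).
Local Notation growth_family := (growth_family mu0 Theta).
Local Notation lip_family := (lip_family sigma mu0 Theta).

Let growth_mu i : growth_family (fun y th => mu y th i 0).
Proof.
(* As mu vanishes at y = 0, it is at most L1 times the l^1 norm of y, which [norm1_growth] bounds.
   [L2] is added so that one constant serves both the growth and the Lipschitz bound. *)
exists (L1 * (P%:R + norm1 mu0) + L2).
have C0 : 0 <= L1 * (P%:R + norm1 mu0) by rewrite mulr_ge0// addr_ge0// norm1_ge0.
split.
- exact: addr_ge0.
- move=> th Tth; apply: (@continuous_measurable _ _ (fun y => mu y th i 0)).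
  by apply: (@lipschitz1_continuous _ _ _ L1) => x y; exact: mu_lip.
- move=> y th Tth; rewrite mulrDl.
  apply: (@le_trans _ _ (L1 * (P%:R + norm1 mu0) * growth mu0 y)); last first.
    by rewrite lerDl mulr_ge0// growth_ge0.
  have := mu_lip Tth y 0 i; rewrite mu00// mxE !subr0 => /le_trans -> //.
  by rewrite -mulrA ler_wpM2l// norm1_growth.
- move=> y th1 th2 T1 T2; apply: le_trans (mu_lip2 y i T1 T2) _.
  by rewrite ler_wpM2r ?norm1_ge0// lerDr.
Qed.

Let resid m y th := (A *m (mu y th - mu0)) m 0.
Let fit m y th := (A *m mu y th) m 0.

Let growth_resid m : growth_family (resid m).
Proof.
apply: growth_family_mulmx => i.
rewrite (_ : (fun y th => _) = fun y th => mu y th i 0 + - mu0 i 0).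
  by apply: growth_familyD => //; exact: growth_family_cst.
by apply/funext => y; apply/funext => th; rewrite !mxE.
Qed.

Let growth_fit m : growth_family (fit m).
Proof. exact: growth_family_mulmx. Qed.

Let lip_risk : lip_family (fun y th => \sum_m resid m y th * resid m y th).
Proof. by apply: lip_family_sum => m; exact: lip_family_growthM. Qed.

Let df_term m y th := (A *m (y - mu0)) m 0 * ((sigma ^+ 2)^-1 * fit m y th).

Let lip_df_term m : lip_family (df_term m).
Proof.
apply: lip_family_growthM; last exact: growth_familyZ.
by apply: growth_family_mulmx => i; exact: growth_family_coord.
Qed.

Let lip_dof : lip_family (fun y th => \sum_m df_term m y th).
Proof. exact: lip_family_sum. Qed.

Let riskE th : risk sigma A mu0 mu th = E (fun y => \sum_m resid m y th * resid m y th).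
Proof.
by congr gE; apply/funext => y; apply: eq_bigr => m _; rewrite expr2.
Qed.

(** Unlike [riskE], this uses the linearity of [gE], hence the domination that is available for
    parameters in [Theta]. *)
Let dofE th : Theta th -> dof sigma A mu0 mu th = E (fun y => \sum_m df_term m y th).
Proof.
move=> Tth.
have dt m : gdom (df_term m ^~ th) := lip_family_gdom (lip_df_term m) Tth.
have dfit m : gdom (fit m ^~ th).
  by have [C [_ mf fC _]] := growth_fit m; apply: growth_gdom (mf _ Tth) (fun y => fC y _ Tth).
have prodE m : (fun y => (A *m (y - mu0)) m 0 * fit m y th) =
    (fun y => sigma ^+ 2 * df_term m y th).
  by apply/funext => y; rewrite /df_term; field; rewrite gt_eqF.
rewrite gE_sum// /dof mulr_suml; apply: eq_bigr => m _.
have dprod : gdom (fun y => (A *m (y - mu0)) m 0 * fit m y th).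
  by rewrite prodE; exact: gdomZ.
rewrite (gcov_mulmx sigma0 (dfit m) dprod) prodE gEZ// mulrAC divff ?mul1r//.
by rewrite gt_eqF// exprn_gt0.
Qed.

Lemma risk_dof_gradients : exists gR gdf : 'cV[R]_d -> 'cV[R]_d,
  weak_gradient Theta (risk sigma A mu0 mu) gR /\
  weak_gradient Theta (dof sigma A mu0 mu) gdf /\
  forall J : 'cV[R]_P -> 'cV[R]_d -> 'M[R]_(P, d),
    jmeasurable Theta J ->
    (forall y, weak_jacobian Theta (mu y) (J y)) ->
    ae_on Theta (fun theta =>
      ((fun eps => gEv sigma mu0 (fun y => SUGAR_FD sigma A mu J y theta eps))
         @ 0^'+ --> gR theta) /\
      ((fun eps => gEv sigma mu0 (fun y => grad_df_FD A J y theta eps))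
         @ 0^'+ --> gdf theta)).
Proof.
have [LR LR0 riskL] := lip_family_gE sigma0 lip_risk.
have [LD LD0 dofL] := lip_family_gE sigma0 lip_dof.
have riskL' x y : Theta x -> Theta y ->
    `|risk sigma A mu0 mu x - risk sigma A mu0 mu y| <= LR * norm1 (x - y).
  by move=> Tx Ty; rewrite !riskE; exact: riskL.
have dofL' x y : Theta x -> Theta y ->
    `|dof sigma A mu0 mu x - dof sigma A mu0 mu y| <= LD * norm1 (x - y).
  by move=> Tx Ty; rewrite !dofE//; exact: dofL.
have [gR [wgR _ gRE]] := lipschitz_on_weak_gradient oTheta LR0 riskL'.
have [gdf [wgdf _ gdfE]] := lipschitz_on_weak_gradient oTheta LD0 dofL'.
exists gR, gdf; split => //; split => // J mJ wJ.
(* The only place where parameters are discarded: everything below holds at each remaining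
   [theta]. *)
have aeJ : {ae tmeas d, forall t, Theta (col t) -> forall p j,
    {ae lam, forall s, (dq j ^~ (fun th => mu (col s) th p 0)) ^~ (col t) @ \oo -->
      J (col s) (col t) p j}}.
  have : {ae tmeas d, forall t, forall p j, Theta (col t) ->
    {ae lam, forall s, (dq j ^~ (fun th => mu (col s) th p 0)) ^~ (col t) @ \oo -->
      J (col s) (col t) p j}}.
    apply: filter_forall => p; apply: filter_forall => j.
    apply: (ae_dq_weak_gradient (f := fun y th => mu y th p 0)
      (g := fun y th => J y th p j) oTheta L2_ge0).
    - by move=> y th1 th2 T1 T2; exact: mu_lip2.
    - by move=> th Tth; apply: (@lipschitz1_continuous _ _ _ L1) => x y; exact: mu_lip.
    - exact: mJ.
    - by move=> y; exists (fun x => \col_j J y x p j); [exact: wJ|move=> th; rewrite mxE].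
  by apply: filterS => t H Tt p j; exact: H.
have [S [mS S0 SJ]] := aeJ.
apply: (ae_on_tmeas mS S0) => t Tt St.
have Jt p j : {ae lam, forall s, (dq j ^~ (fun th => mu (col s) th p 0)) ^~ (col t) @ \oo -->
    J (col s) (col t) p j}.
  by apply: contrapT => H; apply: St; apply: SJ => /(_ Tt p j) /H.
set theta := col t in Tt Jt *.
have mJt p j : measurable_fun setT ((fun y => J y theta p j) \o @col_of_tuple R P).
  have mT : measurable (colpre Theta) by exact: mset_open.
  have mJ0 := (measurable_restrictT _ (measurableX measurableT mT)).1 (mJ p j).
  rewrite (_ : _ \o _ = (fun s => ((fun z : P.-tuple RT * d.-tuple RT =>
    J (col z.1) (col z.2) p j) \_ (setT `*` colpre Theta)) (s, t))).
    exact: measurable_fun_pair1 mJ0.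
  by apply/funext => s; rewrite /patch mem_set.
(* A weak Jacobian comes without pointwise bound; this one is inherited from the difference
   quotients, which are bounded by [L2] and converge to [J] for almost every observation. *)
have JL p j : {ae lam, forall s, `|J (col s) theta p j| <= L2}.
  apply: filterS (Jt p j) => s Js.
  rewrite -(cvg_lim _ (cvg_norm Js))//; apply: limr_le.
    by apply/cvg_ex; exists `|J (col s) theta p j|; exact: cvg_norm.
  apply: (@filterS _ _ eventually_filter _ _ _ (near_shift_ecv j oTheta Tt)) => k Tk.
  rewrite normrM normr_nat -ler_pdivlMl// mulrC.
  apply: le_trans (mu_lip2 _ _ Tk Tt) _.
  by rewrite addrAC subrr add0r norm1Z norm1_ecv mulr1 ger0_norm.
have mAJ m j : measurable_fun setT ((fun y => (A *m J y theta) m j) \o @col_of_tuple R P).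
  rewrite (_ : _ \o _ = fun t => \sum_p A m p * J (col t) theta p j).
    by apply: measurable_sum => p; apply: measurable_funM => //; exact: mJt.
  by apply/funext => s; rewrite /= mxE.
have dq_fit j : {ae lam, forall s, forall m, (dq j ^~ (fit m (col s))) ^~ theta @ \oo -->
    (A *m J (col s) theta) m j}.
  have : {ae lam, forall s, forall p, (dq j ^~ (fun th => mu (col s) th p 0)) ^~ theta @ \oo -->
    J (col s) theta p j}.
    by apply: filter_forall => p; exact: Jt.
  apply: filterS => s Js m.
  rewrite mxE (_ : (dq j ^~ _) ^~ _ = fun k => \sum_p A m p *
      dq j k (fun th => mu (col s) th p 0) theta).
    by apply: cvg_big_sum => p; apply: cvgM; [exact: cvg_cst|exact: Js].
  apply/funext => k; rewrite -[RHS](eq_bigr _ (fun p _ => dqZ _ _ _ _ _)) -dq_sum.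
  by congr dq; apply/funext => th; rewrite /fit mxE.
have dq_resid j : {ae lam, forall s, forall m, (dq j ^~ (resid m (col s))) ^~ theta @ \oo -->
    (A *m J (col s) theta) m j}.
  apply: filterS (dq_fit j) => s Hs m.
  have -> : (dq j ^~ (resid m (col s))) ^~ theta = (dq j ^~ (fit m (col s))) ^~ theta.
    apply/funext => k; rewrite -[RHS](dqB_cst j theta ((A *m mu0) m 0)).
    by congr dq; apply/funext => th; rewrite /resid mulmxBr [LHS]mxE [X in _ + X]mxE.
  exact: Hs.
have gdom_mu i : gdom (fun y => mu y theta i 0).
  by have [C [_ mf fC _]] := growth_mu i; apply: growth_gdom (mf _ Tt) (fun y => fC y _ Tt).
(* The quotients of the risk converge at this very [theta], and by the construction of [gR] their
   limit is its value there. *)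
have gR_eq j : gR theta j 0 = E (fun y => \sum_m
   ((A *m J y theta) m j * resid m y theta + resid m y theta * (A *m J y theta) m j)).
  have mres m : measurable_fun setT ((resid m ^~ theta) \o @col_of_tuple R P).
    by have [C [_ mf _ _]] := growth_resid m; exact: mf.
  apply: gRE => //; rewrite (_ : risk _ _ _ _ = fun th =>
    E (fun y => \sum_m resid m y th * resid m y th)); last by apply/funext => th; exact: riskE.
  apply: (cvg_dq_gE sigma0 oTheta lip_risk Tt _ _).2.
    apply: measurable_sum => m; apply: measurable_funD; apply: measurable_funM => //;
      by [exact: mAJ|exact: mres].
  apply: filterS (dq_resid j) => s Hs.
  under eq_fun do rewrite dq_sum.
  by apply: cvg_big_sum => m; exact: cvg_dqM.
have gdf_eq j : gdf theta j 0 = E (df_integrand sigma A mu0 J theta j).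
  apply: gdfE => //.
  have [] := @cvg_dq_gE _ _ _ _ _ _ sigma0 oTheta _ theta j (df_integrand sigma A mu0 J theta j) lip_dof Tt.
  - apply: measurable_sum => m; apply: measurable_funM.
      by have [] : gdom (fun y => (A *m (y - mu0)) m 0) by exact: gdom_mulmx.
    by apply: measurable_funM => //; exact: mAJ.
  - apply: filterS (dq_fit j) => s Hs.
    under eq_fun do rewrite dq_sum.
    apply: cvg_big_sum => m; under eq_fun do rewrite !dqZ.
    by do 2 (apply: cvgM; first exact: cvg_cst).
  (* The degrees of freedom are known to equal this expectation on [Theta] only. The quotients of
     both agree once the shifted parameter lies in the open set [Theta]. *)
  move=> _ H; apply: (cvg_trans _ H); apply: (@near_eq_cvg _ _ \oo eventually_filter).
  have := @near_dq_eq _ _ _ (fun th => E (fun y => \sum_m df_term m y th))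
    (dof sigma A mu0 mu) j theta oTheta Tt dofE.
  by apply: (@filterS _ _ eventually_filter) => k.
split; apply: cvg_cV => j; rewrite /gEv.
  rewrite gR_eq; under eq_fun do rewrite mxE.
  exact: (cvg_SUGAR_FD (L := L2)).
rewrite gdf_eq; under eq_fun do rewrite mxE.
exact: (cvg_grad_df_FD (L := L2)).
Qed.

End sure.

Theorem theorem1 (R : realType) (d P M : nat) (Theta : set 'cV[R]_d)
  (sigma : R) (A : 'M[R]_(M, P)) (mu0 : 'cV[R]_P)
  (mu : 'cV[R]_P -> 'cV[R]_d -> 'cV[R]_P) :
  open Theta ->
  0 < sigma ->
  (* (A.1) *)
  (exists L1 : R, forall theta, Theta theta -> forall y1 y2 : 'cV[R]_P,
      enorm (mu y1 theta - mu y2 theta) <= L1 * enorm (y1 - y2)) ->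
  (* (A.2) *)
  (forall theta, Theta theta -> mu 0 theta = 0) ->
  (* (A.3) *)
  (exists L2 : R, forall (y : 'cV[R]_P) theta1 theta2,
      Theta theta1 -> Theta theta2 ->
      enorm (mu y theta1 - mu y theta2) <= L2 * enorm (theta1 - theta2)) ->
  exists gR gdf : 'cV[R]_d -> 'cV[R]_d,
    weak_gradient Theta (risk sigma A mu0 mu) gR /\
    weak_gradient Theta (dof sigma A mu0 mu) gdf /\
    forall J : 'cV[R]_P -> 'cV[R]_d -> 'M[R]_(P, d),
      jmeasurable Theta J ->
      (forall y, weak_jacobian Theta (mu y) (J y)) ->
      ae_on Theta (fun theta =>
        ((fun eps => gEv sigma mu0 (fun y => SUGAR_FD sigma A mu J y theta eps))
           @ 0^'+ --> gR theta) /\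
        ((fun eps => gEv sigma mu0 (fun y => grad_df_FD A J y theta eps))
           @ 0^'+ --> gdf theta)).
Proof.
move=> oTheta sigma0 [L1 muL1] mu00 [L2 muL2].
(* The given constants may be negative, and monotonicity in the norm needs a nonnegative factor;
   hence the absolute value. *)
have norm_le n m (L : R) (u : 'cV[R]_n) (v : 'cV[R]_m) i :
    enorm u <= L * enorm v -> `|u i 0| <= `|L| * norm1 v.
  move=> uv; apply: (le_trans (coord_le_enorm u i)); apply: (le_trans uv).
  apply: (@le_trans _ _ (`|L| * enorm v)).
    by rewrite ler_wpM2r ?sqrtr_ge0// ler_norm.
  by rewrite ler_wpM2l// enorm_le_norm1.
have mB n (u v : 'cV[R]_n) i : u i 0 - v i 0 = (u - v) i 0 by rewrite !mxE.
apply: (@risk_dof_gradients R d P M Theta sigma A mu0 mu `|L1| `|L2|) => //.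
- by move=> th Tth y1 y2 i; rewrite mB; apply: norm_le; exact: muL1.
- by move=> y th1 th2 i T1 T2; rewrite mB; apply: norm_le; exact: muL2.
Qed.
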